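(* Let $\Phi$ be a field of characteristic zero, let $s$ be a natural number, and let $\mathbf{V}$ be a subvariety of the variety $\widetilde{\mathbf{N}_s\mathbf{A}}$ of Leibniz algebras over $\Phi$. Suppose that there exist natural numbers $k, m$ with $k\le m$ and scalars $\alpha_1,\dots,\alpha_k\in\Phi$ such that every algebra in $\mathbf{V}$ satisfies the identity $$xY^kzY^{m-k} \equiv \sum_{i=1}^k \alpha_i\, xY^{k-i}zY^{m-k+i}.$$ Then $\mathbf{V}$ has finite colength, i.e. there exists a constant $C$ independent of $n$ such that $l_n(\mathbf{V})\le C$ for all $n$.
   Context: A Leibniz algebra over $\Phi$ is a (not necessarily associative) linear algebra with bilinear multiplication satisfying the identity $(xy)z\equiv (xz)y+x(yz)$. Brackets are omitted in left-normed products: $abc\cdots d=(((ab)c)\cdots)d$; a bracketed expression such as $(x_1x_2)$ is a single factor in such a product. $Y$ denotes the operator of right multiplication by $y$, so $xY=xy$, $xY^k = x\underbrace{y\cdots y}_{k}$ (left-normed), and $xY^kzY^{m-k}$ is the left-normed product $x\underbrace{y\cdots y}_{k}z\underbrace{y\cdots y}_{m-k}$. A variety of linear algebras over $\Phi$ is the class of all algebras over $\Phi$ satisfying a fixed set of identities. $\widetilde{\mathbf{N}_s\mathbf{A}}$ is the variety of all Leibniz algebras over $\Phi$ satisfying the identity $(x_1x_2)(x_3x_4)\cdots(x_{2s+1}x_{2s+2})\equiv 0$ (left-normed product of $s+1$ factors). For a variety $\mathbf{V}$, let $F(X,\mathbf{V})$ be its relatively free algebra on the countable set of free generators $X=\{x_1,x_2,\dots\}$,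 and let $P_n(\mathbf{V})$ be the subspace of $F(X,\mathbf{V})$ of elements multilinear in $x_1,\dots,x_n$ (the multilinear part). The symmetric group $S_n$ acts on $P_n(\mathbf{V})$ by permuting the variables, making it a $\Phi S_n$-module. Its character decomposes as $\chi(P_n(\mathbf{V}))=\sum_{\lambda\vdash n}m_\lambda\chi_\lambda$, where $\chi_\lambda$ is the irreducible character of $S_n$ corresponding to the partition $\lambda$ of $n$. The colength of $\mathbf{V}$ is $l_n(\mathbf{V})=\sum_{\lambda\vdash n}m_\lambda$. *)

(* Defs.v *)
From HB Require Import structures.
From mathcomp Require Import all_boot all_order all_algebra all_fingroup.
From mathcomp Require Import sesquilinear generic_quotient ring_quotient.
From mathcomp Require Import mxrepresentation boolp finmap monalg.

Set Implicit Arguments.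
Unset Strict Implicit.
Unset Printing Implicit Defensive.

Import GRing.Theory.
Local Open Scope ring_scope.
Local Open Scope quotient_scope.

Declare Scope linalg_scope.
Delimit Scope linalg_scope with LA.

Record linAlgebra (Phi : fieldType) := LinAlgebra {
  carrier :> lmodType Phi;
  amul : {bilinear carrier -> carrier -> carrier}
}.

Notation "x ** y" := (amul _ x y) (at level 40, left associativity) :
  linalg_scope.
Local Open Scope linalg_scope.

(* The left-normed product x y ... y, with k factors y. *)
Definition rmulX (Phi : fieldType) (A : linAlgebra Phi) (x y : A) (k : nat)
  : A := iter k (fun u => u ** y) x.

Definition leibniz (Phi : fieldType) (A : linAlgebra Phi) : Prop :=
  forall x y z : A, (x ** y) ** z = (x ** z) ** y + x ** (y ** z).

(* The i-th factor of the identity (counted from 0) is (x_(2i) x_(2i+1)). *)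
Definition satisfies_NsA (Phi : fieldType) (s : nat) (A : linAlgebra Phi)
  : Prop :=
  forall x : nat -> A,
    foldl (fun u i => u ** (x i.*2 ** x i.*2.+1)) (x 0%N ** x 1%N) (iota 1 s)
      = 0.

Definition leibniz_NsA (Phi : fieldType) (s : nat) (A : linAlgebra Phi)
  : Prop := leibniz A /\ satisfies_NsA s A.

Inductive magma := Letter of nat | Prod of magma & magma.

Fixpoint tree_of_magma (t : magma) : GenTree.tree nat :=
  match t with
  | Letter i => GenTree.Leaf i
  | Prod u v => GenTree.Node 0 [:: tree_of_magma u; tree_of_magma v]
  end.

Fixpoint magma_of_tree (t : GenTree.tree nat) : option magma :=
  match t with
  | GenTree.Leaf i => Some (Letter i)
  | GenTree.Node _ [:: u; v] =>
      if magma_of_tree u is Some u' then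
        if magma_of_tree v is Some v' then Some (Prod u' v') else None
      else None
  | _ => None
  end.

Lemma tree_of_magmaK : pcancel tree_of_magma magma_of_tree.
Proof. by elim=> //= u -> v ->. Qed.

HB.instance Definition _ := Countable.copy magma (pcan_type tree_of_magmaK).

Fixpoint letters (t : magma) : seq nat :=
  match t with
  | Letter i => [:: i]
  | Prod u v => letters u ++ letters v
  end.

Fixpoint relabel (g : nat -> nat) (t : magma) : magma :=
  match t with
  | Letter i => Letter (g i)
  | Prod u v => Prod (relabel g u) (relabel g v)
  end.

Fixpoint mageval (Phi : fieldType) (A : linAlgebra Phi) (a : nat -> A)
    (t : magma) : A :=
  match t with
  | Letter i => a i
  | Prod u v => mageval a u ** mageval a v
  end.

(* {malg Phi[magma]} is the underlying space of the absolutely free linear  *)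
(* algebra on x_0, x_1, ... *)
Section FreeAlgebra.
Variable Phi : fieldType.
Implicit Types (f g h : {malg Phi[magma]}) (A : linAlgebra Phi).

Definition linext (W : lmodType Phi) (e : magma -> W) f : W :=
  \sum_(t <- msupp f) f@_t *: e t.

Lemma linextEw (W : lmodType Phi) (e : magma -> W) f (D : {fset magma}) :
  (msupp f `<=` D)%fset -> linext e f = \sum_(t <- D) f@_t *: e t.
Proof.
move=> sfD; rewrite /linext (big_fset_incl _ sfD) //= => t _ tNf.
by rewrite mcoeff_outdom // scale0r.
Qed.

Lemma linext_is_linear (W : lmodType Phi) (e : magma -> W) :
  linear (linext e).
Proof.
move=> c f g; pose D := (msupp (c *: f + g) `|` msupp f `|` msupp g)%fset.
rewrite !(@linextEw _ _ _ D) /D; last 3 first.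
- by rewrite fsubsetUr.
- by rewrite -fsetUA fsetUCA fsubsetUl.
- by rewrite -fsetUA fsubsetUl.
rewrite scaler_sumr -big_split; apply: eq_bigr => t _ /=.
by rewrite mcoeffD mcoeffZ scalerDl scalerA.
Qed.

HB.instance Definition _ (W : lmodType Phi) (e : magma -> W) :=
  GRing.isLinear.Build Phi {malg Phi[magma]} W _ (linext e)
    (linext_is_linear e).

Lemma linextU (W : lmodType Phi) (e : magma -> W) t :
  linext e << t >> = e t.
Proof.
by rewrite (linextEw _ msuppU_le) big_seq_fset1 mcoeffUU scale1r.
Qed.

Lemma linext_comp (W W' : lmodType Phi) (e : magma -> W)
    (k : {linear W -> W'}) f : k (linext e f) = linext (k \o e) f.
Proof.
rewrite /linext raddf_sum; apply: eq_bigr => t _. exact: linearZZ.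
Qed.

Lemma eq_linext (W : lmodType Phi) (e e' : magma -> W) :
  e =1 e' -> linext e =1 linext e'.
Proof. by move=> ee' f; apply: eq_bigr => t _; rewrite ee'. Qed.

Definition free_mul f g : {malg Phi[magma]} :=
  linext (fun t => linext (fun u => << Prod t u >>) g) f.

Definition relabel_poly (r : nat -> nat) f : {malg Phi[magma]} :=
  linext (fun t => << relabel r t >>) f.

Definition polyeval A (a : nat -> A) f : A := linext (mageval a) f.

Lemma free_mul_bilinear : bilinear_for *:%R *:%R free_mul.
Proof.
split=> [g c f f' | f c g g']; rewrite /free_mul /=.
  by rewrite linearP.
rewrite /linext scaler_sumr -big_split; apply: eq_bigr => t _ /=.
by rewrite -/(linext _ _) linearP scalerDr !scalerA mulrC.
Qed.

HB.instance Definition _ :=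
  bilinear_isBilinear.Build Phi _ _ _ _ _ free_mul free_mul_bilinear.

Definition free_algebra : linAlgebra Phi :=
  @LinAlgebra Phi {malg Phi[magma]} free_mul.

Lemma polyevalM A (a : nat -> A) f g :
  polyeval a (free_mul f g) = polyeval a f ** polyeval a g.
Proof.
rewrite /polyeval /free_mul (linext_comp _ (linext (mageval a))).
rewrite [linext (mageval a) f]/linext linear_sumlz; apply: eq_bigr => t _.
rewrite /= linearZl_LR; congr (_ *: _).
rewrite (linext_comp _ (linext (mageval a))) [in RHS]/linext linear_sumr.
by apply: eq_bigr => u _; rewrite /= linextU linearZr_LR.
Qed.

Lemma polyeval_relabel A (a : nat -> A) (r : nat -> nat) f :
  polyeval a (relabel_poly r f) = polyeval (a \o r) f.
Proof.
rewrite /polyeval /relabel_poly (linext_comp _ (linext (mageval a))).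
apply: eq_linext => t /=; rewrite linextU.
by elim: t => //= u -> v ->.
Qed.

End FreeAlgebra.

Section Variety.
Variable Phi : fieldType.

Definition satisfies (A : linAlgebra Phi) (f : {malg Phi[magma]}) : Prop :=
  forall a : nat -> A, polyeval a f = 0.

Definition variety (V : linAlgebra Phi -> Prop) : Prop :=
  exists I : {malg Phi[magma]} -> Prop,
    forall A, V A <-> (forall f, I f -> satisfies A f).

Variable V : linAlgebra Phi -> Prop.

Definition identities : {pred {malg Phi[magma]}} :=
  fun f => `[< forall A, V A -> satisfies A f >].

Lemma identitiesP f :
  reflect (forall A, V A -> satisfies A f) (f \in identities).
Proof. exact: asboolP. Qed.

Lemma identities_submod : submod_closed identities.
Proof.
split=> [|c f g /identitiesP If /identitiesP Ig]; apply/identitiesP => A VA a.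
  by rewrite /polyeval linear0.
have := If A VA a; have := Ig A VA a; rewrite /polyeval linearP /= => -> ->.
by rewrite scaler0 addr0.
Qed.

HB.instance Definition _ :=
  GRing.isSubmodClosed.Build Phi {malg Phi[magma]} identities identities_submod.

Lemma identitiesMl f g : f \in identities -> free_mul f g \in identities.
Proof.
move=> /identitiesP If; apply/identitiesP => A VA a.
by rewrite polyevalM If // linear0l.
Qed.

Lemma identitiesMr f g : g \in identities -> free_mul f g \in identities.
Proof.
move=> /identitiesP Ig; apply/identitiesP => A VA a.
by rewrite polyevalM Ig // linear0r.
Qed.

Lemma identities_relabel r f :
  f \in identities -> relabel_poly r f \in identities.
Proof.
move=> /identitiesP If; apply/identitiesP => A VA a.
by rewrite polyeval_relabel If.
Qed.

(* The relatively free algebra F(X, V) is the quotient of the absolutely    *)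
(* free algebra by the ideal of the identities of V. *)
Definition relfree := Quotient.quot identities.
HB.instance Definition _ := GRing.Zmodule.on relfree.

Definition to_relfree : {malg Phi[magma]} -> relfree := \pi_relfree.

Lemma to_relfree_eq f g :
  to_relfree f = to_relfree g <-> f - g \in identities.
Proof.
by rewrite /to_relfree Quotient.idealrBE; split=> [->|/eqP].
Qed.

Lemma to_relfreeD : {morph to_relfree : f g / f + g}.
Proof. by move=> f g; rewrite /to_relfree raddfD. Qed.

Lemma to_relfreeK u : to_relfree (repr u) = u.
Proof. exact: reprK. Qed.

Lemma repr_to_relfree f : f - repr (to_relfree f) \in identities.
Proof. by apply/to_relfree_eq; rewrite to_relfreeK. Qed.

(* A linear map that preserves the identities of V acts on F(X, V). *)
Definition relfree_lift (h : {malg Phi[magma]} -> {malg Phi[magma]})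
  (u : relfree) : relfree := to_relfree (h (repr u)).

Lemma relfree_liftE (h : {linear {malg Phi[magma]} -> {malg Phi[magma]}}) :
  (forall f, f \in identities -> h f \in identities) ->
  forall f, relfree_lift h (to_relfree f) = to_relfree (h f).
Proof.
move=> hI f; apply/esym/to_relfree_eq; rewrite -raddfB.
exact/hI/repr_to_relfree.
Qed.

Definition relfree_scale (c : Phi) : relfree -> relfree :=
  relfree_lift ( *:%R c).

Lemma relfree_scaleE c f :
  relfree_scale c (to_relfree f) = to_relfree (c *: f).
Proof. by apply: (relfree_liftE (h := *:%R c)) => g; apply: rpredZ. Qed.

Lemma relfree_scaleA a b u :
  relfree_scale a (relfree_scale b u) = relfree_scale (a * b) u.
Proof. by rewrite -[u]to_relfreeK !relfree_scaleE scalerA. Qed.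

Lemma relfree_scale1 : left_id 1 relfree_scale.
Proof. by move=> u; rewrite -[u]to_relfreeK relfree_scaleE scale1r. Qed.

Lemma relfree_scaleDr : right_distributive relfree_scale +%R.
Proof.
move=> c u v; rewrite -[u]to_relfreeK -[v]to_relfreeK -to_relfreeD.
by rewrite !relfree_scaleE scalerDr to_relfreeD.
Qed.

Lemma relfree_scaleDl u : {morph relfree_scale^~ u : a b / a + b}.
Proof.
move=> a b; rewrite -[u]to_relfreeK !relfree_scaleE.
by rewrite scalerDl to_relfreeD.
Qed.

HB.instance Definition _ := GRing.Zmodule_isLmodule.Build Phi relfree
  relfree_scaleA relfree_scale1 relfree_scaleDr relfree_scaleDl.

Lemma to_relfree_is_linear : linear to_relfree.
Proof. by move=> c f g; rewrite to_relfreeD -relfree_scaleE. Qed.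

HB.instance Definition _ :=
  GRing.isLinear.Build Phi _ relfree _ to_relfree to_relfree_is_linear.

Definition relfree_mul (u v : relfree) : relfree :=
  to_relfree (free_mul (repr u) (repr v)).

Lemma relfree_mulE f g :
  relfree_mul (to_relfree f) (to_relfree g) = to_relfree (free_mul f g).
Proof.
apply/esym/to_relfree_eq; set f' := repr _; set g' := repr _.
rewrite -(subrK (free_mul f' g) (free_mul f g)) -addrA.
rewrite -linearBl -linearBr rpredD //.
  exact/identitiesMl/repr_to_relfree.
exact/identitiesMr/repr_to_relfree.
Qed.

Lemma relfree_mul_bilinear : bilinear_for *:%R *:%R relfree_mul.
Proof.
by split=> u c v w; rewrite -[u]to_relfreeK -[v]to_relfreeK -[w]to_relfreeK;
  rewrite -linearP !relfree_mulE ?linearPl ?linearPr linearP.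
Qed.

HB.instance Definition _ :=
  bilinear_isBilinear.Build Phi _ _ _ _ _ relfree_mul relfree_mul_bilinear.

Definition relfree_algebra : linAlgebra Phi :=
  @LinAlgebra Phi relfree relfree_mul.

End Variety.

Section Multilinear.
Variables (Phi : fieldType) (V : linAlgebra Phi -> Prop) (n : nat).

(* The variables x_1, ..., x_n are the letters 0, ..., n - 1. *)
Definition multilinear_poly (f : {malg Phi[magma]}) : Prop :=
  forall t, t \in msupp f -> perm_eq (letters t) (iota 0 n).

Definition multilinear (u : relfree V) : Prop :=
  exists2 f, multilinear_poly f & u = to_relfree V f.

Definition perm_letter (s : 'S_n) (i : nat) : nat :=
  if insub i is Some j then s j else i.

Definition perm_act (s : 'S_n) : relfree V -> relfree V :=
  relfree_lift (relabel_poly (perm_letter s)).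

Lemma perm_actE s f :
  perm_act s (to_relfree V f) = to_relfree V (relabel_poly (perm_letter s) f).
Proof.
apply: (relfree_liftE (h := relabel_poly (perm_letter s))) => g.
exact: identities_relabel.
Qed.

(* The module P_n(V) is given by the matrices of the action of S_n in a     *)
(* basis b of P_n(V); the rows of rG s are the coordinates of the images. *)
Definition affords_multilinear (d : nat)
    (rG : mx_representation Phi [set: 'S_n]%G d) : Prop :=
  exists b : 'I_d -> relfree V,
    [/\ forall i, multilinear (b i),
        forall u, multilinear u ->
          exists! c : 'rV[Phi]_d, u = \sum_i c 0 i *: b i
      & forall s i, perm_act s (b i) = \sum_j rG s i j *: b j].

End Multilinear.

Section YoungCharacters.
Variables (Phi : fieldType) (n : nat).

(* Partitions of n, padded with zeros to n parts. *)
Definition is_intpart (l : n.-tuple 'I_n.+1) : bool :=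
  let p := [seq val i | i <- l] in sorted geq p && (sumn p == n).

Definition intpart := {l : n.-tuple 'I_n.+1 | is_intpart l}.

Definition parts (l : intpart) : seq nat := [seq nat_of_ord i | i <- val l].

(* The tableau of shape l filled with 0, ..., n - 1 row by row: the number  *)
(* i is in row reshape_index (parts l) i, column reshape_offset (parts l) i.*)
Definition row_stab (l : intpart) : {set 'S_n} :=
  [set s : 'S_n | [forall i : 'I_n,
     reshape_index (parts l) (s i) == reshape_index (parts l) i]].

Definition col_stab (l : intpart) : {set 'S_n} :=
  [set s : 'S_n | [forall i : 'I_n,
     reshape_offset (parts l) (s i) == reshape_offset (parts l) i]].

Definition young_symmetrizer (l : intpart) : 'rV[Phi]_#|[set: 'S_n]%G| :=
  \sum_(r in row_stab l) \sum_(c in col_stab l)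
    (-1) ^+ c *: delta_mx 0 (gring_index [set: 'S_n]%G (r * c)%g).

(* The irreducible character of S_n of the partition l, afforded by the     *)
(* ideal of the group algebra generated by the Young symmetrizer. *)
Definition young_char (l : intpart) (s : 'S_n) : Phi :=
  \tr (submod_repr (cyclic_mx_module (regular_repr Phi [set: 'S_n]%G)
                                     (young_symmetrizer l)) s).

End YoungCharacters.

Definition is_colength (Phi : fieldType) (V : linAlgebra Phi -> Prop)
    (n l : nat) : Prop :=
  exists (d : nat) (rG : mx_representation Phi [set: 'S_n]%G d)
         (m : intpart n -> nat),
    [/\ affords_multilinear V rG,
        forall s : 'S_n,
          \tr (rG s) = \sum_(p : intpart n) (m p)%:R * young_char Phi p s
      & l = (\sum_(p : intpart n) m p)%N].

(* Main.v *)
(* Work in the relatively free algebra A of V, where a word is a generator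
   followed by right factors, and words with more than s factors in A^2 vanish.
   By elimination, the given identity yields for every r a nonzero binary form g
   such that, for all b, v and w_1, ..., w_r in A,
     sum_k g_k v b^k w_1 ... w_r b^(M-k) = 0.
   In a word whose factors in A^2 are p_1, ..., p_t the other letters sit in the
   t + 1 slots between the p's, and modulo words with more factors in A^2 their
   order in a slot is irrelevant; the polarised relations above thus let letters
   pass between two slots. This has two consequences.
   - There is Q such that alternating any Q disjoint pairs of variables kills the
     multilinear part P_n: many of the pairs join the same two slots, and the
     minors obtained by alternation are consequences of the polarised relation.
   - For every N, the sums of the elements of P_n over the symmetric group on
     n - N of the variables span a space of dimension at most C(N), independently
     of n: such a sum only depends on the number of symmetrised letters in each
     slot, and all but one of these numbers can be made smaller than a constant.
   By the first point with N = 2Q, a partition with m_lambda > 0 has first row at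
   least n - N: otherwise its columns contain Q disjoint pairs, so that the column
   antisymmetriser vanishes on P_n but not on the Specht module. For such lambda
   the sum over the symmetric group on n - N letters does not vanish on the Specht
   module, so the colength is at most the rank of this sum on P_n. *)
From HB Require Import structures.
Require Import Defs.
From mathcomp Require Import all_boot all_order all_algebra all_fingroup.
From mathcomp Require Import zify ring.
From mathcomp Require Import mxrepresentation boolp generic_quotient finmap.
From mathcomp Require mpoly ssrcomplements.

Set Implicit Arguments.
Unset Strict Implicit.
Unset Printing Implicit Defensive.

Import GRing.Theory.
Local Open Scope ring_scope.
Local Open Scope linalg_scope.

(** * Elimination for binary forms *)

(** The given identity has one factor between the two blocks of [b]. To reach [r] factors, fix [B]
    and regard [v w B] as a function of [(v, w)]: multiplying [v], [w] or the value by [b] are three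
    commuting operators, so polynomials in three variables act, and those that annihilate the
    function form an ideal. The Leibniz rule makes [b] act on [v w] as the sum of the first two
    operators, and passing from [r] to [r + 1] factors becomes elimination in a commutative ring.
    Both consequences are proved by descending induction on the number [t] of factors in the square
    of the algebra, from [t = s + 1], where every word vanishes. Factors are first cut down to
    letters and products of two letters, so that only [2 t + 1] letters lie outside the slots; the
    cost of each level then does not depend on [n]. Multiplicities enter through traces alone: a
    signed sum over a group [H] satisfies [S S = |H| S], so its trace is [|H|] times its rank, and
    the equality of characters becomes an equality of ranks. Characteristic zero keeps the
    factorials [k! (M - k)!] of polarisation and the numbers of coinciding terms from vanishing. *)

Section Forms.
Variable Phi : fieldType.
Implicit Types (p q g : {poly Phi}).

Section InAlgebra.
Variable R : comAlgType Phi.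
Implicit Types (a z : R).

(* The homogenisation of p in degree D, evaluated at (a, z). *)
Definition form p D a z : R := \sum_(k < D.+1) p`_k *: (a ^+ k * z ^+ (D - k)).

Lemma formD p q D a z : form (p + q) D a z = form p D a z + form q D a z.
Proof.
by rewrite /form -big_split /=; apply: eq_bigr => k _; rewrite coefD scalerDl.
Qed.

Lemma formZ c p D a z : form (c *: p) D a z = c *: form p D a z.
Proof.
by rewrite /form scaler_sumr; apply: eq_bigr => k _; rewrite coefZ scalerA.
Qed.

Lemma form0 D a z : form 0 D a z = 0.
Proof. by rewrite /form big1 // => k _; rewrite coef0 scale0r. Qed.

Lemma form_sum I (r : seq I) (p : I -> {poly Phi}) D a z :
  form (\sum_(i <- r) p i) D a z = \sum_(i <- r) form (p i) D a z.
Proof.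
elim: r => [|i r IH]; first by rewrite !big_nil form0.
by rewrite !big_cons formD IH.
Qed.

Lemma formXM q D a z : form ('X * q) D.+1 a z = a * form q D a z.
Proof.
rewrite /form big_ord_recl coefXM scale0r add0r mulr_sumr; apply: eq_bigr => k _.
by rewrite coefXM lift0 /= subSS exprS -mulrA scalerAr.
Qed.

Lemma formS q D a z : (size q <= D.+1)%N -> form q D.+1 a z = z * form q D a z.
Proof.
move=> sq; rewrite /form big_ord_recr /= nth_default // scale0r addr0 mulr_sumr.
apply: eq_bigr => k _; rewrite -scalerAr mulrCA -exprS subSn //.
by rewrite -ltnS.
Qed.

Lemma formXnM q D a z i e : (size q <= D.+1)%N ->
  form ('X^i * q) (i + (e + D)) a z = a ^+ i * (z ^+ e * form q D a z).
Proof.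
move=> sq; elim: i => [|i IH]; last first.
  by rewrite !exprS -!mulrA addSn formXM IH.
rewrite !expr0 !mul1r add0n; elim: e => [|e IH]; first by rewrite expr0 mul1r.
rewrite addSn formS ?IH ?exprS ?mulrA //.
by rewrite (leq_trans sq) // ltnS leq_addl.
Qed.

(** Homogenisation is multiplicative as long as [form] cuts off no coefficient above the chosen
    degree; hence the size bounds. *)
Lemma formM p q D D' a z : (size p <= D.+1)%N -> (size q <= D'.+1)%N ->
  form (p * q) (D + D') a z = form p D a z * form q D' a z.
Proof.
move=> sp sq.
have -> : p = \sum_(i < D.+1) p`_i *: 'X^i.
  rewrite -[LHS]coefK (poly_def (size p)) (big_ord_widen _ (fun i => p`_i *: 'X^i) sp).
  rewrite big_mkcond; apply: eq_bigr => i _; case: ltnP => // le.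
  by rewrite nth_default // scale0r.
rewrite mulr_suml; set P := \sum_(i < D.+1) p`_i *: 'X^i.
rewrite !form_sum mulr_suml; apply: eq_bigr => i _.
rewrite -scalerAl !formZ -scalerAl; congr (_ *: _).
have : (i <= D)%N by rewrite -ltnS.
move: (nat_of_ord i) => k le_kD.
rewrite -{1 2}(subnKC le_kD) -addnA formXnM // mulrA; congr (_ * _).
rewrite -[in RHS](mulr1 'X^k) -[(D - k)%N]addn0 formXnM ?size_poly1 //.
by rewrite /form big_ord1 coef1 scale1r subnn !expr0 !mulr1 addn0.
Qed.

Lemma form_rev q D a z :
  form q D a z = form (\poly_(k < D.+1) q`_(D - k)) D z a.
Proof.
rewrite /form (reindex_inj rev_ord_inj); apply: eq_bigr => k _ /=.
have le_kD : (k <= D)%N by rewrite -ltnS.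
by rewrite coef_poly ltn_ord subSS subKn // mulrC.
Qed.

Lemma form_trunc (r : {poly Phi}) D E a z : (size r <= D)%N -> (D <= E.+1)%N ->
  form r E a z = \sum_(k < D) r`_k *: (a ^+ k * z ^+ (E - k)).
Proof.
move=> sr le_DE; rewrite (big_ord_widen E.+1 (fun k => r`_k *: (a ^+ k * z ^+ (E - k)))) //.
rewrite big_mkcond; apply: eq_bigr => k _; case: ltnP => // le_Dk.
by rewrite nth_default ?scale0r // (leq_trans sr).
Qed.

Definition is_ideal (J : R -> Prop) : Prop :=
  [/\ J 0, forall x y, J x -> J y -> J (x + y) & forall x y, J y -> J (x * y)].

Lemma ideal_sum (J : R -> Prop) I (r : seq I) (F : I -> R) :
  is_ideal J -> (forall i, J (F i)) -> J (\sum_(i <- r) F i).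
Proof. by case=> J0 JD _ JF; elim/big_ind: _. Qed.

Lemma idealZ (J : R -> Prop) c x : is_ideal J -> J x -> J (c *: x).
Proof. by case=> _ _ JM Jx; rewrite -mulr_algl; apply: JM. Qed.

End InAlgebra.

Lemma form_X1 p D : (size p <= D.+1)%N -> form p D ('X : {poly Phi}) 1 = p.
Proof.
move=> sp; rewrite /form -[RHS]coefK (poly_def (size p)).
rewrite (big_ord_widen _ (fun i => p`_i *: 'X^i) sp) [RHS]big_mkcond.
apply: eq_bigr => i _; rewrite expr1n mulr1; case: ltnP => // le.
by rewrite nth_default // scale0r.
Qed.

(** Euclidean division of ['X^i] by [p], homogenised in degree [m + i]: the quotient has degree at
    most [i], and its product with [form p m a y] is the difference. The remainder contains only
    powers of [a] below [m]. *)
Lemma form_reduce p m i : p != 0 -> (size p <= m.+1)%N ->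
  exists r : {poly Phi}, (size r <= m)%N /\ forall (R : comAlgType Phi) (a y : R) J,
    is_ideal J -> J (form p m a y) -> J (y ^+ m * a ^+ i - form r (m + i) a y).
Proof.
move=> p0 sp; exists ('X^i %% p); split.
  by rewrite -ltnS (leq_trans _ sp) // ltn_modp.
move=> R a y J [_ _ JM] Jp.
have sq : (size ('X^i %/ p)%R <= i.+1)%N.
  by rewrite size_divp // size_polyXn leq_subLR leq_addl.
have := formM a y sq sp; rewrite -[_ * p](addrK ('X^i %% p)) -divp_eq addnC.
rewrite formD -(scaleN1r (_ %% _)) formZ scaleN1r => E.
rewrite -[_ * a ^+ i](_ : form 'X^i (m + i) a y = _) ?E; first exact: JM.
have := @formXnM R 1 0 a y i m; rewrite size_poly1 mulr1 addn0 addnC => -> //.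
by rewrite /form big_ord1 coef1 scale1r subnn !expr0 !mulr1 mulrC.
Qed.

(* Modulo the ideal, y^m a^i and y^m' z^j lie in spans of m and m' monomials in
   which only a bounded power of a, resp. z, occurs; thus among the M + 1 products
   y^(m + m') a^i z^(M - i), where M = m m', there is a linear relation. *)
Lemma form_eliminate p q m m' : p != 0 -> (size p <= m.+1)%N ->
    q != 0 -> (size q <= m'.+1)%N ->
  exists (h : {poly Phi}) M N, [/\ h != 0, (size h <= M.+1)%N &
    forall (R : comAlgType Phi) (a y z : R) J, is_ideal J ->
      J (form p m a y) -> J (form q m' y z) -> J (y ^+ N * form h M a z)].
Proof.
move=> p0 sp q0 sq; pose M := (m * m')%N.
(* [q] relates [y] and [z]; read backwards it bounds the powers of [z], as [p] bounds those of
   [a]. *)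
pose q' := \poly_(k < m'.+1) q`_(m' - k).
have q'0 : q' != 0.
  apply: contraNneq q0 => q'0; apply/eqP/polyP => k; rewrite coef0.
  have [le_k|lt_k] := leqP k m'; last by rewrite nth_default // (leq_trans sq).
  have := congr1 (fun P : {poly Phi} => P`_(m' - k)) q'0.
  by rewrite coef_poly coef0 ltnS leq_subr subKn.
have sq' : (size q' <= m'.+1)%N by rewrite size_poly.
have /choice [r rP] : forall i : 'I_M.+1, exists r : {poly Phi}, (size r <= m)%N /\
    forall (R : comAlgType Phi) (a y : R) J, is_ideal J ->
    J (form p m a y) -> J (y ^+ m * a ^+ i - form r (m + i) a y).
  by move=> i; apply: form_reduce.
have /choice [t tP] : forall i : 'I_M.+1, exists r : {poly Phi}, (size r <= m')%N /\
    forall (R : comAlgType Phi) (a y : R) J, is_ideal J ->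
    J (form q' m' a y) -> J (y ^+ m' * a ^+ (M - i) - form r (m' + (M - i)) a y).
  by move=> i; apply: form_reduce.
pose C : 'M[Phi]_(M.+1, m * m') :=
  \matrix_i mxvec (\matrix_(k < m, l < m') ((r i)`_k * (t i)`_l)).
have kerC : kermx C != 0.
  rewrite kermx_eq0 /row_free; apply: contraTneq (rank_leq_col C) => ->.
  by rewrite -ltnNge.
have /rowV0Pn[v /sub_kermxP vC v0] := kerC.
have vE (k : 'I_m) (l : 'I_m') : \sum_i v 0 i * ((r i)`_k * (t i)`_l) = 0.
  have := congr1 (fun A : 'rV_(m * m') => A 0 (mxvec_index k l)) vC.
  rewrite /= !mxE => E; rewrite -[RHS]E; apply: eq_bigr => i _.
  by rewrite mxE mxvecE mxE.
pose h := \poly_(i < M.+1) v 0 (inord i).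
have hE (i : 'I_M.+1) : h`_i = v 0 i by rewrite coef_poly ltn_ord inord_val.
exists h, M, (m + m')%N; split.
- apply: contraNneq v0 => h0; apply/eqP/rowP => i.
  by rewrite -hE h0 coef0 mxE.
- exact: size_poly.
move=> R a y z J idJ; rewrite (form_rev q) -/q' => Jp Jq.
have [J0 JD JM] := idJ.
pose P i := form (r i) (m + i) a y; pose T (i : 'I_M.+1) := form (t i) (m' + (M - i)) z y.
have -> : y ^+ (m + m') * form h M a z =
    \sum_(i < M.+1) v 0 i *: (y ^+ m * a ^+ i * (y ^+ m' * z ^+ (M - i)) - P i * T i)
    + \sum_(i < M.+1) v 0 i *: (P i * T i).
  rewrite -big_split mulr_sumr; apply: eq_bigr => i _ /=.
  by rewrite -scalerDr subrK hE -scalerAr exprD; congr (_ *: _); ring.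
apply: (JD).
  apply: ideal_sum => // i; apply: idealZ => //.
  have -> : y ^+ m * a ^+ i * (y ^+ m' * z ^+ (M - i)) - P i * T i =
     (y ^+ m' * z ^+ (M - i)) * (y ^+ m * a ^+ i - P i) +
     P i * (y ^+ m' * z ^+ (M - i) - T i) by ring.
  by apply: (JD); apply: (JM); [apply: (rP i).2 | apply: (tP i).2].
rewrite (_ : \sum_(i < _) _ = 0) //.
(* Both remainders are homogeneous, so the exponent of [y] depends on [k] and [l] but not on [i];
   the relation [vE] between the coefficients therefore kills the sum over [i]. *)
have PT i : P i * T i = \sum_(k < m) \sum_(l < m')
    ((r i)`_k * (t i)`_l) *: (a ^+ k * z ^+ l * y ^+ (m + m' + M - k - l)).
  rewrite /P /T (form_trunc _ _ (rP i).1) ?(form_trunc _ _ (tP i).1); last first.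
  - exact: leqW (leq_addr _ _).
  - exact: leqW (leq_addr _ _).
  rewrite big_distrlr /=; apply: eq_bigr => k _; apply: eq_bigr => l _.
  rewrite -scalerAl -scalerAr scalerA; congr (_ *: _).
  have expE (m0 m1 M0 i0 k0 l0 : nat) : (i0 <= M0 -> k0 < m0 -> l0 < m1 ->
      m0 + m1 + M0 - k0 - l0 = (m0 + i0 - k0) + (m1 + (M0 - i0) - l0))%N by lia.
  have le_iM : (i <= M)%N by rewrite -ltnS.
  by rewrite (expE _ _ _ _ _ _ le_iM (ltn_ord k) (ltn_ord l)) exprD; ring.
under eq_bigr => i _ do rewrite PT scaler_sumr.
rewrite exchange_big big1 //= => k _.
under eq_bigr => i _ do rewrite scaler_sumr.
rewrite exchange_big big1 //= => l _.
under eq_bigr => i _ do rewrite scalerA.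
by rewrite -scaler_suml vE scale0r.
Qed.

(** Substituting [z + a] for [z] is invertible, so it cannot send a nonzero form to zero. The new
    coefficients are read off in the polynomial ring at [a = 'X], [z = 1]. *)
Lemma form_shift g M : (size g <= M.+1)%N -> g != 0 ->
  exists g' : {poly Phi}, [/\ g' != 0, (size g' <= M.+1)%N &
    forall (R : comAlgType Phi) (a z : R), form g' M a z = form g M a (z + a)].
Proof.
move=> sg g0; have sX1 : size (1 + 'X : {poly Phi}) = 2.
  by rewrite addrC size_polyDl ?size_polyX ?size_poly1.
have sX1e e : (size ((1 + 'X : {poly Phi}) ^+ e) <= e.+1)%N.
  by apply: leq_trans (size_poly_exp_leq _ _) _; rewrite sX1 mul1n.
have fX1 e (R : comAlgType Phi) (a z : R) : form ((1 + 'X) ^+ e) e a z = (z + a) ^+ e.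
  elim: e => [|e IH].
    by rewrite /form big_ord1 subnn !expr0 coef1 scale1r mulr1.
  rewrite !exprS -addn1 addnC formM ?sX1 // IH; congr (_ * _).
  rewrite /form big_ord_recl big_ord1 !coefD !coef1 !coefX /= addr0 add0r.
  by rewrite !scale1r expr0 mul1r expr1 mulr1.
have g'E (R : comAlgType Phi) (a z : R) :
    form (form g M ('X : {poly Phi}) (1 + 'X)) M a z = form g M a (z + a).
  rewrite {2}/form form_sum; apply: eq_bigr => k _; rewrite formZ; congr (_ *: _).
  have : (k <= M)%N by rewrite -ltnS.
  move: (nat_of_ord k) => i le_iM.
  have := @formXnM R ((1 + 'X) ^+ (M - i)) (M - i) a z i 0 (sX1e _).
  by rewrite add0n subnKC // fX1 expr0 mul1r.
exists (form g M ('X : {poly Phi}) (1 + 'X)); split=> //.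
  apply: contraNneq g0 => g'0; apply/eqP.
  by rewrite -(form_X1 sg) -[1](subrK 'X) -g'E g'0 form0.
apply: leq_trans (size_sum _ _ _) _.
apply/bigmax_leqP => k _; apply: leq_trans (size_scale_leq _ _) _.
have : (k <= M)%N by rewrite -ltnS.
move: (nat_of_ord k) => i le_iM; apply: leq_trans (size_polyMleq _ _) _.
by rewrite size_polyXn addSn; have := leq_add (leqnn i) (sX1e (M - i)%N); rewrite addnS subnKC.
Qed.

Lemma ideal_expr_mod (R : comAlgType Phi) (J : R -> Prop) (x u w : R) N :
  is_ideal J -> J (u - x) -> J (w * x ^+ N) -> J (w * u ^+ N).
Proof.
move=> [_ JD JM] Jux Jwx.
rewrite -[_ * u ^+ N](subrK (w * x ^+ N)); apply: (JD) => //.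
by rewrite -mulrBr subrXX mulrA mulrC mulrA; apply: JM.
Qed.

(* With y = a + d, some y^N h(a, z) is in the ideal; modulo y the third form is
   x = g(a, z) g(a, z + a), hence h(a, z) x^N is in the ideal. *)
Lemma chain_eliminate p m g M : p != 0 -> (size p <= m.+1)%N ->
    g != 0 -> (size g <= M.+1)%N ->
  exists (h : {poly Phi}) D, [/\ h != 0, (size h <= D.+1)%N &
    forall (R : comAlgType Phi) (a d z : R) J, is_ideal J ->
      J (form p m a (a + d)) -> J (form g M (a + d) z) ->
      J (form g M a z * form g M a (z - d)) -> J (form h D a z)].
Proof.
move=> p0 sp g0 sg.
have [h [D [N [h0 sh hE]]]] := form_eliminate p0 sp g0 sg.
have [g' [g'0 sg' g'E]] := form_shift sg g0.
have sgg' : (size (g * g')%R <= (M + M).+1)%N.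
  apply: leq_trans (size_polyMleq _ _) _.
  by move: sg sg'; clear; lia.
have sE e : (size ((g * g') ^+ e)%R <= (e * (M + M)).+1)%N.
  apply: leq_trans (size_poly_exp_leq _ _) _.
  by rewrite ltnS mulnC leq_mul2l; move: sgg'; clear; lia.
exists (h * (g * g') ^+ N), (D + N * (M + M))%N; split.
- by rewrite mulf_neq0 // expf_neq0 // mulf_neq0.
- apply: leq_trans (size_polyMleq _ _) _.
  by move: sh (sE N); clear; lia.
move=> R a d z J idJ Jp Jg JX; rewrite formM //.
have -> : form ((g * g') ^+ N) (N * (M + M)) a z = (form (g * g') (M + M) a z) ^+ N.
  elim: N {hE} => [|N IH].
    by rewrite /form big_ord1 coef1 scale1r subnn !expr0 mulr1.
  by rewrite !exprS mulSn formM // IH.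
rewrite formM // g'E.
pose y := a + d.
(* [z - d] and [z + a] differ by [y], so the two values of the form agree modulo [y]. *)
have [X' X'E] : exists X', form g M a (z - d) - form g M a (z + a) = y * X'.
  have yI : is_ideal (fun x => exists X', x = y * X').
    split=> [|x1 x2 [c1 ->] [c2 ->]|x1 x2 [c2 ->]]; first by exists 0; rewrite mulr0.
      by exists (c1 + c2); rewrite mulrDr.
    by exists (x1 * c2); rewrite mulrCA.
  rewrite /form -sumrB; apply: (ideal_sum (J := fun x => exists X0, x = y * X0)) => // k.
  rewrite -scalerBr; apply: (idealZ (J := fun x => exists X0, x = y * X0)) => //.
  rewrite -mulrBr subrXX; set S := \sum_(_ < _) _; exists (- (a ^+ k * S)).
  by rewrite /y; ring.
(* Modulo the ideal, the third relation makes [g(a, z) g(a, z + a)] a multiple of [y]; its [N]-th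
   power then carries the factor [y ^+ N] that [h] requires. *)
apply: (@ideal_expr_mod _ _ (- y * (form g M a z * X'))) => //.
  have -> : form g M a z * form g M a (z + a) - - y * (form g M a z * X') =
     form g M a z * form g M a (z - d).
    by rewrite -(subrK (form g M a (z + a)) (form g M a (z - d))) X'E; ring.
  exact: JX.
case: (idJ) => _ _ JM.
have -> : form h D a z * (- y * (form g M a z * X')) ^+ N =
    ((-1) ^+ N * (form g M a z * X') ^+ N) * (y ^+ N * form h D a z).
  by rewrite !exprMn [(- y) ^+ N]exprNn; ring.
by apply: (JM); exact: (hE R a y z J idJ Jp Jg).
Qed.

End Forms.

(** * The chain identities *)

Section LeftNormed.
Variables (Phi : fieldType) (A : linAlgebra Phi).
Implicit Types (v w b : A) (ws : seq A).

Definition act v ws : A := foldl (fun x y => x ** y) v ws.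

Lemma act_cat v ws1 ws2 : act v (ws1 ++ ws2) = act (act v ws1) ws2.
Proof. exact: foldl_cat. Qed.

Lemma act_cons v w ws : act v (w :: ws) = act (v ** w) ws.
Proof. by []. Qed.

Lemma act_rcons v ws w : act v (rcons ws w) = act v ws ** w.
Proof. by rewrite /act foldl_rcons. Qed.

Lemma act_nseq v b k : act v (nseq k b) = rmulX v b k.
Proof. by elim: k v => //= k IH v; rewrite IH /rmulX -iterSr. Qed.

Lemma amulDl v v' w : (v + v') ** w = v ** w + v' ** w.
Proof. exact: linearDl. Qed.
Lemma amulDr v w w' : v ** (w + w') = v ** w + v ** w'.
Proof. exact: linearDr. Qed.
Lemma amulZl c v w : (c *: v) ** w = c *: (v ** w).
Proof. exact: linearZl_LR. Qed.
Lemma amulZr c v w : v ** (c *: w) = c *: (v ** w).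
Proof. exact: linearZr_LR. Qed.
Lemma amul0l w : (0 : A) ** w = 0.
Proof. exact: linear0l. Qed.

Lemma act_is_linear ws : linear (act^~ ws).
Proof.
elim: ws => [//|w ws IH] c x y /=; rewrite amulDl amulZl; exact: IH.
Qed.

Lemma actD v v' ws : act (v + v') ws = act v ws + act v' ws.
Proof. by have := act_is_linear ws 1 v v'; rewrite !scale1r. Qed.
Lemma act0 ws : act 0 ws = 0.
Proof. by have := act_is_linear ws (-1) 0 0; rewrite scaleN1r oppr0 addr0 scaleN1r addNr. Qed.
Lemma actZ c v ws : act (c *: v) ws = c *: act v ws.
Proof. by rewrite -[c *: v]addr0 (act_is_linear ws c v 0) act0 addr0. Qed.
Lemma actB v v' ws : act (v - v') ws = act v ws - act v' ws.
Proof. by rewrite -scaleN1r actD actZ scaleN1r. Qed.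
Lemma act_sum I (r : seq I) (F : I -> A) ws :
  act (\sum_(i <- r) F i) ws = \sum_(i <- r) act (F i) ws.
Proof.
elim: r => [|i r IH]; first by rewrite !big_nil act0.
by rewrite !big_cons actD IH.
Qed.

End LeftNormed.

Section Operators.
Import ssrcomplements mpoly.
Variables (Phi : fieldType) (A : linAlgebra Phi).
Hypothesis leibA : leibniz A.
Variable b : A.
Implicit Types (v w : A) (phi : A -> A -> A) (p q : {mpoly Phi[3]}).

Local Notation i0 := (ord0 : 'I_3).
Local Notation i1 := (lift ord0 ord0 : 'I_3).
Local Notation i2 := (ord_max : 'I_3).

(* The variables act on functions of (v, w) by the commuting operators
   "multiply v by b", "multiply w by b" and "multiply the value by b". *)
Definition mono_op phi v w (m : 'X_{1..3}) : A :=
  rmulX (phi (rmulX v b (m i0)) (rmulX w b (m i1))) b (m i2).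

Definition poly_op phi p v w : A := \sum_(m <- msupp p) p@_m *: mono_op phi v w m.

Lemma poly_opE phi p v w k : (msize p <= k)%N ->
  poly_op phi p v w = \sum_(m : 'X_{1..3 < k}) p@_m *: mono_op phi v w m.
Proof.
move=> le_pk; set I : subFinType _ := 'X_{1..3 < k}.
rewrite /poly_op (big_mksub I) ?msupp_uniq //=; first last.
  by move=> x /msize_mdeg_lt /leq_trans; apply.
by rewrite big_rmcond //= => j /memN_msupp_eq0 ->; rewrite scale0r.
Qed.

Lemma poly_op_is_linear phi v w : linear (fun p => poly_op phi p v w).
Proof.
move=> c p q.
pose k := (msize (c *: p + q) + msize p + msize q)%N.
rewrite !(@poly_opE _ _ _ _ k) /k ?leq_addl -?addnA ?leq_addr // ?(addnCA _ (msize p)) ?leq_addr //.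
rewrite scaler_sumr -big_split /=; apply: eq_bigr => m _.
by rewrite mcoeffD mcoeffZ scalerDl scalerA.
Qed.

Lemma poly_opD phi p q v w : poly_op phi (p + q) v w = poly_op phi p v w + poly_op phi q v w.
Proof. by have := poly_op_is_linear phi v w 1 p q; rewrite !scale1r. Qed.
Lemma poly_op0 phi v w : poly_op phi 0 v w = 0.
Proof. by rewrite /poly_op msupp0 big_nil. Qed.
Lemma poly_opZ phi c p v w : poly_op phi (c *: p) v w = c *: poly_op phi p v w.
Proof. by have := poly_op_is_linear phi v w c p 0; rewrite poly_op0 !addr0. Qed.
Lemma poly_opB phi p q v w : poly_op phi (p - q) v w = poly_op phi p v w - poly_op phi q v w.
Proof. by rewrite -(scaleN1r q) poly_opD poly_opZ scaleN1r. Qed.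
Lemma poly_op_sum phi I (r : seq I) (F : I -> {mpoly Phi[3]}) v w :
  poly_op phi (\sum_(i <- r) F i) v w = \sum_(i <- r) poly_op phi (F i) v w.
Proof.
elim: r => [|i r IH]; first by rewrite !big_nil poly_op0.
by rewrite !big_cons poly_opD IH.
Qed.

Lemma poly_op_mono phi m v w : poly_op phi 'X_[m] v w = mono_op phi v w m.
Proof. by rewrite /poly_op msuppX big_seq1 mcoeffX eqxx scale1r. Qed.

Lemma poly_op_ext (f : {mpoly Phi[3]} -> A) phi v w :
  linear f -> (forall m, poly_op phi 'X_[m] v w = f 'X_[m]) ->
  forall p, poly_op phi p v w = f p.
Proof.
move=> fl fX p; have f0 : f 0 = 0.
  by have := fl (-1) 0 0; rewrite scaleN1r oppr0 addr0 scaleN1r addNr.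
elim/mpolyind: p => [|c m p _ _ IH]; first by rewrite poly_op0 f0.
by rewrite poly_opD poly_opZ fl fX IH.
Qed.

Lemma poly_op_X0 phi p v w : poly_op phi ('X_i0 * p) v w = poly_op phi p (v ** b) w.
Proof.
apply/esym/(@poly_op_ext (fun p => poly_op phi ('X_i0 * p) v w)).
  by move=> c q q'; rewrite mulrDr -scalerAr poly_opD poly_opZ.
move=> m; rewrite -mpolyXD !poly_op_mono /mono_op !mnmDE !mnm1E -!val_eqE /=.
by rewrite !add0n /rmulX -iterSr.
Qed.

Lemma poly_op_X1 phi p v w : poly_op phi ('X_i1 * p) v w = poly_op phi p v (w ** b).
Proof.
apply/esym/(@poly_op_ext (fun p => poly_op phi ('X_i1 * p) v w)).
  by move=> c q q'; rewrite mulrDr -scalerAr poly_opD poly_opZ.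
move=> m; rewrite -mpolyXD !poly_op_mono /mono_op !mnmDE !mnm1E -!val_eqE /=.
by rewrite !add0n /rmulX -iterSr.
Qed.

Lemma poly_op_X2 phi p v w : poly_op phi ('X_i2 * p) v w = poly_op phi p v w ** b.
Proof.
elim/mpolyind: p => [|c m p _ _ IH]; first by rewrite mulr0 !poly_op0 amul0l.
rewrite mulrDr !poly_opD -scalerAr !poly_opZ amulDl amulZl IH; congr (_ *: _ + _).
by rewrite -mpolyXD !poly_op_mono /mono_op !mnmDE !mnm1E -!val_eqE /= !add0n.
Qed.

Lemma poly_op_diff phi1 phi2 p v w :
  poly_op (fun v w => phi1 v w - phi2 v w) p v w = poly_op phi1 p v w - poly_op phi2 p v w.
Proof.
rewrite /poly_op -sumrB; apply: eq_bigr => m _; rewrite -scalerBr /mono_op.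
by rewrite -!act_nseq actB.
Qed.

Definition annihilates phi p := forall v w, poly_op phi p v w = 0.

(** A variable acts by multiplying [v], [w] or the value by [b], and none of these destroys
    vanishing at all [(v, w)]. Identities of the algebra thereby become ideal membership, to which
    the elimination lemmas apply. *)
Lemma annihilates_ideal phi : is_ideal (annihilates phi).
Proof.
have JX i q : annihilates phi q -> annihilates phi ('X_i * q).
  move=> Jq v w; case: i => [[|[|[|//]]] lti]; last first.
  - have -> : Ordinal lti = i2 by apply: val_inj.
    by rewrite poly_op_X2 Jq amul0l.
  - have -> : Ordinal lti = i1 by apply: val_inj.
    by rewrite poly_op_X1 Jq.
  have -> : Ordinal lti = i0 by apply: val_inj.
  by rewrite poly_op_X0 Jq.
have JXn i k q : annihilates phi q -> annihilates phi ('X_i ^+ k * q).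
  by move=> Jq; elim: k => [|k IH]; rewrite ?expr0 ?mul1r // exprS -mulrA; apply: JX.
split=> [v w|p q Jp Jq v w|p q Jq]; first exact: poly_op0.
  by rewrite poly_opD Jp Jq addr0.
elim/mpolyind: p => [|c m p _ _ IH] v w; first by rewrite mul0r poly_op0.
rewrite mulrDl poly_opD IH addr0 -scalerAl poly_opZ.
suff JXm : annihilates phi ('X_[m] * q) by rewrite JXm scaler0.
by rewrite mpolyXE_id !big_ord_recl big_ord0 mulr1 -!mulrA; do 3 apply: (JXn).
Qed.

Lemma annihilates_formP phi (p : {poly Phi}) D (x y : {mpoly Phi[3]}) :
  (forall v w, \sum_(k < D.+1) p`_k *: poly_op phi (x ^+ k * y ^+ (D - k)) v w = 0) ->
  annihilates phi (form p D x y).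
Proof.
by move=> H v w; rewrite poly_op_sum -[RHS](H v w); apply: eq_bigr => k _; rewrite poly_opZ.
Qed.

Lemma poly_op_X0n phi k p v w :
  poly_op phi ('X_i0 ^+ k * p) v w = poly_op phi p (rmulX v b k) w.
Proof.
elim: k v => [|k IH] v; first by rewrite mul1r.
by rewrite exprS -mulrA poly_op_X0 IH /rmulX -iterSr.
Qed.

Lemma poly_op_X2n phi k p v w :
  poly_op phi ('X_i2 ^+ k * p) v w = rmulX (poly_op phi p v w) b k.
Proof.
elim: k => [|k IH]; first by rewrite mul1r.
by rewrite exprS -mulrA poly_op_X2 IH.
Qed.

Lemma poly_op1 phi v w : poly_op phi 1 v w = phi v w.
Proof. by rewrite -mpolyX0 poly_op_mono /mono_op !mnm0E. Qed.

Definition before B v w : A := act v (w :: B).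
Definition after B v w : A := act v B ** w.

Fixpoint derive_at w B : seq (seq A) :=
  if B is u :: B' then (w ** u :: B') :: map (cons u) (derive_at w B') else [::].

Lemma size_derive_at w B l : l \in derive_at w B -> size l = size B.
Proof.
elim: B l => //= u B IH l; rewrite inE => /orP[/eqP-> //|/mapP[l' l'in ->]] /=.
by rewrite IH.
Qed.

(** Moving [w] to the right past a factor [u] leaves [v (w u)], hence one correction term per factor
    of [B]. Each such term still has as many factors as [B], so the chain identity of that length
    applies to it. *)
Lemma before_after B v w :
  before B v w - after B v w = \sum_(l <- derive_at w B) act v l.
Proof.
rewrite /before /after; elim: B v => [|u B IH] v; first by rewrite big_nil subrr.
rewrite /= big_cons big_map !act_cons leibA actD addrAC addrC.
by under eq_bigr => l _ do rewrite act_cons; rewrite -IH.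
Qed.

(** Right multiplication by [b] is a derivation: on [v w] it acts as the sum of the first two
    operators. *)
Lemma poly_op_before B k v w :
  poly_op (before B) (('X_i0 + 'X_i1) ^+ k) v w = act (v ** w) (nseq k b ++ B).
Proof.
elim: k v w => [|k IH] v w; first by rewrite expr0 poly_op1.
by rewrite exprS mulrDl poly_opD poly_op_X0 poly_op_X1 !IH -actD -leibA.
Qed.

(** The derivation rule solved for the term in which [b] precedes [w]:
    [(u b) w = (u w) b - u (w b)]. *)
Lemma poly_op_after B k v w :
  poly_op (after B) (('X_i2 - 'X_i1) ^+ k) v w = act v (B ++ nseq k b) ** w.
Proof.
elim: k v w => [|k IH] v w; first by rewrite expr0 poly_op1 cats0.
rewrite exprS mulrBl poly_opB poly_op_X2 poly_op_X1 !IH leibA addrK.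
by rewrite !act_cat !act_nseq.
Qed.

Definition chain_identity r (g : {poly Phi}) M :=
  forall v B, size B = r -> \sum_(k < M.+1) g`_k *: rmulX (act (rmulX v b k) B) b (M - k) = 0.

(* With phi(v, w) = v w B, the identity for one factor gives the first form, the
   one for r factors applied to v w gives the second, and moving w through B by
   the Leibniz rule gives the third. *)
Lemma chain_identity_step r (p g : {poly Phi}) m M B :
  chain_identity 1 p m -> chain_identity r g M -> size B = r ->
  [/\ annihilates (before B) (form p m 'X_i0 ('X_i0 + 'X_i1)),
      annihilates (before B) (form g M ('X_i0 + 'X_i1) 'X_i2)
    & annihilates (before B) (form g M 'X_i0 'X_i2 * form g M 'X_i0 ('X_i2 - 'X_i1))].
Proof.
move=> chp chg sB; split.
- apply: annihilates_formP => v w.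
  transitivity (act (\sum_(k < m.+1) p`_k *: rmulX (act (rmulX v b k) [:: w]) b (m - k)) B);
    last by rewrite chp // act0.
  rewrite act_sum; apply: eq_bigr => k _; rewrite poly_op_X0n poly_op_before actZ act_cat act_nseq /=.
  by [].
- apply: annihilates_formP => v w; apply: etrans (chg (v ** w) B sB).
  by apply: eq_bigr => k _; rewrite mulrC poly_op_X2n poly_op_before act_cat act_nseq.
have [_ _ Jm] := annihilates_ideal (fun v w => before B v w - after B v w).
have [_ _ Ja] := annihilates_ideal (after B).
(* [before B] is the sum of [before B - after B], which the first form kills because its terms are
   chains of length [r], and of [after B], which the second form kills. *)
move=> v w; rewrite -[LHS](subrK (poly_op (after B) (form g M 'X_i0 'X_i2 *
  form g M 'X_i0 ('X_i2 - 'X_i1)) v w)) -poly_op_diff mulrC Jm ?add0r; last first.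
  apply: annihilates_formP => v1 w1.
  pose F k l := rmulX (act (rmulX v1 b k) l) b (M - k).
  transitivity (\sum_(k < M.+1) g`_k *: \sum_(l <- derive_at w1 B) F k l).
    apply: eq_bigr => k _; congr (_ *: _).
    rewrite poly_op_X0n -[_ ^+ _]mulr1 poly_op_X2n poly_op1 before_after.
    by rewrite -act_nseq act_sum; apply: eq_bigr => l _; rewrite act_nseq.
  under eq_bigr => k _ do rewrite scaler_sumr.
  rewrite exchange_big big_seq big1 //= => l /size_derive_at szl.
  by apply: chg; rewrite szl.
rewrite mulrC Ja //; apply: annihilates_formP => v1 w1.
apply: etrans (amul0l w1).
transitivity ((\sum_(k < M.+1) g`_k *: rmulX (act (rmulX v1 b k) B) b (M - k)) ** w1);
  last by rewrite chg // amul0l.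
rewrite linear_sumlz; apply: eq_bigr => k _.
by rewrite poly_op_X0n poly_op_after linearZl_LR /= act_cat act_nseq.
Qed.

End Operators.

(** Induction on the number of factors: a list of [r.+2] factors is read as [w :: B], and the three
    relations for [before B] come from the one-factor identity and from the one for the length of
    [B]. *)
Theorem chain_identities (Phi : fieldType) (A : linAlgebra Phi) (k m : nat)
    (alpha : nat -> Phi) :
  leibniz A -> (k <= m)%N ->
  (forall x y z : A,
       rmulX (rmulX x y k ** z) y (m - k) =
       \sum_(1 <= i < k.+1)
         alpha i *: rmulX (rmulX x y (k - i) ** z) y (m - k + i)) ->
  forall r, exists (g : {poly Phi}) M, [/\ g != 0, (size g <= M.+1)%N &
     forall b : A, chain_identity b r.+1 g M].
Proof.
(* The identity with all terms on one side: the coefficient of ['X^i] belongs to the term with [i]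
   factors [y] before [z]. The one of ['X^k] is 1, so [p] is nonzero. *)
move=> leibA le_km idA; pose p : {poly Phi} := 'X^k - \poly_(i < k) alpha (k - i)%N.
have pk : p`_k = 1 by rewrite coefB coefXn eqxx coef_poly ltnn subr0.
have p0 : p != 0 by apply: contra_eq_neq pk => ->; rewrite coef0 eq_sym oner_eq0.
have sp : (size p <= m.+1)%N.
  apply: leq_trans (size_polyD _ _) _; rewrite size_polyN size_polyXn geq_max ltnS le_km.
  by apply: leq_trans (size_poly _ _) _; apply: leqW.
have chp (b : A) : chain_identity b 1 p m.
  move=> v [|w [|//]] // _; rewrite /act /=.
  pose T i := rmulX (rmulX v b i ** w) b (m - i).
  rewrite -(big_mkord xpredT (fun i => p`_i *: T i)) (big_cat_nat (n := k.+1)) //=.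
  have -> : \sum_(k.+1 <= i < m.+1) p`_i *: T i = 0.
    rewrite big_nat big1 // => i /andP[lt_ki _]; rewrite coefB coefXn coef_poly.
    by rewrite (gtn_eqF lt_ki) ltnNge (ltnW lt_ki) subrr scale0r.
  rewrite addr0 big_nat_recr //= pk scale1r [X in _ + X]idA big_add1 [X in _ + X]big_nat_rev /=.
  rewrite -big_split /= big_nat big1 // => i /andP[_ lt_ik].
  rewrite coefB coefXn (ltn_eqF lt_ik) coef_poly lt_ik sub0r add0n subnSK //.
  rewrite subKn ?(ltnW lt_ik) // /T (_ : m - k + (k - i) = m - i)%N ?scaleNr ?addNr //.
  by rewrite addnBA ?(ltnW lt_ik) // subnK.
elim=> [|r [g [M [g0 sg chg]]]]; first by exists p, m.
have [h [D [h0 sh hE]]] := chain_eliminate p0 sp g0 sg.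
exists h, D; split=> // b v [//|w B] [sB].
have [Jp Jg JX] := chain_identity_step leibA (chp b) (chg b) sB.
have /(_ v w) := hE _ _ _ _ _ (annihilates_ideal b (before B)) Jp Jg JX.
rewrite poly_op_sum => E; rewrite -[RHS]E; apply: eq_bigr => i _.
by rewrite poly_opZ poly_op_X0n -[_ ^+ (D - i)]mulr1 poly_op_X2n poly_op1.
Qed.

(** * Colength and symmetrization *)

From mathcomp Require Import monalg.

Section SignedSums.
Variables (F : fieldType) (n : nat).
Hypothesis charF : [pchar F] =i pred0.

Lemma natr_inj_pchar0 : injective (fun k : nat => k%:R : F).
Proof.
have inj0 (k : nat) : k%:R = 0 :> F -> k = 0%N.
  by move=> /eqP; rewrite ((pcharf0P F).1 charF) => /eqP.
move=> i j /= eij; wlog le_ij : i j eij / (i <= j)%N.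
  by move=> W; case/orP: (leq_total i j) => le; [|apply/esym]; apply: W.
apply/eqP; rewrite eqn_leq le_ij -subn_eq0; apply/eqP/inj0.
by rewrite natrB // eij subrr.
Qed.

(** In a rank factorisation [A = C *m R] the relation cancels to [R *m C = c%:M], a matrix whose
    size is the rank; exchanging the two factors does not change the trace. *)
Lemma mxtrace_quasi_idem d (A : 'M[F]_d) c :
  c != 0 -> A *m A = c *: A -> \tr A = c * (\rank A)%:R.
Proof.
move=> c0; rewrite -{1 2 3 4}(mulmx_base A) => AA.
suff RC : row_base A *m col_base A = c%:M by rewrite mxtrace_mulC RC mxtrace_scalar mulr_natr.
apply: (row_free_inj (row_base_free A)); apply: (row_full_inj (col_base_full A)).
by rewrite mul_scalar_mx -scalemxAr -AA !mulmxA.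
Qed.

Variable H : {group 'S_n}.
Variable sg : 'S_n -> F.
Hypothesis sgM : {morph sg : x y / (x * y)%g >-> x * y}.
Hypothesis sgV : forall x, sg x * sg x = 1.

Definition signed_sum d (rho : mx_representation F [set: 'S_n]%G d) : 'M[F]_d :=
  \sum_(h in H) sg h *: rho h.

Lemma mul_signed_sum d (rho : mx_representation F [set: 'S_n]%G d) g :
  g \in H -> rho g *m signed_sum rho = sg g *: signed_sum rho.
Proof.
move=> Hg; rewrite /signed_sum mulmx_sumr scaler_sumr.
rewrite [RHS](reindex_inj (mulgI g)) /=.
apply: eq_big => [h|h Hh]; first by rewrite groupMl.
by rewrite -scalemxAr repr_mxM ?inE // sgM !scalerA mulrA sgV mul1r.
Qed.

Lemma signed_sum_sqr d (rho : mx_representation F [set: 'S_n]%G d) :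
  signed_sum rho *m signed_sum rho = #|H|%:R *: signed_sum rho.
Proof.
rewrite {1}/signed_sum mulmx_suml (eq_bigr (fun _ => signed_sum rho)).
  by rewrite sumr_const scaler_nat.
by move=> h Hh; rewrite -scalemxAl mul_signed_sum // scalerA sgV scale1r.
Qed.

Lemma mxtrace_signed_sum d (rho : mx_representation F [set: 'S_n]%G d) :
  \tr (signed_sum rho) = (#|H| * \rank (signed_sum rho))%:R.
Proof.
rewrite natrM; apply: mxtrace_quasi_idem (signed_sum_sqr rho).
apply/eqP=> /(@natr_inj_pchar0 _ 0%N) H0.
by move: (cardG_gt0 H); rewrite H0.
Qed.

(* The multiplicity of a constituent is bounded by the rank on the module of
   any signed sum that does not vanish on this constituent. *)
Lemma rank_signed_sum (d : nat) (rG : mx_representation F [set: 'S_n]%G d)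
    (m : intpart n -> nat) :
  (forall s : 'S_n, \tr (rG s) = \sum_p (m p)%:R * young_char F p s) ->
  \rank (signed_sum rG) = (\sum_p m p * \rank (signed_sum (submod_repr
     (cyclic_mx_module (regular_repr F [set: 'S_n]%G) (young_symmetrizer F p)))))%N.
Proof.
move=> trE; apply/eqP; rewrite -(eqn_pmul2l (cardG_gt0 H)); apply/eqP.
apply: natr_inj_pchar0; rewrite /= -mxtrace_signed_sum.
rewrite big_distrr /= natr_sum raddf_sum /=.
under eq_bigr => h Hh do rewrite mxtraceZ trE mulr_sumr.
rewrite exchange_big /=; apply: eq_bigr => p _.
rewrite mulnCA natrM -mxtrace_signed_sum raddf_sum mulr_sumr /=.
by apply: eq_bigr => h _; rewrite mxtraceZ mulrCA.
Qed.

(** The generator [u] lies in the submodule and witnesses that the sum does not act as zero there.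
    This reduces the question on Specht modules to a computation with the Young symmetrizer. *)
Lemma signed_sum_submod_neq0 d (rho : mx_representation F [set: 'S_n]%G d)
    (u : 'rV_d) :
  u *m signed_sum rho != 0 ->
  (0 < \rank (signed_sum (submod_repr (cyclic_mx_module rho u))))%N.
Proof.
apply: contraNT; rewrite -leqNgt leqn0 mxrank_eq0 => /eqP S0.
apply/eqP.
have := in_submodK (cyclic_mx_id rho u) => <-.
rewrite mulmx_sumr.
transitivity (val_submod (in_submod (cyclic_mx rho u) u *m signed_sum
   (submod_repr (cyclic_mx_module rho u)))); last first.
  by rewrite S0 mulmx0 linear0.
rewrite /signed_sum mulmx_sumr linear_sum; apply: eq_bigr => h _ /=.
by rewrite -!scalemxAr linearZ /= val_submodJ ?inE.
Qed.

End SignedSums.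

Section YoungSymmetrizers.
Variables (F : fieldType) (n : nat).
Hypothesis charF : [pchar F] =i pred0.

(** Row stabilizers, column stabilizers and [head_group] all have this form, which provides their
    group structure at once. *)
Definition fun_stab (f : 'I_n -> nat) : {set 'S_n} :=
  [set s : 'S_n | [forall i : 'I_n, f (s i) == f i]].

Lemma fun_stabP (f : 'I_n -> nat) (s : 'S_n) :
  reflect (forall i, f (s i) = f i) (s \in fun_stab f).
Proof. by rewrite inE; apply: (iffP forallP) => fs i; apply/eqP/fs. Qed.

Lemma group_set_fun_stab (f : 'I_n -> nat) : group_set (fun_stab f).
Proof.
apply/group_setP; split=> [|s t /fun_stabP fs /fun_stabP ft]; apply/fun_stabP => i.
  by rewrite perm1.
by rewrite permM ft.
Qed.
Canonical fun_stab_group (f : 'I_n -> nat) := Group (group_set_fun_stab f).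

Lemma row_stabE (l : intpart n) :
  row_stab l = fun_stab (fun i => reshape_index (parts l) i).
Proof. by []. Qed.

Lemma col_stabE (l : intpart n) :
  col_stab l = fun_stab (fun i => reshape_offset (parts l) i).
Proof. by []. Qed.

Lemma sumn_parts (l : intpart n) : sumn (parts l) = n.
Proof. by have /andP[_ /eqP] := valP l. Qed.

Lemma parts_sorted (l : intpart n) : sorted geq (parts l).
Proof. by have /andP[] := valP l. Qed.

Lemma row_col_stab (l : intpart n) s : s \in row_stab l -> s \in col_stab l -> s = 1%g.
Proof.
rewrite row_stabE col_stabE => /fun_stabP rs /fun_stabP cs.
apply/permP => i; rewrite perm1; apply: val_inj => /=.
have E (j : 'I_n) : flatten_index (parts l) (reshape_index (parts l) j)
    (reshape_offset (parts l) j) = j by apply: reshape_indexK.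
by rewrite -[LHS]E -[RHS]E rs cs.
Qed.

(** The coefficient of the product at the identity counts the triples with [r * c * h = 1], each
    with sign 1 by hypothesis. The trivial triple makes this count positive, so it is nonzero in
    characteristic zero. *)
Lemma young_symmetrizer_signed_sum (H : {group 'S_n}) (sg : 'S_n -> F) (l : intpart n) :
  (forall r c h, r \in row_stab l -> c \in col_stab l -> h \in H ->
     (r * c * h = 1)%g -> (-1) ^+ c * sg h = 1) ->
  young_symmetrizer F l *m signed_sum H sg (regular_repr F [set: 'S_n]%G) != 0.
Proof.
move=> sgE.
pose cnt := (\sum_(r in row_stab l) \sum_(c in col_stab l) \sum_(h in H)
  (r * c * h == 1)%g)%N.
have vE : (young_symmetrizer F l *m signed_sum H sg (regular_repr F [set: 'S_n]%G))
    0 (gring_index [set: 'S_n]%G 1%g) = cnt%:R.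
  rewrite /young_symmetrizer /signed_sum mulmx_suml summxE.
  rewrite natr_sum; apply: eq_bigr => r Rr.
  rewrite mulmx_suml summxE natr_sum; apply: eq_bigr => c Cc.
  rewrite mulmx_sumr summxE natr_sum; apply: eq_bigr => h Hh.
  rewrite -scalemxAr -scalemxAl -rowE rowK !mxE gring_indexK ?inE //.
  rewrite eqxx /= -(inj_eq (can_inj (@gring_valK _ [set: 'S_n]%G))) !gring_indexK ?inE //.
  have [E|NE] := eqVneq (r * c * h)%g 1%g.
    by rewrite mulr1 mulrC (sgE r c h).
  by rewrite !mulr0.
apply/eqP => /rowP /(_ (gring_index [set: 'S_n]%G 1%g)).
rewrite vE [in RHS]mxE => /eqP; rewrite ((pcharf0P F).1 charF) => /eqP cnt0.
suff: (0 < cnt)%N by rewrite cnt0.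
rewrite /cnt row_stabE col_stabE (bigD1 1%g) ?group1 //=.
rewrite (bigD1 1%g) ?group1 //= (bigD1 1%g) ?group1 //=.
by rewrite !mulg1 eqxx.
Qed.

End YoungSymmetrizers.

(** Take out two elements with equal value as long as there are any; [f] injects what remains into
    [c] values. *)
Lemma tperm_pairing (n c : nat) (f : 'I_n -> nat) (s : seq 'I_n) :
  uniq s -> (forall i, i \in s -> f i < c)%N ->
  exists ps : seq ('I_n * 'I_n),
    [/\ uniq (flatten [seq [:: p.1; p.2] | p <- ps]),
        forall i, i \in flatten [seq [:: p.1; p.2] | p <- ps] -> i \in s,
        all (fun p => f p.1 == f p.2) ps
      & (size s <= c + (size ps).*2)%N].
Proof.
have [k] := ubnP (size s); elim: k s => // k IHk s; rewrite ltnS => le_s_k Us fc.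
have [inj_f|] := boolP (uniq (map f s)).
  exists [::]; split=> //=; rewrite addn0 -(size_map f) -(size_iota 0 c).
  apply: uniq_leq_size => // _ /mapP[i si ->].
  by rewrite mem_iota /= add0n fc.
case/(uniqPn 0%N)=> i [j] [ltij]; rewrite size_map => ltj.
have x0 : 'I_n by case: s ltj {le_s_k Us fc} => // x s; exact: x.
have lti := ltn_trans ltij ltj.
rewrite !(nth_map x0) // => eq_f.
set x := nth x0 s i in eq_f; set y := nth x0 s j in eq_f.
have neq_xy : x != y by rewrite nth_uniq // ltn_eqF.
have [sx sy] : x \in s /\ y \in s by rewrite !mem_nth.
pose s' := rem y (rem x s).
have Us' : uniq s' by rewrite !rem_uniq.
have sz : size s = (size s').+2.
  rewrite /s' size_rem ?size_rem ?mem_rem_uniq ?inE //; last first.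
    by rewrite eq_sym neq_xy.
  by case: (s) sx sy neq_xy => [|a [|b t]] //=; rewrite !inE => /eqP-> /eqP->; rewrite eqxx.
have s's z : z \in s' -> [/\ z \in s, z != x & z != y].
  by rewrite mem_rem_uniq ?rem_uniq // inE mem_rem_uniq // inE => /and3P[].
have [||z /s's[]|ps [Ups sps fps le_s']] := IHk s' => //.
- by apply: leq_trans le_s_k; rewrite sz.
- by move=> *; apply: fc.
exists ((x, y) :: ps); split=> /=.
- rewrite inE (negbTE neq_xy) Ups andbT /=; apply/andP; split.
    by apply/negP => /sps/s's[_]; rewrite eqxx.
  by apply/negP => /sps/s's[_ _]; rewrite eqxx.
- by move=> z; rewrite !inE => /or3P[/eqP->|/eqP->|/sps/s's[]].
- by rewrite eq_f eqxx.
- by rewrite sz doubleS !addnS !ltnS.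
Qed.

(** * From alternation and symmetrization to a bound on the colength *)

Section PermAct.
Variables (Phi : fieldType) (V : linAlgebra Phi -> Prop) (n : nat).

Lemma perm_act_is_linear (s : 'S_n) : linear (@perm_act Phi V n s).
Proof.
move=> c u v; rewrite -[u]to_relfreeK -[v]to_relfreeK -linearP !perm_actE.
by rewrite /relabel_poly !linearP.
Qed.
HB.instance Definition _ (s : 'S_n) :=
  GRing.isLinear.Build Phi (relfree V) (relfree V) _ (perm_act s) (perm_act_is_linear s).

Definition alternate (ps : seq ('I_n * 'I_n)) (u : relfree V) : relfree V :=
  foldr (fun p v => v - perm_act (tperm p.1 p.2) v) u ps.

(* The symmetric group on the letters below n - N. *)
Definition head_group (N : nat) : {group 'S_n} :=
  fun_stab_group (fun i : 'I_n => if (i < n - N)%N then 0%N else i.+1).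

Lemma head_groupP N (h : 'S_n) :
  h \in head_group N -> forall i : 'I_n,
    if (i < n - N)%N then (h i < n - N)%N else h i == i.
Proof.
move=> /fun_stabP hf i; have := hf i; case: ltnP => _; case: ltnP => //= _ [] // E.
by apply/eqP/val_inj.
Qed.

Hypothesis charPhi : [pchar Phi] =i pred0.

Theorem colength_le (Q C l : nat) :
  (forall (ps : seq ('I_n * 'I_n)) u,
     uniq (flatten [seq [:: p.1; p.2] | p <- ps]) -> (Q <= size ps)%N ->
     multilinear n u -> alternate ps u = 0) ->
  (exists vs : seq (relfree V), [/\ (size vs <= C)%N,
     forall v, v \in vs -> multilinear n v
     & forall u, multilinear n u -> exists c : nat -> Phi,
        \sum_(h in head_group Q.*2) perm_act h u = \sum_(i < size vs) c i *: vs`_i]) ->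
  is_colength V n l -> (l <= C)%N.
Proof.
move=> altH [vs [vsC vsM symH]] [d [rG [m [[b [bM bU bA]] trE ->]]]].
(* Coordinates in the basis [b] identify row vectors with the multilinear part, so sums over groups
   become matrices. *)
pose B (c : 'rV[Phi]_d) : relfree V := \sum_i c 0 i *: b i.
have B_linear : linear B.
  move=> a c c'; rewrite /B scaler_sumr -big_split /=; apply: eq_bigr => i _.
  by rewrite !mxE scalerDl scalerA.
pose BL : {linear 'rV[Phi]_d -> relfree V} :=
  HB.pack B (GRing.isLinear.Build _ _ _ _ B B_linear).
have BE : B = BL by [].
have BM c : multilinear n (B c).
  have M0 : multilinear n (0 : relfree V).
    by exists 0; [move=> t; rewrite msupp0 in_fset0 | rewrite linear0].
  rewrite /B; elim/big_rec: _ => // i u _ [f fM ->].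
  have [g gM ->] := bM i; exists (c 0 i *: g + f); last by rewrite linearP.
  move=> t /(fsubsetP (msuppD_le _ _)); rewrite in_fsetU => /orP[]; last exact: fM.
  by move=> /(fsubsetP (msuppZ_le _ _))/gM.
have Bin u : multilinear n u -> exists c, u = B c.
  by move=> /bU [c [uc _]]; exists c.
have Binj c c' : B c = B c' -> c = c'.
  move=> eB; have [c0 [_ U0]] := bU _ (BM c).
  by rewrite -(U0 c) // -(U0 c').
have actB s c : perm_act s (B c) = B (c *m rG s).
  rewrite /B linear_sum /= .
  under eq_bigr => i _ do rewrite linearZ /= bA scaler_sumr.
  rewrite exchange_big /=; apply: eq_bigr => j _.
  by rewrite mxE scaler_suml; apply: eq_bigr => i _; rewrite scalerA.
have one_morph : {morph (fun _ : 'S_n => 1 : Phi) : x y / (x * y)%g >-> x * y}.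
  by move=> x y; rewrite mulr1.
have one_sqr : forall x : 'S_n, (1 : Phi) * 1 = 1 by move=> x; rewrite mulr1.
pose SH := signed_sum (head_group Q.*2) (fun _ => 1) rG.
have rkSH : (\rank SH <= C)%N.
  have /choice [cv cvE] : forall i : 'I_(size vs), exists c, vs`_i = B c.
    by move=> i; apply/Bin/vsM/mem_nth.
  apply: leq_trans vsC; pose W := \matrix_i cv i.
  apply: leq_trans (rank_leq_row W); apply/mxrankS/row_subP => i.
  have [e eE] := symH _ (BM (delta_mx 0 i)).
  apply/submxP; exists (\row_k e k).
  apply: Binj; rewrite -[in LHS](mul1mx SH) row_mul row1 /SH /signed_sum.
  rewrite mulmx_sumr BE raddf_sum /=.
  under eq_bigr => h _ do rewrite scale1r -actB.
  rewrite eE mulmx_sum_row BE raddf_sum /=; apply: eq_bigr => k _.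
  by rewrite mxE BE linearZ /= rowK -cvE.
apply: leq_trans rkSH.
rewrite (rank_signed_sum charPhi (head_group Q.*2) one_morph one_sqr trE); apply: leq_sum => p _.
have [->//|m_gt0] := posnP (m p); rewrite leq_pmulr //.
apply: signed_sum_submod_neq0.
apply: (young_symmetrizer_signed_sum charPhi) => r c h Rr Cc Hh rch.
rewrite mulr1; suff -> : c = 1%g by rewrite odd_perm1 expr0.
(* [c] will be seen to preserve rows as well, being a product of a row permutation and of an element
   of the head group, whose moved letters all stand in the first row. *)
apply: row_col_stab (Cc).
have -> : c = (r^-1 * h^-1)%g by rewrite -[c](mulKg r) -[(r * c)%g](mulgK h) rch mul1g.
rewrite row_stabE groupM ?groupV //.
apply: subsetP Hh; rewrite -/(row_stab p).
have le_row : (n - Q.*2 <= nth 0 (parts p) 0)%N.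
  rewrite leqNgt; apply/negP => lt_row.
  pose sgn (s : 'S_n) := (-1) ^+ s : Phi.
  have sgnM : {morph sgn : x y / (x * y)%g >-> x * y}.
    by move=> x y; rewrite /sgn odd_permM signr_addb.
  have sgn_sqr x : sgn x * sgn x = 1 by rewrite /sgn -expr2 sqrr_sign.
  pose K : {group 'S_n} := fun_stab_group (fun i : 'I_n => reshape_offset (parts p) i).
  suff SK0 : signed_sum K sgn rG = 0.
    have := rank_signed_sum charPhi K sgnM sgn_sqr trE.
    rewrite SK0 mxrank0 (bigD1 p) //= => /esym/eqP; rewrite addn_eq0 muln_eq0.
    rewrite -[m p == 0%N]negbK -lt0n m_gt0 /= => /andP[/eqP rk0 _].
    suff: (0 < \rank (signed_sum K sgn (submod_repr (cyclic_mx_module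
       (regular_repr Phi [set: 'S_n]) (young_symmetrizer Phi p)))))%N by rewrite rk0.
    apply: signed_sum_submod_neq0.
    apply: (young_symmetrizer_signed_sum charPhi) => r1 c1 h1 Rr1 Cc1 Hh1 rch1.
    suff r11 : r1 = 1%g.
      move: rch1; rewrite r11 mul1g => /(canRL (mulKg _)); rewrite mulg1 => ->.
      by rewrite -/(sgn _) /sgn odd_permV sgn_sqr.
    apply: row_col_stab (Rr1) _.
    have -> : r1 = (h1^-1 * c1^-1)%g.
      by apply: (mulIg (c1 * h1)%g); rewrite -invMg mulVg mulgA.
    by rewrite col_stabE groupM ?groupV.
  have fc (i : 'I_n) : (reshape_offset (parts p) i < nth 0 (parts p) 0)%N.
    have lti : (i < sumn (parts p))%N by rewrite sumn_parts.
    apply: leq_trans (reshape_offsetP lti) _.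
    have geq_trans : transitive geq by move=> x y z /= yx xz; apply: leq_trans xz yx.
    apply: (sorted_leq_nth geq_trans leqnn 0%N (parts_sorted p)) => //.
      by rewrite inE; case: (parts p) lti.
    exact: reshape_indexP.
  (* Letters are paired inside columns. There are no more columns than boxes in the first row, so
     fewer than [n - Q.*2] letters stay unpaired and at least [Q] pairs arise. *)
  have [ps [Ups _ psK le_n]] := tperm_pairing (enum_uniq 'I_n) (fun i _ => fc i).
  have szps : (Q <= size ps)%N.
    move: le_n lt_row; rewrite size_enum_ord.
    by move: (nth _ _ _) => a; clear; lia.
  pose M (qs : seq ('I_n * 'I_n)) : 'M[Phi]_d :=
    foldr (fun q A => A - A *m rG (tperm q.1 q.2)) 1%:M qs.
  have altB qs c0 : alternate qs (B c0) = B (c0 *m M qs).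
    elim: qs => [|q qs IH] /=; first by rewrite mulmx1.
    by rewrite IH actB mulmxBr BE raddfB /= mulmxA.
  have M0 : M ps = 0.
    apply/row_matrixP => i; apply: Binj.
    rewrite -[in LHS](mul1mx (M ps)) row_mul row1 -altB altH // .
    by rewrite row0 BE raddf0.
  (* Each transposition preserves columns and acts on the signed sum by [-1], so each factor
     [1 - tperm] doubles it; with [M ps = 0] the sum must vanish. *)
  have : M ps *m signed_sum K sgn rG = 2 ^+ size ps *: signed_sum K sgn rG.
    elim: (ps) psK Ups => [|q qs IH] /=; first by rewrite mul1mx scale1r.
    case/andP=> /eqP fq /IH{}IH; rewrite inE negb_or => /and3P[/andP[q12 _] _ /IH{}IH].
    have Kq : tperm q.1 q.2 \in K.
      apply/fun_stabP => i; case: tpermP => [->|->|] //.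
    rewrite mulmxBl -mulmxA mul_signed_sum // /sgn odd_tperm q12 expr1 scaleN1r.
    by rewrite mulmxN opprK IH -scalerDl exprS mulr2n mulrDl mul1r.
  rewrite M0 mul0mx => /esym/eqP; rewrite scaler_eq0 expf_eq0.
  by rewrite ((pcharf0P Phi).1 charPhi 2) andbF => /eqP.
apply/subsetP => g /head_groupP gh; apply/fun_stabP => i.
have row0 (j : nat) : (j < n - Q.*2)%N -> reshape_index (parts p) j = 0%N.
  move=> ltj; have := @flatten_indexKl (parts p) 0 j (leq_trans ltj le_row).
  by rewrite /flatten_index take0 add0n.
by have := gh i; case: ifP => [lti ltgi|_ /eqP-> //]; rewrite !row0.
Qed.

End PermAct.

(** * Words in the relatively free algebra *)

Section RelativelyFree.
Variables (Phi : fieldType) (V : linAlgebra Phi -> Prop).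

Local Notation A := (relfree_algebra V).

Definition gen (i : nat) : A := to_relfree V << Letter i >>.

Lemma polyeval_sub (B : linAlgebra Phi) (b : nat -> B) (a : nat -> free_algebra Phi) f :
  polyeval b (polyeval a f) = polyeval (fun i => polyeval b (a i)) f.
Proof.
rewrite /polyeval (linext_comp _ (linext (mageval b))); apply: eq_linext => t /=.
by elim: t => //= u IHu v IHv; rewrite -/(polyeval b _) polyevalM /= /polyeval IHu IHv.
Qed.

Lemma to_relfree_polyeval (a : nat -> free_algebra Phi) f :
  to_relfree V (polyeval a f) = polyeval (fun i => to_relfree V (a i) : A) f.
Proof.
rewrite /polyeval (linext_comp _ (to_relfree V)); apply: eq_linext => t /=.
elim: t => //= u <- v <-; exact/esym/relfree_mulE.
Qed.

(** A valuation in the relatively free algebra lifts to a substitution in the free algebra, and a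
    substitution instance of a defining identity of [V] is again an identity of [V]. *)
Lemma relfree_in_variety : variety V -> V A.
Proof.
case=> I VI; apply/VI => f If a.
have -> : a = (fun i => to_relfree V (repr (a i))) by apply: funext => i; rewrite to_relfreeK.
rewrite -to_relfree_polyeval -(linear0 (to_relfree V)); apply/to_relfree_eq.
rewrite subr0; apply/identitiesP => B VB b; rewrite polyeval_sub.
exact: (VI B).1 VB f If _.
Qed.

Lemma mageval_gen w : mageval gen w = to_relfree V << w >>.
Proof.
elim: w => //= u -> v ->; rewrite [LHS]relfree_mulE; congr (to_relfree V _).
by rewrite /free_mul !linextU.
Qed.

Lemma to_relfreeE f : to_relfree V f = \sum_(w <- msupp f) f@_w *: (mageval gen w : relfree V).
Proof.
rewrite {1}[f]monalgE raddf_sum /=; apply: eq_bigr => w _.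
rewrite mageval_gen -linearZ /=; congr (to_relfree V _).
by apply/malgP => u; rewrite mcoeffZ !mcoeffU; case: eqP => _; rewrite ?mulr1 ?mulr0 ?mulr0n ?mulr1n.
Qed.

End RelativelyFree.

Lemma eq_foldl_in (S : eqType) (T : Type) (f g : T -> S -> T) x l :
  (forall u i, i \in l -> f u i = g u i) -> foldl f x l = foldl g x l.
Proof.
elim: l x => //= i l IH x fg; rewrite fg ?mem_head // IH // => u j lj.
by rewrite fg // inE lj orbT.
Qed.

Section Span.
Variables (Phi : fieldType) (U : lmodType Phi).

Inductive span (S : U -> Prop) : U -> Prop :=
| span0 : span S 0
| span_gen u : S u -> span S u
| spanD u v : span S u -> span S v -> span S (u + v)
| spanZ c u : span S u -> span S (c *: u).

Lemma spanN S u : span S u -> span S (- u).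
Proof. by rewrite -scaleN1r; apply: spanZ. Qed.
Lemma spanB S u v : span S u -> span S v -> span S (u - v).
Proof. by move=> Su Sv; apply: spanD Su (spanN Sv). Qed.
Lemma span_sum S I (r : seq I) (F : I -> U) :
  (forall i, span S (F i)) -> span S (\sum_(i <- r) F i).
Proof. by move=> SF; elim/big_ind: _ => //; [exact: span0|exact: spanD]. Qed.
Lemma span_sum_in S (I : eqType) (r : seq I) (F : I -> U) :
  (forall i, i \in r -> span S (F i)) -> span S (\sum_(i <- r) F i).
Proof. by move=> SF; rewrite big_seq; elim/big_ind: _ => //; [exact: span0|exact: spanD]. Qed.
Lemma span_sub (S T : U -> Prop) u : (forall v, S v -> span T v) -> span S u -> span T u.
Proof.
move=> ST; elim=> *; [exact: span0|exact: ST|exact: spanD|exact: spanZ].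
Qed.
Lemma span_trans S u v w : span S (u - v) -> span S (v - w) -> span S (u - w).
Proof. by move=> uv vw; rewrite -(subrKA v); apply: spanD. Qed.
Lemma span_sym S u v : span S (u - v) -> span S (v - u).
Proof. by move=> uv; rewrite -opprB; apply: spanN. Qed.
Lemma span_congr S u v : span S (u - v) -> span S v -> span S u.
Proof. by move=> uv Sv; rewrite -(subrK v u); apply: spanD. Qed.
End Span.

(** * Left-normed words, filtered by the number of right factors in the square of the algebra *)

Definition is_letter (w : magma) : bool := if w is Letter _ then true else false.

Definition nprod (ws : seq magma) : nat := count (predC is_letter) ws.

Lemma nprod_cat ws1 ws2 : nprod (ws1 ++ ws2) = (nprod ws1 + nprod ws2)%N.
Proof. exact: count_cat. Qed.
Lemma nprod_cons w ws : nprod (w :: ws) = (~~ is_letter w + nprod ws)%N.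
Proof. by []. Qed.
Lemma nprod_letters L : all is_letter L -> nprod L = 0%N.
Proof. by rewrite /nprod; elim: L => //= w L IH /andP[-> /IH->]. Qed.

Definition all_letters (ws : seq magma) : seq nat := flatten (map letters ws).
Lemma all_letters_cat ws1 ws2 : all_letters (ws1 ++ ws2) = all_letters ws1 ++ all_letters ws2.
Proof. by rewrite /all_letters map_cat flatten_cat. Qed.
Lemma all_letters_cons w ws : all_letters (w :: ws) = letters w ++ all_letters ws.
Proof. by []. Qed.

Lemma perm_all_letters ws ws' :
  perm_eq ws ws' -> perm_eq (all_letters ws) (all_letters ws').
Proof. by move=> p; apply/perm_flatten/perm_map. Qed.

Section Words.
Variables (Phi : fieldType) (A : linAlgebra Phi) (X : nat -> A).
Hypothesis leibA : leibniz A.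
Local Notation "'ev' w" := (mageval X w) (at level 10, w at level 8).

Definition wact (v : A) (ws : seq magma) : A := act v (map (mageval X) ws).
Definition word (a : nat) (ws : seq magma) : A := wact (X a) ws.

Lemma wact_cat v ws1 ws2 : wact v (ws1 ++ ws2) = wact (wact v ws1) ws2.
Proof. by rewrite /wact map_cat act_cat. Qed.
Lemma wact_cons v w ws : wact v (w :: ws) = wact (v ** ev w) ws.
Proof. by []. Qed.
Lemma word_cat a ws1 ws2 : word a (ws1 ++ ws2) = wact (word a ws1) ws2.
Proof. exact: wact_cat. Qed.

Definition wordspan t (I : seq nat) : A -> Prop :=
  span (fun u => exists a ws,
    [/\ perm_eq (a :: all_letters ws) I, (t <= nprod ws)%N & u = word a ws]).

Lemma wordspan_word t I a ws :
  perm_eq (a :: all_letters ws) I -> (t <= nprod ws)%N -> wordspan t I (word a ws).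
Proof. by move=> *; apply: span_gen; exists a, ws. Qed.

Lemma wordspanS t t' I u : (t <= t')%N -> wordspan t' I u -> wordspan t I u.
Proof.
move=> le_tt'; apply: span_sub => _ [a [ws [pI le ->]]].
by apply: wordspan_word pI (leq_trans le_tt' le).
Qed.

(** The Leibniz identity read backwards: right multiplication by a product is a commutator of right
    multiplications. *)
Lemma wact_prod v u w ws :
  wact v (Prod u w :: ws) = wact v (u :: w :: ws) - wact v (w :: u :: ws).
Proof.
transitivity (wact (v ** ev u ** ev w - v ** ev w ** ev u) ws); last by rewrite /wact actB.
by rewrite leibA [X in X - _]addrC addrK.
Qed.

(** Follow the left branch of the tree down to its letter; the right subtrees met on the way are the
    factors. *)
Lemma ev_wordspan w : wordspan 0 (letters w) (ev w).
Proof.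
suff [a [ws [lw ->]]] : exists a ws, letters w = a :: all_letters ws /\ ev w = word a ws.
  by apply: wordspan_word; rewrite ?lw.
elim: w => [i|u [a [ws [lu evu]]] v _]; first by exists i, [::].
exists a, (rcons ws v); rewrite /= lu evu /word /wact map_rcons act_rcons.
by rewrite -cats1 all_letters_cat /all_letters /= cats0.
Qed.

(* The j-th iterate of D |-> D A^2 starting at D = A^2. *)
Fixpoint square_power (j : nat) : A -> Prop :=
  span (if j is j'.+1 then fun u => exists v x y, square_power j' v /\ u = v ** (x ** y)
        else fun u => exists x y, u = x ** y).

(** Both Leibniz terms of [(v (y z)) x], namely [(v x) (y z)] and [v ((y z) x)], end with a
    product. *)
Lemma square_powerM j u x : square_power j u -> square_power j (u ** x).
Proof.
elim: j u x => [|j IH] u x.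
  by move=> _; apply: span_gen; exists u, x.
move=> Du; rewrite /= in Du *.
elim: Du => [|_ [v [y [z [Dv ->]]]]|u1 u2 _ D1 _ D2|c u1 _ D1].
- by rewrite amul0l; apply: span0.
- rewrite leibA; apply: spanD; apply: span_gen.
    by exists (v ** x), y, z; split=> //; apply: IH.
  by exists v, (y ** z), x.
- by rewrite amulDl; apply: spanD.
- by rewrite amulZl; apply: spanZ.
Qed.

Lemma square_powerS j u x : square_power j u ->
  (exists y z, x = y ** z) -> square_power j.+1 (u ** x).
Proof. by move=> Du [y [z ->]]; apply: span_gen; exists u, y, z. Qed.

Lemma square_power0 s u : satisfies_NsA s A -> square_power s u -> u = 0.
Proof.
move=> nilA; suff gens j u1 : square_power j u1 ->
    span (fun u => exists x : nat -> A, u = foldl (fun u i => u ** (x i.*2 ** x i.*2.+1))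
       (x 0%N ** x 1%N) (iota 1 j)) u1.
  by move=> /gens; elim=> [//|_ [x ->]|u1 u2 _ -> _ ->|c u1 _ ->]; rewrite ?addr0 ?scaler0 //.
elim: j u1 => [|j IH] u1.
  apply: span_sub => _ [x [y ->]]; apply: span_gen.
  by exists (fun i => if i == 0%N then x else y).
apply: span_sub => _ [v [x [y [/IH Dv ->]]]].
elim: Dv => [|_ [z ->]|v1 v2 _ D1 _ D2|c v1 _ D1].
- by rewrite amul0l; apply: span0.
- apply: span_gen.
  exists (fun i => if (i < j.+1.*2)%N then z i else if i == j.+1.*2 then x else y).
  have -> : iota 1 j.+1 = rcons (iota 1 j) j.+1 by rewrite -(addn1 j) iotaD cats1 addnC.
  rewrite foldl_rcons ltnn eqxx [(j.+1.*2.+1 < _)%N]ltnNge leqnSn /=.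
  rewrite gtn_eqF //; congr (_ ** _); apply: eq_foldl_in => u2 i.
  rewrite mem_iota add1n => /andP[_ lt_ij].
  by rewrite ltn_double lt_ij -doubleS leq_double lt_ij.
- by rewrite amulDl; apply: spanD.
- by rewrite amulZl; apply: spanZ.
Qed.

Lemma square_powerW j u : square_power j.+1 u -> square_power j u.
Proof.
rewrite [square_power j.+1]/=.
elim=> [|_ [v [x [y [Dv ->]]]]|u1 u2 _ D1 _ D2|c u1 _ D1].
- by case: j => [|j]; apply: span0.
- exact: square_powerM.
- by case: j D1 D2 => [|j]; apply: spanD.
- by case: j D1 => [|j]; apply: spanZ.
Qed.

Lemma wact_square_power j v ws :
  square_power j v -> square_power (j + nprod ws) (wact v ws).
Proof.
elim: ws j v => [|w ws IH] j v Dv; first by rewrite addn0.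
case: w => [i|u w]; first by apply: IH; apply: square_powerM.
rewrite /nprod /= addnCA add1n -addSn; apply: IH; apply: square_powerS => //.
by exists (ev u), (ev w).
Qed.

(** The leading letter and the first factor together only give an element of the square, whether or
    not that factor is itself a product. One product may thus be lost in the count, which explains
    the strict inequality. *)
Lemma word_nilpotent s a ws : satisfies_NsA s A -> (s < nprod ws)%N -> word a ws = 0.
Proof.
move=> nilA lt_s; apply: (@square_power0 s) => //.
case: ws lt_s => // w ws lt_s; rewrite /word wact_cons.
have : square_power (0 + nprod ws) (wact (X a ** ev w) ws).
  by apply: wact_square_power; apply: span_gen; exists (X a), (ev w).
have : (s <= 0 + nprod ws)%N.
  by move: lt_s; rewrite /nprod /=; case: (is_letter w); [apply: ltnW|].
move: (0 + nprod ws)%N => n le_sn; elim: n le_sn => [|n IH].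
  by rewrite leqn0 => /eqP->.
by rewrite leq_eqVlt => /orP[/eqP-> //|/IH Dn /square_powerW].
Qed.

Lemma wordspan_nilpotent s t I u : satisfies_NsA s A -> (s < t)%N -> wordspan t I u -> u = 0.
Proof.
move=> nilA lt_st; elim=> [//|_ [a [ws [_ le ->]]]|u1 u2 _ -> _ ->|c u1 _ ->].
- exact: word_nilpotent nilA (leq_trans lt_st le).
- by rewrite addr0.
- by rewrite scaler0.
Qed.

(** By [wact_prod] the difference is the word with [Prod x y] in place of the two letters, one level
    deeper. *)
Lemma word_swap a ws1 x y ws2 I :
    perm_eq (a :: all_letters (ws1 ++ x :: y :: ws2)) I -> is_letter x -> is_letter y ->
  wordspan (nprod (ws1 ++ ws2)).+1 I
    (word a (ws1 ++ x :: y :: ws2) - word a (ws1 ++ y :: x :: ws2)).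
Proof.
move=> pI lx ly; rewrite !word_cat -wact_prod -word_cat; apply: wordspan_word.
  by move: pI; rewrite !all_letters_cat !all_letters_cons /= -catA.
by rewrite !nprod_cat /nprod /= add1n addnS.
Qed.

Lemma word_move a ws1 L x ws2 I :
    perm_eq (a :: all_letters (ws1 ++ x :: L ++ ws2)) I -> is_letter x -> all is_letter L ->
  wordspan (nprod (ws1 ++ ws2)).+1 I
    (word a (ws1 ++ x :: L ++ ws2) - word a (ws1 ++ L ++ x :: ws2)).
Proof.
move=> pI lx; elim: L ws1 pI => [|y L IH] ws1 pI /=.
  by rewrite subrr => _; apply: span0.
case/andP=> ly lL.
apply: span_trans (word a (ws1 ++ y :: x :: L ++ ws2)) _ _ _.
  have := word_swap pI lx ly; rewrite !nprod_cat (nprod_letters lL); exact.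
have := IH (rcons ws1 y); rewrite !cat_rcons !nprod_cat nprod_cons ly add0n; apply=> //.
apply: perm_trans pI; rewrite perm_cons !all_letters_cat perm_cat2l.
by rewrite !all_letters_cons !catA perm_cat2r perm_catC.
Qed.

Lemma word_perm a ws1 L L' ws2 I :
    perm_eq (a :: all_letters (ws1 ++ L ++ ws2)) I -> all is_letter L -> perm_eq L L' ->
  wordspan (nprod (ws1 ++ ws2)).+1 I
    (word a (ws1 ++ L ++ ws2) - word a (ws1 ++ L' ++ ws2)).
Proof.
elim: L ws1 L' => [|x L IH] ws1 L' pI /=.
  by move=> _; rewrite perm_sym => /perm_nilP->; rewrite subrr; apply: span0.
case/andP=> lx lL pL; have xL' : x \in L' by rewrite -(perm_mem pL) mem_head.
have := xL'; move/perm_to_rem; case/splitPr: xL' pL => P Q pL _.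
have pPQ : perm_eq L (P ++ Q).
  rewrite -(perm_cons x); apply: perm_trans pL _; by rewrite -[x :: Q]cat1s perm_catCA.
have lPQ : all is_letter (P ++ Q) by rewrite -(perm_all _ pPQ).
have [lP lQ] : all is_letter P /\ all is_letter Q by apply/andP; rewrite -all_cat.
apply: span_trans (word a (ws1 ++ x :: (P ++ Q) ++ ws2)) _ _ _.
  have := IH (rcons ws1 x) (P ++ Q); rewrite !cat_rcons !nprod_cat nprod_cons lx add0n; exact.
rewrite -!catA /=; have := @word_move a ws1 P x (Q ++ ws2) I.
rewrite !nprod_cat (nprod_letters lQ) add0n; apply=> //.
apply: perm_trans pI; rewrite perm_cons; apply: perm_all_letters.
by rewrite perm_cat2l /= perm_cons [L ++ ws2]/= catA perm_cat2r perm_sym.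
Qed.

Definition is_small (w : magma) : bool :=
  match w with
  | Letter _ => true
  | Prod (Letter _) (Letter _) => true
  | _ => false
  end.

Lemma letters_gt0 w : (0 < size (letters w))%N.
Proof. by elim: w => //= u IH v _; rewrite size_cat ltn_addr. Qed.

Lemma size_all_letters ws : (size ws <= size (all_letters ws))%N.
Proof.
elim: ws => //= w ws IH; rewrite all_letters_cons size_cat -add1n.
exact: leq_add (letters_gt0 w) IH.
Qed.

(** A product with a product inside is split by [wact_prod]; of the two pieces at least one is still
    a product, so the level does not drop, while the number of factors grows. After that the number
    of letters hidden in products is exactly twice the number of products. *)
Lemma wordspan_small t I u : wordspan t I u ->
  span (fun u => exists a ws, [/\ perm_eq (a :: all_letters ws) I, (t <= nprod ws)%N,
    all is_small ws & u = word a ws]) u.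
Proof.
elim=> [|_ [a [ws [pI le_t ->]]]|u1 u2 _ D1 _ D2|c u1 _ D1];
  [exact: span0| |exact: spanD|exact: spanZ].
have [n] := ubnP (size (all_letters ws) - size ws).
elim: n ws pI le_t => // n IH ws pI le_t; rewrite ltnS => le_n.
have [sm|] := boolP (all is_small ws); first by apply: span_gen; exists a, ws.
case/allPn=> w ws_w nsm; case/splitPr: ws_w pI le_t le_n => ws1 ws2 pI le_t le_n.
case: w nsm pI le_t le_n => // w1 w2 nsm pI le_t le_n.
have step x y :
    perm_eq (all_letters (ws1 ++ x :: y :: ws2)) (all_letters (ws1 ++ Prod w1 w2 :: ws2)) ->
    (1 <= ~~ is_letter x + ~~ is_letter y)%N ->
    span (fun u => exists a ws, [/\ perm_eq (a :: all_letters ws) I, (t <= nprod ws)%N,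
      all is_small ws & u = word a ws]) (word a (ws1 ++ x :: y :: ws2)).
  move=> p le1; apply: IH.
  - by apply: perm_trans pI; rewrite perm_cons.
  - apply: leq_trans le_t _; rewrite !nprod_cat leq_add2l !nprod_cons addnA.
    by rewrite leq_add2r.
  have := size_all_letters (ws1 ++ x :: y :: ws2); have := perm_size p.
  by move: le_n; rewrite !size_cat /=; lia.
rewrite word_cat wact_prod -!word_cat; apply: spanB.
  apply: (step); first by rewrite !all_letters_cat !all_letters_cons /= -catA.
  by case: w1 nsm {pI le_t le_n step} => // i; case: w2.
apply: step; last by case: w1 nsm {pI le_t le_n} => // i; case: w2.
rewrite !all_letters_cat !all_letters_cons /= -catA perm_cat2l.
by rewrite perm_catCA.
Qed.

(** On its way to the right, [w] either lets a letter [k] pass in front of it or absorbs it: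
    [(v w) k = (v k) w + v (w k)]. *)
Lemma wact_move_letters w K : ~~ is_letter w -> all is_letter K ->
  exists Q : seq (seq magma * magma),
    (forall q, q \in Q -> [/\ all is_letter q.1, ~~ is_letter q.2
       & perm_eq (all_letters (rcons q.1 q.2)) (all_letters (w :: K))]) /\
    forall v, wact v (w :: K) = \sum_(q <- Q) wact v (rcons q.1 q.2).
Proof.
elim: K w => [|k K IH] w lw.
  move=> _; exists [:: ([::], w)]; split=> [q|v]; last by rewrite big_seq1.
  by rewrite inE => /eqP->.
case/andP=> lk lK; have [Q1 [Q1P Q1E]] := IH w lw lK.
have [//|Q2 [Q2P Q2E]] := IH (Prod w k) _ lK.
exists ([seq (k :: q.1, q.2) | q <- Q1] ++ Q2); split=> [q|v].
  rewrite mem_cat => /orP[/mapP[q' /Q1P[l1 l2 p] ->]|/Q2P[l1 l2 p]]; split=> //=.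
  - by rewrite lk.
  - rewrite all_letters_cons; apply: perm_trans (_ : perm_eq (letters k ++ all_letters (w :: K)) _).
      by rewrite perm_cat2l.
    by rewrite !all_letters_cons perm_catCA.
  - by apply: perm_trans p _; rewrite !all_letters_cons /= -catA.
rewrite big_cat big_map /=; under eq_bigr => q _ do rewrite wact_cons.
rewrite -Q1E -Q2E !wact_cons {1 2 3}/wact -actD; congr (act _ _).
by rewrite leibA.
Qed.

(** An exact equality, not one modulo deeper words. The number of products is preserved, so a
    stretch with [r] products ends in [r] consecutive ones, to which the chain identity for [r]
    applies. *)
Lemma wact_normal_order W :
  exists Q : seq (seq magma * seq magma),
    (forall q, q \in Q -> [/\ all is_letter q.1, all (predC is_letter) q.2,
        size q.2 = nprod W & perm_eq (all_letters (q.1 ++ q.2)) (all_letters W)]) /\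
    forall v, wact v W = \sum_(q <- Q) wact v (q.1 ++ q.2).
Proof.
elim: W => [|w W [Q [QP QE]]].
  exists [:: ([::], [::])]; split=> [q|v]; last by rewrite big_seq1.
  by rewrite inE => /eqP->.
have [lw|nlw] := boolP (is_letter w).
  exists [seq (w :: q.1, q.2) | q <- Q]; split=> [_ /mapP[q /QP[l1 l2 sz p] ->]|v].
    by split=> //=; rewrite ?lw // !all_letters_cons perm_cat2l.
  by rewrite wact_cons QE big_map.
have /choice [R RP] : forall K : seq magma, exists R : seq (seq magma * magma), all is_letter K ->
   (forall q, q \in R -> [/\ all is_letter q.1, ~~ is_letter q.2
       & perm_eq (all_letters (rcons q.1 q.2)) (all_letters (w :: K))]) /\
    forall v, wact v (w :: K) = \sum_(q <- R) wact v (rcons q.1 q.2).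
  move=> K; have [lK|] := boolP (all is_letter K); last by exists [::].
  by have [R RP] := wact_move_letters nlw lK; exists R.
exists (flatten [seq [seq (r.1, r.2 :: q.2) | r <- R q.1] | q <- Q]); split=> [q|v].
  case/flatten_mapP=> q' Qq' /mapP[r Rr ->]; have [l1 l2 sz p] := QP _ Qq'.
  have [rP _] := RP _ l1; have [r1 r2 rp] := rP r Rr; split=> //=.
  - by rewrite r2.
  - by rewrite sz /nprod /= nlw.
  rewrite -cat_rcons all_letters_cat; apply: perm_trans (_ : perm_eq (all_letters (w :: q'.1) ++ all_letters q'.2) _).
    by rewrite perm_cat2r.
  by rewrite -all_letters_cat /= !all_letters_cons perm_cat2l.
rewrite wact_cons QE big_flatten big_map /=; apply: eq_big_seq => q Qq.
have [l1 _ _ _] := QP _ Qq; have [_ RE] := RP _ l1.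
rewrite -wact_cons -cat_cons wact_cat RE /wact act_sum big_map; apply: eq_bigr => r _.
by rewrite -cat_rcons map_cat act_cat.
Qed.

End Words.

(** * Polarization *)

Section WordDerivative.
Variable W : Type.
Implicit Types (y : W) (u : seq (option W)).

(* A hole [None] stands for the variable with respect to which we polarise. *)
Fixpoint pders y u : seq (seq (option W)) :=
  match u with
  | [::] => [::]
  | None :: u' => (Some y :: u') :: map (cons None) (pders y u')
  | o :: u' => map (cons o) (pders y u')
  end.

Definition holes u : nat := count (fun o => ~~ isSome o) u.
Definition filled u : seq W := pmap id u.

Lemma pders_cat y u u' :
  pders y (u ++ u') = map (cat^~ u') (pders y u) ++ map (cat u) (pders y u').
Proof.
elim: u => [|[w|] u IH] /=; first by rewrite map_id.
  by rewrite IH map_cat -!map_comp.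
by rewrite IH map_cat -!map_comp.
Qed.

Lemma pders_filled y ws : pders y (map Some ws) = [::].
Proof. by elim: ws => //= w ws ->. Qed.

Lemma size_pders y u : size (pders y u) = holes u.
Proof. by elim: u => //= -[w|] u IH; rewrite /= size_map IH. Qed.

Fixpoint pderss (ys : seq W) (U : seq (seq (option W))) : seq (seq (option W)) :=
  if ys is y :: ys' then pderss ys' (flatten (map (pders y) U)) else U.

Lemma pderss_cat ys U1 U2 : pderss ys (U1 ++ U2) = pderss ys U1 ++ pderss ys U2.
Proof. by elim: ys U1 U2 => //= y ys IH U1 U2; rewrite map_cat flatten_cat IH. Qed.

Lemma pderss_map ys (I : Type) (r : seq I) (f : I -> seq (option W)) :
  pderss ys (map f r) = flatten (map (fun i => pderss ys [:: f i]) r).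
Proof.
elim: r => [|i r IH] /=; first by elim: ys.
by rewrite -IH -cat1s pderss_cat.
Qed.

End WordDerivative.

Lemma pders_map (W W' : Type) (f : W -> W') y u :
  pders (f y) (map (omap f) u) = map (map (omap f)) (pders y u).
Proof. by elim: u => //= -[w|] u IH; rewrite /= IH -!map_comp. Qed.

Lemma mem_pders (y : nat) (x x' : seq (option nat)) : x' \in pders y x ->
  holes x = (holes x').+1 /\ perm_eq (filled x') (y :: filled x).
Proof.
elim: x x' => //= -[w|] x IH x' /=.
  case/mapP=> z /IH[-> p] ->; split=> //=.
  rewrite /filled /= -/(filled z) -/(filled x) -(perm_cons w) in p *.
  by apply: perm_trans p _; rewrite (perm_catCA [:: w] [:: y]).
rewrite inE => /orP[/eqP-> //|/mapP[z /IH[-> p] ->]]; split=> //.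
Qed.

Section Vandermonde.
Variables (Phi : fieldType) (U : lmodType Phi).
Hypothesis charPhi : [pchar Phi] =i pred0.

(** Invert the Vandermonde matrix at the points [0, ..., n - 1], which are distinct in
    characteristic zero. *)
Lemma power_sum_eq0 n (F : nat -> U) :
  (forall c : Phi, \sum_(i < n) c ^+ i *: F i = 0) ->
  forall i, (i < n)%N -> F i = 0.
Proof.
move=> F0 i lti; pose a : 'rV[Phi]_n := \row_j j%:R.
have uV : Vandermonde n a \in unitmx.
  rewrite unitmxE det_Vandermonde unitfE; apply/prodf_neq0 => j _.
  apply/prodf_neq0 => l ltjl; rewrite !mxE subr_eq0; apply/eqP => e.
  have : (l - j)%N%:R == 0 :> Phi by rewrite natrB ?(ltnW ltjl) // e subrr.
  by rewrite ((pcharf0P Phi).1 charPhi) subn_eq0 leqNgt ltjl.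
have -> : F i = \sum_(j < n) ((1%:M : 'M[Phi]_n) j (Ordinal lti)) *: F j.
  rewrite (bigD1 (Ordinal lti)) //= mxE eqxx scale1r big1 ?addr0 // => j ne.
  by rewrite mxE (negbTE ne) scale0r.
rewrite -(mulmxV uV).
under eq_bigr => j _ do rewrite mxE scaler_suml.
rewrite exchange_big big1 //= => l _.
transitivity (invmx (Vandermonde n a) l (Ordinal lti) *: \sum_(j < n) (l%:R ^+ j *: F j)).
  rewrite scaler_sumr; apply: eq_bigr => j _.
  by rewrite !mxE scalerA mulrC.
by rewrite F0 scaler0.
Qed.
End Vandermonde.

Section Polarization.
Variables (Phi : fieldType) (A : linAlgebra Phi) (X : nat -> A).
Hypothesis charPhi : [pchar Phi] =i pred0.
Implicit Types (u : seq (option magma)) (v b h : A).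

Definition fill b (o : option magma) : A := if o is Some w then mageval X w else b.
Definition owact b v u : A := act v (map (fill b) u).

(* The coefficient of c ^+ i in the value at b + c *: h. *)
Fixpoint taylor b h v u i : A :=
  match u with
  | [::] => if i is 0 then v else 0
  | Some w :: u' => taylor b h (v ** mageval X w) u' i
  | None :: u' => taylor b h (v ** b) u' i +
                  (if i is i'.+1 then taylor b h (v ** h) u' i' else 0)
  end.

Lemma taylorE b h v u n c : (size u < n)%N ->
  owact (b + c *: h) v u = \sum_(i < n) c ^+ i *: taylor b h v u i.
Proof.
elim: u v n => [|[w|] u IH] v [//|n] /=; rewrite ltnS => lt_n.
- by rewrite big_ord_recl expr0 scale1r big1 ?addr0 // => i _; rewrite scaler0.
- by rewrite -(IH (v ** mageval X w) n.+1) // ltnW.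
have -> : owact (b + c *: h) v (None :: u) =
    owact (b + c *: h) (v ** b) u + c *: owact (b + c *: h) (v ** h) u.
  by rewrite /owact -actZ -actD -amulZr -amulDr.
rewrite (IH (v ** b) n.+1) ?(IH (v ** h) n) // 1?ltnW //.
rewrite big_ord_recl [in RHS]big_ord_recl !expr0 !scale1r addr0 -addrA; congr (_ + _).
rewrite scaler_sumr -big_split; apply: eq_bigr => i _ /=.
by rewrite ?lift0 /= scalerDr scalerA -exprS.
Qed.

Lemma taylor0 b h v u : taylor b h v u 0 = owact b v u.
Proof. by elim: u v => [|[w|] u IH] v //=; rewrite ?addr0 IH. Qed.

Lemma taylor1 b (y : nat) v u :
  taylor b (X y) v u 1 = \sum_(u' <- pders (Letter y) u) owact b v u'.
Proof.
elim: u v => [|[w|] u IH] v /=; first by rewrite big_nil.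
  by rewrite IH big_map.
by rewrite IH taylor0 big_cons big_map addrC.
Qed.

(** At [b + c *: X y] the identity is a polynomial in [c] that vanishes for every [c]; its
    coefficient of degree one is the derivative in the direction of [y]. *)
Lemma polarize_step v n (c : 'I_n -> Phi) (U : 'I_n -> seq (seq (option magma))) :
  (forall b, \sum_(i < n) c i *: \sum_(u <- U i) owact b v u = 0) ->
  forall y b, \sum_(i < n) c i *:
    \sum_(u <- flatten (map (pders (Letter y)) (U i))) owact b v u = 0.
Proof.
(* One successor puts [N] above every degree, the other guarantees that the coefficient of index 1
   exists. *)
move=> U0 y b; pose N := (\max_(i < n) \max_(u <- U i) size u).+2.
have ltN i u : u \in U i -> (size u < N)%N.
  move=> Uu; rewrite /N ltnS; apply: leqW; apply: leq_trans (leq_bigmax i).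
  exact: (@leq_bigmax_seq _ (U i) xpredT size u Uu isT).
pose F k := \sum_(i < n) c i *: \sum_(u <- U i) taylor b (X y) v u k.
have F0 (a : Phi) : \sum_(k < N) a ^+ k *: F k = 0.
  apply: etrans (U0 (b + a *: X y)).
  under eq_bigr => k _ do rewrite /F scaler_sumr.
  rewrite exchange_big; apply: eq_bigr => i _ /=.
  under eq_bigr => k _ do rewrite scalerA mulrC -scalerA.
  rewrite -scaler_sumr; congr (_ *: _).
  transitivity (\sum_(k < N) \sum_(u <- U i) a ^+ k *: taylor b (X y) v u k).
    by apply: eq_bigr => k _; rewrite scaler_sumr.
  rewrite exchange_big; apply: eq_big_seq => u /ltN lt /=.
  by rewrite -taylorE.
have /(_ 1%N isT) := power_sum_eq0 charPhi F0; rewrite /F => E; apply: etrans E.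
apply: eq_bigr => i _; congr (_ *: _); rewrite big_flatten big_map /=.
by apply: eq_bigr => u _; rewrite taylor1.
Qed.

Lemma polarize v n (c : 'I_n -> Phi) (U : 'I_n -> seq (seq (option magma))) :
  (forall b, \sum_(i < n) c i *: \sum_(u <- U i) owact b v u = 0) ->
  forall (ys : seq nat) b,
    \sum_(i < n) c i *: \sum_(u <- pderss (map Letter ys) (U i)) owact b v u = 0.
Proof.
move=> U0 ys; elim: ys U U0 => [|y ys IH] U U0 b; first exact: U0.
exact: (IH (fun i => flatten (map (pders (Letter y)) (U i))) (polarize_step U0 y)).
Qed.

End Polarization.

Section Polarized.
Variables (Phi : fieldType) (U : lmodType Phi).
Implicit Types (val : seq nat -> seq nat -> U) (g : nat -> Phi).

(* The polarised form: each letter of ys goes to the left or to the right, and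
   the coefficient depends on the number of letters on the left. *)
Fixpoint pol g val (ys : seq nat) (S1 S2 : seq nat) : U :=
  if ys is y :: ys' then
    pol (fun k => g k.+1) val ys' (y :: S1) S2 + pol g val ys' S1 (y :: S2)
  else g 0%N *: val S1 S2.

(** The outcome of repeated derivation when the order of the letters on a side is irrelevant: [k]
    and [l] are the free places on the two sides, and a letter may take any of them. *)
Fixpoint weighted val (ys : seq nat) (k l : nat) (S1 S2 : seq nat) : U :=
  if ys is y :: ys' then
    k%:R *: weighted val ys' k.-1 l (y :: S1) S2 +
    l%:R *: weighted val ys' k l.-1 S1 (y :: S2)
  else val S1 S2.

(** A distribution with [k] letters on the left arises from [k! (M - k)!] fillings of the places. *)
Definition hat M g k : Phi := (k`! * (M - k)`!)%:R * g k.

Lemma eq_pol g g' val ys S1 S2 : (forall k, (k <= size ys)%N -> g k = g' k) ->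
  pol g val ys S1 S2 = pol g' val ys S1 S2.
Proof.
elim: ys g g' S1 S2 => [|y ys IH] g g' S1 S2 gg' /=; first by rewrite gg'.
by rewrite (IH _ (fun k => g' k.+1)) ?(IH g g') // => k le_k; apply: gg'; rewrite // ltnW.
Qed.

Lemma weighted_pol val g ys M S1 S2 : size ys = M ->
  \sum_(k < M.+1) g k *: weighted val ys k (M - k) S1 S2 = pol (hat M g) val ys S1 S2.
Proof.
elim: ys M g S1 S2 => [|y ys IH] M g S1 S2 /= <-.
  by rewrite big_ord1 /hat subnn fact0 mul1r.
under eq_bigr => k _ do rewrite scalerDr.
rewrite big_split /=; congr (_ + _).
  rewrite big_ord_recl scale0r scaler0 add0r.
  transitivity (pol (hat (size ys) (fun k => k.+1%:R * g k.+1)) val ys (y :: S1) S2).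
    rewrite -IH //; apply: eq_bigr => k _.
    by rewrite ?lift0 /= subSS scalerA [g _ * _]mulrC.
  apply: eq_pol => k le_k; rewrite /hat subSS mulrA -natrM.
  by rewrite factS; congr (_%:R * _); rewrite mulnC mulnA.
rewrite big_ord_recr /= subnn scale0r scaler0 addr0.
transitivity (pol (hat (size ys) (fun k => ((size ys).+1 - k)%:R * g k)) val ys S1 (y :: S2)).
  rewrite -IH //; apply: eq_bigr => k _; have le_k : (k <= size ys)%N by rewrite -ltnS.
  by rewrite scalerA [g _ * _]mulrC subSn.
apply: eq_pol => k le_k; rewrite /hat mulrA -natrM subSn // factS.
by congr (_%:R * _); rewrite -mulnA [(_`! * _.+1)%N]mulnC.
Qed.

End Polarized.

Section PolarizedWords.
Variables (Phi : fieldType) (A : linAlgebra Phi) (X : nat -> A).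
Hypothesis charPhi : [pchar Phi] =i pred0.
Variables (T : A -> Prop) (v : A) (B C : seq magma).

Definition two_sided (S1 S2 : seq nat) : A :=
  wact X v (map Letter S1 ++ B ++ map Letter S2 ++ C).

Definition two_sided_word (x1 x2 : seq (option nat)) : seq (option magma) :=
  map (omap Letter) x1 ++ map Some B ++ map (omap Letter) x2 ++ map Some C.

Lemma pders_two_sided y x1 x2 : pders (Letter y) (two_sided_word x1 x2) =
  map (two_sided_word^~ x2) (pders y x1) ++ map (two_sided_word x1) (pders y x2).
Proof.
rewrite /two_sided_word !pders_cat !pders_filled !pders_map /= cats0 -!map_comp.
by [].
Qed.

Lemma owact_two_sided b (S1 S2 : seq nat) :
  owact X b v (two_sided_word (map Some S1) (map Some S2)) = two_sided S1 S2.
Proof.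
rewrite /owact /two_sided /wact /two_sided_word !map_cat -!map_comp.
by [].
Qed.

Lemma scale_holes y (x : seq (option nat)) (u : A) :
  (holes x)%:R *: u = \sum_(x' <- pders y x) u.
Proof.
rewrite -(size_pders y) -sum1_size natr_sum scaler_suml.
by apply: eq_bigr => _ _; rewrite scale1r.
Qed.

Variable ys : seq nat.
Hypothesis T_perm : forall S1 S2 S1' S2',
  perm_eq S1 S1' -> perm_eq S2 S2' -> perm_eq (S1 ++ S2) ys ->
  span T (two_sided S1 S2 - two_sided S1' S2').

Lemma no_holes (x : seq (option nat)) : holes x = 0%N -> x = map Some (filled x).
Proof. by elim: x => //= -[w|] x IH //= h; rewrite -IH. Qed.

Lemma span_weighted b zs x1 x2 S1 S2 :
  size zs = (holes x1 + holes x2)%N ->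
  perm_eq (filled x1) S1 -> perm_eq (filled x2) S2 -> perm_eq (zs ++ S1 ++ S2) ys ->
  span T (\sum_(u <- pderss (map Letter zs) [:: two_sided_word x1 x2]) owact X b v u
          - weighted two_sided zs (holes x1) (holes x2) S1 S2).
Proof.
elim: zs x1 x2 S1 S2 => [|z zs IH] x1 x2 S1 S2 /=.
  move=> /esym/eqP; rewrite addn_eq0 => /andP[/eqP h1 /eqP h2] p1 p2 p.
  rewrite big_seq1 (no_holes h1) (no_holes h2) owact_two_sided.
  by apply: T_perm => //; apply: perm_trans p; apply: perm_cat.
move=> sz p1 p2 p; rewrite cats0 pders_two_sided pderss_cat big_cat opprD addrACA.
apply: spanD.
  rewrite pderss_map big_flatten big_map (scale_holes z x1).
  rewrite -sumrB; apply: span_sum_in => x' x'in /=.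
  have [hE pE] := mem_pders x'in.
  have := IH x' x2 (z :: S1) S2; rewrite hE /=; apply.
  - by apply: succn_inj; rewrite sz hE.
  - by apply: perm_trans pE _; rewrite perm_cons.
  - by [].
  - by apply: perm_trans p; rewrite /= (perm_catCA zs [:: z]).
rewrite pderss_map big_flatten big_map (scale_holes z x2).
rewrite -sumrB; apply: span_sum_in => x' x'in /=.
have [hE pE] := mem_pders x'in.
have := IH x1 x' S1 (z :: S2); rewrite hE /=; apply.
- by apply: succn_inj; rewrite sz hE addnS.
- by [].
- by apply: perm_trans pE _; rewrite perm_cons.
- apply: perm_trans p; rewrite /= (catA zs S1 (z :: S2)) (catA zs S1 S2) -[z :: S2]cat1s.
  by rewrite perm_catCA.
Qed.

(** There are exactly as many letters in [ys] as factors [b] in the identity, so complete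
    polarisation leaves no hole and may be read at [b = 0]. *)
Lemma span_pol (g : nat -> Phi) M : size ys = M ->
  (forall b, \sum_(k < M.+1) g k *:
     act v (nseq k b ++ map (mageval X) B ++ nseq (M - k) b ++ map (mageval X) C) = 0) ->
  span T (pol (hat M g) two_sided ys [::] [::]).
Proof.
move=> sy g0; rewrite -weighted_pol //.
pose w (k : 'I_M.+1) := two_sided_word (nseq k None) (nseq (M - k) None).
have := @polarize _ _ X charPhi v M.+1 (fun k => g k) (fun k => [:: w k]).
move=> /(_ _ ys 0) E.
have {}E : \sum_(k < M.+1) g k *:
    \sum_(u <- pderss (map Letter ys) [:: w k]) owact X 0 v u = 0.
  apply: E => b; apply: etrans (g0 b); apply: eq_bigr => k _.
  rewrite big_seq1; congr (_ *: act v _).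
  by rewrite /w /two_sided_word !map_cat !map_nseq -!map_comp.
set P := \sum_(k < _) _; rewrite -(subr0 P) -E /P -sumrB; apply: span_sum => k.
rewrite -scalerBr; apply: spanZ; apply: span_sym.
have le_kM : (k <= M)%N by rewrite -ltnS.
have hn n : holes (nseq n (None : option nat)) = n by rewrite /holes count_nseq mul1n.
have fn n : filled (nseq n (None : option nat)) = [::] by elim: n.
have := @span_weighted 0 ys (nseq k None) (nseq (M - k) None) [::] [::].
by rewrite !hn !fn subnKC // => H; apply: H; rewrite ?cats0 // sy subnKC.
Qed.

End PolarizedWords.

(** * Slots *)

Section Slots.
Local Open Scope nat_scope.
Variable ys : seq nat.
Implicit Types (kappa : nat -> nat) (ps : seq magma) (i n : nat).

Definition slot kappa i : seq magma := [seq Letter y | y <- ys & kappa y == i].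

(* The word with the factors ps, where the letter y is put between the factors
   number kappa y - 1 and kappa y. *)
Fixpoint slots kappa ps i : seq magma :=
  if ps is p :: ps' then slot kappa i ++ p :: slots kappa ps' i.+1
  else slot kappa i.

Fixpoint slots_before kappa ps i n : seq magma :=
  match n, ps with
  | n'.+1, p :: ps' => slot kappa i ++ p :: slots_before kappa ps' i.+1 n'
  | _, _ => [::]
  end.

Definition slots_after kappa ps i : seq magma :=
  if ps is p :: ps' then p :: slots kappa ps' i.+1 else [::].

Lemma slots_split kappa ps i n : (n <= size ps)%N ->
  slots kappa ps i =
  slots_before kappa ps i n ++ slot kappa (i + n) ++ slots_after kappa (drop n ps) (i + n).
Proof.
elim: n ps i => [|n IH] ps i.
  by move=> _; rewrite drop0 addn0; case: ps => [|p ps] /=; rewrite ?cats0.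
by case: ps => //= p ps le_n; rewrite (IH ps i.+1) // addSnnS -catA.
Qed.

Lemma eq_slot kappa kappa' i :
  {in ys, forall y, (kappa y == i) = (kappa' y == i)} -> slot kappa i = slot kappa' i.
Proof. by move=> e; rewrite /slot (eq_in_filter e). Qed.

Lemma eq_slots kappa kappa' ps i :
  (forall l, (i <= l <= i + size ps)%N -> slot kappa l = slot kappa' l) ->
  slots kappa ps i = slots kappa' ps i.
Proof.
elim: ps i => [|p ps IH] i e /=; first by rewrite e // leqnn leq_addr.
rewrite e ?leqnn ?leq_addr // IH // => l /andP[le1 le2]; apply: e.
by rewrite (ltnW le1) -addSnnS.
Qed.

Lemma eq_slots_before kappa kappa' ps i n :
  (forall l, (i <= l < i + n)%N -> slot kappa l = slot kappa' l) ->
  slots_before kappa ps i n = slots_before kappa' ps i n.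
Proof.
elim: n ps i => [|n IH] [|p ps] i e //=; rewrite e ?leqnn ?addnS ?ltnS ?leq_addr //.
rewrite (IH ps i.+1) // => l /andP[le1 le2]; apply: e.
by rewrite (ltnW le1) -addSnnS.
Qed.

Lemma letters_slot kappa i : all is_letter (slot kappa i).
Proof. by rewrite /slot all_map; apply/allP. Qed.

Lemma all_letters_Letter (S : seq nat) : all_letters (map Letter S) = S.
Proof. by elim: S => //= y S IH; rewrite all_letters_cons IH. Qed.

Lemma nprod_slots kappa ps i : all (predC is_letter) ps -> nprod (slots kappa ps i) = size ps.
Proof.
elim: ps i => [|p ps IH] i /=; first by rewrite (nprod_letters (letters_slot _ _)).
case/andP=> np nps; rewrite nprod_cat (nprod_letters (letters_slot _ _)).
by rewrite nprod_cons np IH.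
Qed.

Lemma nprod_slots_before kappa ps i n : all (predC is_letter) ps -> (n <= size ps)%N ->
  nprod (slots_before kappa ps i n) = n.
Proof.
elim: n ps i => [|n IH] [|p ps] i //= /andP[np nps] le_n.
by rewrite nprod_cat (nprod_letters (letters_slot _ _)) nprod_cons np IH.
Qed.

Lemma all_letters_slots kappa ps i :
  perm_eq (all_letters (slots kappa ps i))
    (all_letters ps ++ [seq y <- ys | (i <= kappa y <= i + size ps)%N]).
Proof.
elim: ps i => [|p ps IH] i /=.
  rewrite all_letters_Letter addn0.
  by rewrite (@eq_filter _ _ (fun y => i <= kappa y <= i)) // => y; rewrite eqn_leq andbC.
rewrite all_letters_cat all_letters_Letter !all_letters_cons perm_catCA -catA perm_cat2l.
apply: perm_trans (_ : perm_eq ([seq y <- ys | kappa y == i] ++ all_letters ps ++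
  [seq y <- ys | (i.+1 <= kappa y <= i.+1 + size ps)%N]) _); first by rewrite perm_cat2l.
rewrite perm_catCA perm_cat2l; apply/seq.permP => a.
rewrite count_cat !count_filter -count_predUI [X in (_ + X)%N](_ : _ = 0%N) ?addn0.
  apply: eq_count => y /=; case: (a y) => //=; rewrite addSnnS.
  by case: ltngtP => //= <-; rewrite leq_addr.
by apply/eqP; rewrite -leqn0 leqNgt -has_count; apply/hasPn => y _ /=; case: ltngtP; rewrite ?andbF.
Qed.

Lemma perm_slots kappa ps : {in ys, forall y, kappa y <= size ps}%N ->
  perm_eq (all_letters (slots kappa ps 0)) (all_letters ps ++ ys).
Proof.
move=> le_kappa; apply: perm_trans (all_letters_slots _ _ _) _.
rewrite perm_cat2l (_ : [seq _ <- _ | _] = ys) //; apply/all_filterP/allP => y /le_kappa.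
by rewrite add0n.
Qed.

End Slots.

Definition update (kappa : nat -> nat) (z i y : nat) : nat :=
  if y == z then i else kappa y.

Section SlotPolarization.
Variables (Phi : fieldType) (U : lmodType Phi).
Implicit Types (F : (nat -> nat) -> U) (g : nat -> Phi).

(* As [pol], with the two sides replaced by the slots i and j. *)
Fixpoint slot_pol g F i j (zs : seq nat) (kappa : nat -> nat) : U :=
  if zs is z :: zs' then
    slot_pol (fun k => g k.+1) F i j zs' (update kappa z i) +
    slot_pol g F i j zs' (update kappa z j)
  else g 0%N *: F kappa.

Lemma pol_congr T g (val val' : seq nat -> seq nat -> U) ys S1 S2 :
  (forall S1' S2', perm_eq (S1' ++ S2') (ys ++ S1 ++ S2) ->
     span T (val S1' S2' - val' S1' S2')) ->
  span T (pol g val ys S1 S2 - pol g val' ys S1 S2).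
Proof.
elim: ys g S1 S2 => [|y ys IH] g S1 S2 H /=.
  by rewrite -scalerBr; apply: spanZ; apply: H.
rewrite opprD addrACA; apply: spanD; apply: IH => S1' S2' p; apply: H;
  apply: perm_trans p _; rewrite /=.
  by rewrite (perm_catCA ys [:: y]).
by rewrite (catA ys S1 (y :: S2)) (catA ys S1 S2) -[y :: S2]cat1s perm_catCA.
Qed.

Lemma pol_sum (I : eqType) (r : seq I) g (val : I -> seq nat -> seq nat -> U) ys S1 S2 :
  pol g (fun S1 S2 => \sum_(q <- r) val q S1 S2) ys S1 S2 =
  \sum_(q <- r) pol g (val q) ys S1 S2.
Proof.
elim: ys g S1 S2 => [|y ys IH] g S1 S2 /=; first by rewrite scaler_sumr.
by rewrite !IH big_split.
Qed.

Lemma slot_pol_pol T g F val i j zs kappa S1 S2 :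
  uniq (zs ++ S1 ++ S2) ->
  (forall kappa' S1' S2', perm_eq (S1' ++ S2') (zs ++ S1 ++ S2) ->
     {in S1', forall y, kappa' y = i} -> {in S2', forall y, kappa' y = j} ->
     (forall y, y \notin zs ++ S1 ++ S2 -> kappa' y = kappa y) ->
     span T (F kappa' - val S1' S2')) ->
  {in S1, forall y, kappa y = i} -> {in S2, forall y, kappa y = j} ->
  span T (slot_pol g F i j zs kappa - pol g val zs S1 S2).
Proof.
elim: zs g kappa S1 S2 => [|z zs IH] g kappa S1 S2 Uz H k1 k2 /=.
  by rewrite -scalerBr; apply: spanZ; apply: H.
have p1 : perm_eq (zs ++ (z :: S1) ++ S2) (z :: zs ++ S1 ++ S2).
  by rewrite /= (perm_catCA zs [:: z]).
have p2 : perm_eq (zs ++ S1 ++ z :: S2) (z :: zs ++ S1 ++ S2).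
  by rewrite (catA zs S1 (z :: S2)) (catA zs S1 S2) -[z :: S2]cat1s perm_catCA.
have [zS1 zS2] : z \notin S1 /\ z \notin S2.
  by move: Uz; rewrite /= !mem_cat !negb_or => /andP[/and3P[]].
rewrite opprD addrACA; apply: spanD; apply: IH.
- by rewrite (perm_uniq p1).
- move=> kappa' S1' S2' p e1 e2 eo; apply: H => //; first exact: perm_trans p p1.
  move=> y yz; rewrite eo ?(perm_mem p1) // /update; case: eqP yz => // ->.
  by rewrite mem_head.
- move=> y; rewrite /update inE; case: eqP => //= _; exact: k1.
- by move=> y yS2; rewrite /update; case: eqP yS2 zS2 => [->->//|_ yS2 _]; apply: k2.
- by rewrite (perm_uniq p2).
- move=> kappa' S1' S2' p e1 e2 eo; apply: H => //; first exact: perm_trans p p2.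
  move=> y yz; rewrite eo ?(perm_mem p2) // /update; case: eqP yz => // ->.
  by rewrite mem_head.
- by move=> y yS1; rewrite /update; case: eqP yS1 zS1 => [->->//|_ yS1 _]; apply: k1.
- move=> y; rewrite /update inE; case: eqP => //= _; exact: k2.
Qed.

End SlotPolarization.

(** * The polarised relation between two slots *)

Section SlotRelation.
Variables (Phi : fieldType) (A : linAlgebra Phi) (X : nat -> A).
Hypothesis leibA : leibniz A.
Hypothesis charPhi : [pchar Phi] =i pred0.
Variables (a : nat) (ps : seq magma) (ys : seq nat) (I : seq nat).
Hypothesis ps_prod : all (predC is_letter) ps.
Hypothesis uniq_ys : uniq ys.
Hypothesis permI : perm_eq (a :: all_letters ps ++ ys) I.
Local Notation G := (wordspan X (size ps).+1 I).

Definition slot_word kappa : A := word X a (slots ys kappa ps 0).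

Lemma wact_perm_letters v0 L L' R :
  perm_eq L L' -> all is_letter L ->
  (exists P, [/\ v0 = word X a P, (size ps <= nprod (P ++ R))%N
     & perm_eq (a :: all_letters (P ++ L ++ R)) I]) ->
  G (wact X v0 (L ++ R) - wact X v0 (L' ++ R)).
Proof.
move=> pL lL [P [-> le p]]; rewrite -!word_cat.
by apply: wordspanS (word_perm X leibA p lL pL).
Qed.

(** [W] may have letters between its [r] products. Normal ordering brings them to its front, where
    modulo deeper words they pass the left-hand letters and join [v0]; what remains of [W] is a
    chain of [r] products. *)
Lemma two_sided_pol_span (r : nat) (g : {poly Phi}) M v0 P W C zs :
  (forall b : A, chain_identity b r g M) ->
  v0 = word X a P -> nprod W = r -> (size ps <= nprod (P ++ W ++ C))%N ->
  size zs = M -> perm_eq (a :: all_letters (P ++ W ++ C) ++ zs) I ->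
  G (pol (hat M (nth 0 g)) (two_sided X v0 W C) zs [::] [::]).
Proof.
move=> chg v0E rW le_ps szs pI.
have [Q [QP QE]] := wact_normal_order X leibA W.
pose val q := two_sided X (wact X v0 q.1) q.2 C.
have permQ q S1 S2 : q \in Q -> perm_eq (S1 ++ S2) zs ->
    perm_eq (a :: all_letters ((P ++ q.1) ++ map Letter S1 ++ q.2 ++ map Letter S2 ++ C)) I.
  move=> Qq pS; have [_ _ _ pq] := QP q Qq.
  apply: perm_trans pI; rewrite perm_cons !all_letters_cat !all_letters_Letter -!catA perm_cat2l.
  apply/seq.permP => c; move: (seq.permP pq c) (seq.permP pS c); rewrite all_letters_cat !count_cat.
  by clear; lia.
have nprodQ q : q \in Q -> nprod q.2 = nprod W.
  by move=> Qq; have [_ l2 <- _] := QP q Qq; apply/eqP; rewrite -all_count.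
apply: (@span_congr _ _ _ _ (\sum_(q <- Q) pol (hat M (nth 0 g)) (val q) zs [::] [::])).
  rewrite -pol_sum; apply: pol_congr => S1 S2; rewrite !cats0 => pS.
  pose R := map Letter S2 ++ C.
  have -> : two_sided X v0 W C S1 S2 = \sum_(q <- Q) wact X v0 ((map Letter S1 ++ q.1) ++ q.2 ++ R).
    rewrite /two_sided wact_cat [wact X _ (W ++ _)]wact_cat QE /wact act_sum; apply: eq_bigr => q _.
    by rewrite -/(wact X _ _) -/(wact X _ _) -!wact_cat -!catA.
  rewrite -sumrB; apply: span_sum_in => q Qq; have [l1 _ _ _] := QP q Qq.
  rewrite /val /two_sided -wact_cat [q.1 ++ _]catA.
  apply: wact_perm_letters; first by rewrite perm_catC.
    by rewrite all_cat all_map l1 andbT; apply/allP.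
  exists P; split=> //.
    by apply: leq_trans le_ps _; rewrite !nprod_cat nprodQ //; clear; lia.
  apply: perm_trans (permQ q S1 S2 Qq pS); rewrite perm_cons; apply: perm_all_letters.
  by apply/seq.permP => c; rewrite /R !count_cat -!addnA; congr addn; rewrite addnCA.
apply: span_sum_in => q Qq; have [l1 l2 sz pq] := QP q Qq.
apply: (span_pol charPhi) => // [S1 S2 S1' S2' p1 p2 p|b]; last first.
  pose u k := rmulX (act (rmulX (wact X v0 q.1) b k) (map (mageval X) q.2)) b (M - k).
  transitivity (act (\sum_(k < M.+1) g`_k *: u k) (map (mageval X) C)).
    by rewrite act_sum; apply: eq_bigr => k _; rewrite actZ !act_cat !act_nseq.
  by rewrite (chg b) ?act0 // size_map sz.
apply: (span_trans (v := two_sided X (wact X v0 q.1) q.2 C S1' S2)).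
  apply: wact_perm_letters; [exact: perm_map|by rewrite all_map; apply/allP|].
  exists (P ++ q.1); split; first by rewrite v0E -word_cat.
    by apply: leq_trans le_ps _; rewrite !nprod_cat nprodQ //; clear; lia.
  exact: permQ Qq p.
rewrite /two_sided !(catA (map Letter S1')) !(wact_cat _ _ (map Letter S1' ++ q.2)).
apply: wact_perm_letters; [exact: perm_map|by rewrite all_map; apply/allP|].
exists ((P ++ q.1) ++ map Letter S1' ++ q.2); split.
- by rewrite v0E -word_cat -wact_cat.
- by apply: leq_trans le_ps _; rewrite !nprod_cat nprodQ //; clear; lia.
rewrite -catA -[(map Letter S1' ++ q.2) ++ _]catA; apply: permQ => //.
by apply: perm_trans p; rewrite perm_cat2r perm_sym.
Qed.

Theorem slot_relation (i j : nat) (g : {poly Phi}) M kappa zs :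
  (i < j <= size ps)%N -> (forall b : A, chain_identity b (j - i) g M) ->
  {in ys, forall y, kappa y <= size ps}%N -> uniq zs -> {subset zs <= ys} -> size zs = M ->
  G (slot_pol (hat M (nth 0 g)) slot_word i j zs kappa).
Proof.
move=> /andP[lt_ij le_j] chg le_kappa Uz sz_ys szz.
have le_i : (i <= size ps)%N by apply: leq_trans (ltnW lt_ij) le_j.
(* The word has no slot [(size ps).+1]: [kb] removes the letters of [zs] and keeps the others in
   place. *)
pose kb y := if y \in zs then (size ps).+1 else kappa y.
case Ei: (drop i ps) => [|q ps'].
  by have := size_drop i ps; rewrite Ei /= => /esym/eqP; rewrite subn_eq0 leqNgt (leq_trans lt_ij).
have sps' : size ps' = (size ps - i.+1)%N.
  by have := size_drop i ps; rewrite Ei /= => e; rewrite subnS -e.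
pose n := (j - i.+1)%N; have le_n : (n <= size ps')%N by rewrite sps' leq_sub2r.
have ijn : (i.+1 + n = j)%N by rewrite subnKC.
have split_slots kappa' : (forall l, (l <= size ps)%N -> l != i -> l != j ->
     slot ys kappa' l = slot ys kb l) ->
   slots ys kappa' ps 0 = slots_before ys kb ps 0 i ++ slot ys kappa' i ++
     (q :: slots_before ys kb ps' i.+1 n) ++ slot ys kappa' j ++
     slots_after ys kb (drop n ps') j.
  move=> eq_k; rewrite (slots_split _ _ _ le_i) add0n Ei /= (slots_split _ _ _ le_n) ijn.
  rewrite (@eq_slots_before _ kappa' kb); last first.
    move=> l /andP[_ lt_l]; apply: eq_k; rewrite ?(ltn_eqF lt_l) //.
      exact: leq_trans (ltnW lt_l) le_i.
    by rewrite ltn_eqF // (ltn_trans lt_l).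
  congr (_ ++ _ ++ _ :: _); rewrite (@eq_slots_before _ kappa' kb); last first.
    move=> l /andP[lt_il]; rewrite ijn => lt_lj; apply: eq_k; rewrite ?(ltn_eqF lt_lj) //.
      exact: leq_trans (ltnW lt_lj) le_j.
    by rewrite gtn_eqF.
  congr (_ ++ _ ++ _); rewrite /slots_after; case: (drop _ _) (size_drop n ps') => //= p ps'' sp.
  congr (_ :: _); apply: eq_slots => l /andP[lt_jl le_l]; apply: eq_k.
  - move: le_l sp lt_jl; rewrite sps' /n; clear -le_i le_j lt_ij; lia.
  - by rewrite gtn_eqF // (ltn_trans lt_ij).
  - by rewrite gtn_eqF.
(* The word is cut into [P], the letters of [zs] sent to slot [i], [W], those sent to slot [j], and
   [C]; the products in [W] are [j - i] in number. *)
pose P := slots_before ys kb ps 0 i ++ slot ys kb i.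
pose W := q :: slots_before ys kb ps' i.+1 n.
pose C := slot ys kb j ++ slots_after ys kb (drop n ps') j.
have kbE l : (l <= size ps)%N -> slot ys kb l = map Letter [seq y <- ys | (y \notin zs) && (kappa y == l)].
  move=> le_l; rewrite /slot; congr (map _ _); apply: eq_filter => y; rewrite /kb.
  by case: (y \in zs) => //=; rewrite gtn_eqF.
have val_slots kappa' S1 S2 : perm_eq (S1 ++ S2) zs ->
    {in S1, forall y, kappa' y = i} -> {in S2, forall y, kappa' y = j} ->
    (forall y, y \notin zs -> kappa' y = kappa y) ->
    [/\ forall l, (l <= size ps)%N -> l != i -> l != j -> slot ys kappa' l = slot ys kb l,
     perm_eq (slot ys kappa' i) (slot ys kb i ++ map Letter S1) &
     perm_eq (slot ys kappa' j) (map Letter S2 ++ slot ys kb j)].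
  move=> pS k1 k2 ko; have US : uniq (S1 ++ S2) by rewrite (perm_uniq pS).
  have memS y : (y \in zs) = (y \in S1) || (y \in S2) by rewrite -mem_cat (perm_mem pS).
  have disj y : y \in S1 -> y \in S2 -> False.
    by move: US; rewrite cat_uniq => /and3P[_ /hasPn D _] yS1 /D; rewrite /= yS1.
  have [U1 U2] : uniq S1 /\ uniq S2 by move: US; rewrite cat_uniq => /and3P[].
  split=> [l le_l li lj||].
  - rewrite kbE // /slot; congr (map _ _); apply: eq_in_filter => y _.
    rewrite memS; case: (boolP (y \in S1)) => [/k1->|y1]; first by rewrite eq_sym (negbTE li).
    case: (boolP (y \in S2)) => [/k2->|y2]; first by rewrite eq_sym (negbTE lj).
    by rewrite /= ko // memS negb_or y1.
  - rewrite kbE // /slot -map_cat; apply: perm_map; apply: uniq_perm; first exact: filter_uniq.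
      rewrite cat_uniq filter_uniq // U1 andbT /=; apply/hasPn => y y1.
      by rewrite mem_filter memS y1.
    move=> y; rewrite mem_cat !mem_filter.
    case: (boolP (y \in S1)) => [y1|y1]; first by rewrite k1 // eqxx orbT sz_ys // memS y1.
    rewrite orbF; case: (boolP (y \in S2)) => [y2|y2].
      by rewrite k2 // memS y2 orbT /= gtn_eqF.
    have yz : y \notin zs by rewrite memS negb_or y1.
    by rewrite ko // yz.
  - rewrite kbE // /slot -map_cat; apply: perm_map; apply: uniq_perm; first exact: filter_uniq.
      rewrite cat_uniq filter_uniq // U2 /= andbT; apply/hasPn => y.
      rewrite mem_filter memS negb_or => /andP[/andP[/andP[_ y2] _] _]; exact: y2.
    move=> y; rewrite mem_cat !mem_filter.
    case: (boolP (y \in S2)) => [y2|y2]; first by rewrite k2 // eqxx sz_ys // memS y2 orbT.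
    case: (boolP (y \in S1)) => [y1|y1].
      by rewrite k1 // memS y1 /= ltn_eqF.
    have yz : y \notin zs by rewrite memS negb_or y1.
    by rewrite ko // yz.
have prod_drop : all (predC is_letter) (q :: ps').
  by rewrite -Ei; apply/allP => p /mem_drop; apply/allP.
have rW : nprod W = (j - i)%N.
  have /andP[nq nps'] := prod_drop; rewrite /W nprod_cons nprod_slots_before // [~~ _]nq.
  by rewrite add1n /n subnSK.
have le_P : (size ps <= nprod (P ++ W ++ C))%N.
  have := nprod_slots ys kb 0 ps_prod; rewrite split_slots // => <-.
  rewrite /P /W /C !nprod_cat; clear; lia.
have permS kappa' : {in ys, forall y, kappa' y <= size ps}%N ->
    perm_eq (a :: all_letters (slots ys kappa' ps 0)) I.
  by move=> /perm_slots pk; apply: perm_trans permI; rewrite perm_cons.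
have wordE kappa' S1 S2 : perm_eq (S1 ++ S2) zs ->
    {in S1, forall y, kappa' y = i} -> {in S2, forall y, kappa' y = j} ->
    (forall y, y \notin zs -> kappa' y = kappa y) ->
    G (slot_word kappa' - two_sided X (word X a P) W C S1 S2).
  move=> pS k1 k2 ko; have [eq_k p1 p2] := val_slots _ _ _ pS k1 k2 ko.
  have memS y : (y \in zs) = (y \in S1) || (y \in S2) by rewrite -mem_cat (perm_mem pS).
  have /permS : {in ys, forall y, kappa' y <= size ps}%N.
    move=> y yys; have [|/ko->] := boolP (y \in zs); last exact: le_kappa.
    by rewrite memS => /orP[/k1->|/k2->].
  have := nprod_slots ys kappa' 0 ps_prod.
  rewrite /slot_word (split_slots kappa' eq_k) => rk pk.
  pose pre := slots_before ys kb ps 0 i; pose post := slots_after ys kb (drop n ps') j.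
  rewrite -/pre -/W -/post in rk pk *.
  rewrite /two_sided -word_cat.
  have -> : P ++ map Letter S1 ++ W ++ map Letter S2 ++ C =
      (pre ++ (slot ys kb i ++ map Letter S1) ++ W) ++ (map Letter S2 ++ slot ys kb j) ++ post.
    by rewrite /P /C -!catA.
  have E1 : pre ++ slot ys kappa' i ++ W ++ slot ys kappa' j ++ post =
      (pre ++ slot ys kappa' i ++ W) ++ slot ys kappa' j ++ post by rewrite -!catA.
  have pk2 : perm_eq (a :: all_letters ((pre ++ (slot ys kb i ++ map Letter S1) ++ W) ++
      slot ys kappa' j ++ post)) I.
    apply: perm_trans pk; rewrite perm_cons; apply: perm_all_letters.
    by rewrite E1 perm_cat2r perm_cat2l perm_cat2r perm_sym.
  apply: span_trans (word X a ((pre ++ (slot ys kb i ++ map Letter S1) ++ W) ++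
      slot ys kappa' j ++ post)) _ _ _.
    have := word_perm X leibA pk (letters_slot ys kappa' i) p1.
    rewrite -!catA; apply: wordspanS; rewrite ltnS -[X in (X <= _)%N]rk !nprod_cat.
    by rewrite (nprod_letters (letters_slot ys kappa' i)) add0n.
  have := word_perm X leibA pk2 (letters_slot ys kappa' j) p2.
  apply: wordspanS; rewrite ltnS -[X in (X <= _)%N]rk !nprod_cat.
  rewrite (nprod_letters (letters_slot ys kappa' i)) (nprod_letters (letters_slot ys kappa' j)).
  by clear; lia.
apply: (@span_congr _ _ _ _ (pol (hat M (nth 0 g)) (two_sided X (word X a P) W C) zs [::] [::])).
  by apply: slot_pol_pol; rewrite ?cats0.
apply: (two_sided_pol_span chg erefl rW) => //.
pose ki y := if y \in zs then i else kappa y.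
have ki_le : {in ys, forall y, ki y <= size ps}%N.
  by move=> y /le_kappa; rewrite /ki; case: ifP.
have [||||eq_k p1 p2] := @val_slots ki zs [::].
- by rewrite cats0.
- by move=> y yz; rewrite /ki yz.
- by [].
- by move=> y /negbTE yz; rewrite /ki yz.
apply: perm_trans (permS _ ki_le); rewrite (split_slots _ eq_k) perm_cons perm_sym.
rewrite -[zs in X in perm_eq _ X]all_letters_Letter -all_letters_cat.
apply: perm_all_letters; apply/seq.permP => c.
move: (seq.permP p1 c) (seq.permP p2 c); rewrite /P /C !count_cat /= => -> ->.
by ring.
Qed.

End SlotRelation.

Definition swap (x y z : nat) : nat := if z == x then y else if z == y then x else z.

Definition pair_letters (T : Type) (ps : seq (T * T)) : seq T :=
  flatten [seq [:: p.1; p.2] | p <- ps].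

Lemma subseq_pair_letters (T : eqType) (c : pred (T * T)) (ps : seq (T * T)) :
  subseq (pair_letters (filter c ps)) (pair_letters ps).
Proof.
have cons_letters (p : T * T) qs : pair_letters (p :: qs) = [:: p.1; p.2] ++ pair_letters qs by [].
elim: ps => // p ps IH; rewrite [filter _ _]/= cons_letters; case: ifP => _; rewrite ?cons_letters.
  exact: cat_subseq (subseq_refl _) IH.
exact: subseq_trans IH (suffix_subseq _ _).
Qed.

Lemma pigeonhole (T : Type) (f : T -> nat) K m (s : seq T) :
  all (fun x => f x < K)%N s -> (K * m < size s)%N ->
  exists2 c, (c < K)%N & (m < size (filter (fun x => f x == c) s))%N.
Proof.
elim: K s => [|K IH] s fK lt_s.
  by case: s fK lt_s.
have [le|lt] := leqP (size (filter (fun x => f x == K) s)) m; last by exists K.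
have [||c ltc ltm] := IH (filter (fun x => f x != K) s).
- rewrite all_filter; apply: sub_all fK => x; rewrite ltnS leq_eqVlt /=.
  by case: eqP.
- have := count_predC (fun x => f x == K) s; rewrite -!size_filter.
  move: lt_s le; rewrite mulSn.
  move: (size [seq x <- s | f x == K]) (size (filter (predC _) s)) => p q; lia.
exists c; first exact: ltnW.
rewrite -filter_predI in ltm; apply: leq_trans ltm _.
by rewrite !size_filter; apply: sub_count => x /= /andP[].
Qed.

Lemma size_filter_letters (T : eqType) (sp : seq T) (ps : seq (T * T)) :
  uniq (pair_letters ps) ->
  (size (filter (fun p => (p.1 \in sp) || (p.2 \in sp)) ps) <= size sp)%N.
Proof.
move=> Ups; apply: (@leq_trans (size (filter (mem sp) (pair_letters ps)))).
  elim: ps {Ups} => //= p ps IH.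
  case: (p.1 \in sp) => /=; first by case: (p.2 \in sp); rewrite //= ltnS ?(leq_trans IH).
  by case: (p.2 \in sp).
apply: uniq_leq_size; first exact: filter_uniq.
by move=> x; rewrite mem_filter => /andP[].
Qed.

Lemma updateC (kappa : nat -> nat) x y i j : x != y ->
  update (update kappa x i) y j = update (update kappa y j) x i.
Proof.
move=> xy; apply: funext => z; rewrite /update; case: (eqVneq z y) => // ->.
by rewrite eq_sym (negbTE xy).
Qed.

(** * Alternation *)

Section Alternation.
Variables (Phi : fieldType) (U : lmodType Phi) (T : U -> Prop).
Implicit Types (F : (nat -> nat) -> U) (ps : seq (nat * nat)).

Fixpoint slot_alt F ps (kappa : nat -> nat) : U :=
  if ps is p :: ps' then slot_alt F ps' kappa - slot_alt F ps' (kappa \o swap p.1 p.2)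
  else F kappa.

Fixpoint minors F i j ps (kappa : nat -> nat) : U :=
  if ps is p :: ps' then
    minors F i j ps' (update (update kappa p.1 i) p.2 j) -
    minors F i j ps' (update (update kappa p.1 j) p.2 i)
  else F kappa.

Lemma minorsD F1 F2 i j ps kappa :
  minors (fun k => F1 k + F2 k) i j ps kappa = minors F1 i j ps kappa + minors F2 i j ps kappa.
Proof. by elim: ps kappa => //= p ps IH kappa; rewrite !IH opprD addrACA. Qed.

Lemma minorsZ c F i j ps kappa :
  minors (fun k => c *: F k) i j ps kappa = c *: minors F i j ps kappa.
Proof. by elim: ps kappa => //= p ps IH kappa; rewrite !IH scalerBr. Qed.

Lemma minors_update F i j ps kappa x l : x \notin pair_letters ps ->
  minors (fun k => F (update k x l)) i j ps kappa = minors F i j ps (update kappa x l).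
Proof.
elim: ps kappa => //= p ps IH kappa; rewrite !inE !negb_or => /and3P[x1 x2 xps].
by rewrite !IH // !(updateC _ _ _ x1, updateC _ _ _ x2) //.
Qed.

(* Eliminating one letter of a pair at a time: the minor of (x, y) times the
   derivative of the polarised form is a combination of values of the form. *)
Lemma minors_slot_pol F (g : nat -> Phi) i j M (ok : nat -> bool) (P : (nat -> nat) -> Prop) :
  (forall kappa x l, P kappa -> l = i \/ l = j -> P (update kappa x l)) ->
  (forall zs kappa, uniq zs -> all ok zs -> size zs = M -> P kappa ->
     span T (slot_pol g F i j zs kappa)) ->
  forall ps zs d kappa, uniq (pair_letters ps ++ zs) -> all ok (pair_letters ps ++ zs) ->
    (size ps + size zs = M)%N -> (d <= size ps)%N -> P kappa ->
    span T (minors (slot_pol (fun k => g (d + k)%N) F i j zs) i j ps kappa).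
Proof.
move=> Pup Z; elim=> [|[x y] ps IH] zs d kappa /=.
  by move=> Uz okz sz; rewrite leqn0 => /eqP-> Pk; apply: Z.
move=> /andP[]; rewrite inE negb_or => /andP[xy xn] /andP[yn Un].
move=> /and3P[okx oky okn] sz le_d Pk.
pose A d k := minors (slot_pol (fun k => g (d + k)%N) F i j zs) i j ps k.
have [xps xzs] : x \notin pair_letters ps /\ x \notin zs.
  by apply/andP; rewrite -negb_or -mem_cat.
have [yps yzs] : y \notin pair_letters ps /\ y \notin zs.
  by apply/andP; rewrite -negb_or -mem_cat.
have step z d' k : z \notin pair_letters ps -> z \notin zs -> ok z -> (d' <= size ps)%N -> P k ->
    span T (A d'.+1 (update k z i) + A d' (update k z j)).
  move=> zps zzs okz le_d' Pk'; have := IH (z :: zs) d' k.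
  rewrite (_ : minors _ _ _ _ k = A d'.+1 (update k z i) + A d' (update k z j)); last first.
    rewrite /A -!minors_update // -minorsD; congr (minors _ _ _ _ _).
    apply: funext => k' /=; congr (slot_pol _ _ _ _ _ _ + _).
    by apply: funext => l; rewrite addnS.
  apply=> //.
  - by rewrite -cat1s uniq_catCA /= mem_cat negb_or zps zzs.
  - by move: okn; rewrite !all_cat /= okz.
  - by rewrite /= addnS -addSn.
rewrite -/(A d _) -/(A d _).
(* In the difference of two relations the terms with both letters in the same slot cancel: both in
   [j] if [d] is positive, both in [i] if [d] is at most the number of remaining pairs. *)
have [d0|le_d'] : (0 < d)%N \/ (d <= size ps)%N by case: (d) le_d => [|d'] ?; [right|left].
  case: d d0 le_d => // d _; rewrite ltnS => le_d.
  have := spanB (step x d (update kappa y j) xps xzs okx le_d (Pup _ _ _ Pk (or_intror erefl)))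
    (step y d (update kappa x j) yps yzs oky le_d (Pup _ _ _ Pk (or_intror erefl))).
  rewrite (updateC _ j j xy) opprD addrACA subrr addr0.
  by rewrite (updateC _ i j xy).
have := spanB (step y d (update kappa x i) yps yzs oky le_d' (Pup _ _ _ Pk (or_introl erefl)))
    (step x d (update kappa y i) xps xzs okx le_d' (Pup _ _ _ Pk (or_introl erefl))).
rewrite -(updateC _ i i xy) opprD addrACA subrr add0r.
by rewrite -(updateC _ j i xy).
Qed.

Lemma slot_alt_minors F i j ps kappa : uniq (pair_letters ps) ->
  {in ps, forall p, kappa p.1 = i /\ kappa p.2 = j} ->
  slot_alt F ps kappa = minors F i j ps kappa.
Proof.
elim: ps kappa => //= -[x y] ps IH kappa /= /and3P[]; rewrite inE negb_or => /andP[xy xps] yps Ups k.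
have [kx ky] := k _ (mem_head _ _).
have xin p : p \in ps -> [/\ p.1 != x, p.2 != x, p.1 != y & p.2 != y].
  move=> pps; split; [apply: contraNneq xps|apply: contraNneq xps|apply: contraNneq yps|apply: contraNneq yps] => <-;
  by apply/flatten_mapP; exists p; rewrite // !inE eqxx ?orbT.
congr (_ - _).
  rewrite IH // => [|p pps]; last by apply: k; rewrite inE pps orbT.
  congr (minors _ _ _ _ _); apply: funext => z; rewrite /update.
  by case: eqP => [->//|_]; case: eqP => [->|].
rewrite IH // => [|p pps].
  congr (minors _ _ _ _ _); apply: funext => z; rewrite /update /= /swap.
  have [->|zy] := eqVneq z y; first by rewrite eq_sym (negbTE xy).
  by case: eqP.
have [px1 px2 py1 py2] := xin p pps; have [k1 k2] : kappa p.1 = i /\ kappa p.2 = j.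
  by apply: k; rewrite inE pps orbT.
by rewrite /= /swap !(negbTE px1, negbTE px2, negbTE py1, negbTE py2).
Qed.

End Alternation.

Section Letters.
Implicit Types (ws ps : seq magma).

Fixpoint plain_letters ws : seq nat :=
  if ws is w :: ws' then
    if w is Letter y then y :: plain_letters ws' else plain_letters ws'
  else [::].

Definition products ws : seq magma := filter (predC is_letter) ws.

Lemma perm_plain_letters ws :
  perm_eq (all_letters ws) (all_letters (products ws) ++ plain_letters ws).
Proof.
elim: ws => //= -[y|u w] ws IH; rewrite /= !all_letters_cons.
  by rewrite perm_sym (perm_catCA _ [:: y]) /= perm_cons perm_sym.
by rewrite -catA perm_cat2l.
Qed.

Lemma size_products ws : size (products ws) = nprod ws.
Proof. exact: size_filter. Qed.

Lemma products_prod ws : all (predC is_letter) (products ws).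
Proof. exact: filter_all. Qed.

Lemma eq_slots_letters ys ys' kappa kappa' ps i :
  (forall l, (i <= l)%N -> slot ys kappa l = slot ys' kappa' l) ->
  slots ys kappa ps i = slots ys' kappa' ps i.
Proof.
elim: ps i => [|p ps IH] i e /=; rewrite e // IH // => l le_l.
by rewrite e // ltnW.
Qed.

Lemma size_all_letters_small ws : all is_small ws -> all (predC is_letter) ws ->
  size (all_letters ws) = (size ws).*2.
Proof.
elim: ws => // w ws IH /andP[sm sms] /andP[nl nls].
rewrite all_letters_cons size_cat IH //=.
by case: w sm nl => // -[i|? ?] // [j|? ?].
Qed.

Lemma word_slots ws i : uniq (all_letters ws) ->
  exists kappa, {in plain_letters ws, forall y, (i <= kappa y <= i + nprod ws)%N} /\
    ws = slots (plain_letters ws) kappa (products ws) i.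
Proof.
elim: ws i => [|w ws IH] i; first by exists (fun=> i).
rewrite all_letters_cons cat_uniq => /and3P[_ /hasPn nw /(IH _)].
case: w nw => [y|u w] nw {}IH.
  have [kappa [le_k E]] := IH i; exists (update kappa y i).
  have yws : y \notin plain_letters ws.
    apply/negP => yws; have /nw : y \in all_letters ws.
      by rewrite (perm_mem (perm_plain_letters ws)) mem_cat yws orbT.
    by rewrite /= inE eqxx.
  split=> [z|]; rewrite /update.
    rewrite inE; case: eqP => [_ _|_ /le_k]; first by rewrite leqnn leq_addr.
    by rewrite nprod_cons.
  rewrite /= {1}E; have eqs l : slot (plain_letters ws) kappa l =
     slot (plain_letters ws) (fun z => if z == y then i else kappa z) l.
    by apply: eq_slot => z zws; case: (z =P y) zws => // -> zws; rewrite zws in yws.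
  have eqsl l : l != i -> slot (plain_letters ws) kappa l =
     slot (y :: plain_letters ws) (fun z => if z == y then i else kappa z) l.
    by move=> li; rewrite eqs /slot /= eqxx eq_sym (negbTE li).
  case: (products ws) => [|p ps] /=; first by rewrite eqs /slot /= !eqxx.
  rewrite {1}eqs /slot /= !eqxx /=; congr (_ :: _ ++ _ :: _).
  by apply: eq_slots_letters => l lt_il; rewrite eqsl // gtn_eqF.
have [kappa [le_k E]] := IH i.+1; exists kappa; split=> [z /le_k|].
  by rewrite nprod_cons /= add1n addnS addSn => /andP[/ltnW-> ->].
rewrite /= -E /slot (_ : [seq _ <- _ | _] = [::]) //.
apply/eqP; rewrite -(negbK (_ == _)) -has_filter; apply/hasPn => z /le_k /andP[lt _].
by rewrite gtn_eqF.
Qed.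

End Letters.

Lemma word_slots_perm (Phi : fieldType) (A : linAlgebra Phi) (X : nat -> A) (leibA : leibniz A)
    a I ys ys' kappa kappa' ps i R :
  all (predC is_letter) ps ->
  (forall l, perm_eq (slot ys kappa l) (slot ys' kappa' l)) ->
  perm_eq (a :: all_letters (R ++ slots ys kappa ps i)) I ->
  wordspan X (nprod R + size ps).+1 I
    (word X a (R ++ slots ys kappa ps i) - word X a (R ++ slots ys' kappa' ps i)).
Proof.
move=> + e; elim: ps i R => [|p ps IH] i R.
  move=> _ /= pI; rewrite addn0.
  have := @word_perm _ _ X leibA a R (slot ys kappa i) (slot ys' kappa' i) [::] I.
  by rewrite !cats0 => H; exact: H pI (letters_slot _ _ _) (e i).
case/andP=> /= np nps pI.
have pI' : perm_eq (a :: all_letters ((R ++ rcons (slot ys' kappa' i) p) ++ slots ys kappa ps i.+1)) I.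
  apply: perm_trans pI; rewrite perm_cons; apply: perm_all_letters.
  by rewrite -catA perm_cat2l cat_rcons /= perm_cat2r perm_sym.
apply: (span_trans (v := word X a (R ++ slot ys' kappa' i ++ p :: slots ys kappa ps i.+1))).
  have := word_perm X leibA pI (letters_slot _ _ _) (e i); apply: wordspanS.
  by rewrite nprod_cat nprod_cons np nprod_slots.
have := IH i.+1 (R ++ rcons (slot ys' kappa' i) p) nps pI'.
rewrite -!catA !cat_rcons; apply: wordspanS.
rewrite nprod_cat -cats1 nprod_cat (nprod_letters (letters_slot _ _ _)) nprod_cons np.
by rewrite -addnA.
Qed.

Section RelfreeAction.
Variables (Phi : fieldType) (V : linAlgebra Phi -> Prop) (n : nat).
Local Notation A := (relfree_algebra V).
Local Notation X := (gen V).
Implicit Types (sigma : 'S_n) (w : magma) (ws : seq magma).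

Lemma perm_act_mageval sigma w :
  perm_act sigma (mageval X w : relfree V) = mageval X (relabel (perm_letter sigma) w).
Proof. by rewrite !mageval_gen perm_actE /relabel_poly linextU. Qed.

Lemma word_mageval a ws : word X a ws = mageval X (foldl Prod (Letter a) ws).
Proof.
elim/last_ind: ws => //= ws w IH.
by rewrite /word /wact map_rcons act_rcons foldl_rcons /= -IH.
Qed.

Lemma perm_act_word sigma a ws :
  perm_act sigma (word X a ws : relfree V) =
  word X (perm_letter sigma a) (map (relabel (perm_letter sigma)) ws).
Proof.
have E : relabel (perm_letter sigma) (foldl Prod (Letter a) ws) =
    foldl Prod (Letter (perm_letter sigma a)) (map (relabel (perm_letter sigma)) ws).
  by elim/last_ind: ws => //= ws w IH; rewrite map_rcons !foldl_rcons /= IH.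
by rewrite !word_mageval perm_act_mageval E.
Qed.

Lemma all_letters_relabel (f : nat -> nat) ws :
  all_letters (map (relabel f) ws) = map f (all_letters ws).
Proof.
have lE w : letters (relabel f w) = map f (letters w).
  by elim: w => //= u -> v ->; rewrite map_cat.
by elim: ws => //= w ws IH; rewrite !all_letters_cons map_cat IH lE.
Qed.

Lemma nprod_relabel (f : nat -> nat) ws : nprod (map (relabel f) ws) = nprod ws.
Proof. by elim: ws => // w ws IH; rewrite [map _ _]/= !nprod_cons IH; case: w. Qed.

Lemma perm_iota_perm_letter sigma : perm_eq (map (perm_letter sigma) (iota 0 n)) (iota 0 n).
Proof.
rewrite -val_enum_ord -map_comp.
rewrite (eq_map (g := val \o sigma)) => [|i /=]; last by rewrite /perm_letter valK.
rewrite map_comp; apply: perm_map; apply: uniq_perm; rewrite ?enum_uniq //.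
  by rewrite map_inj_uniq ?enum_uniq //; apply: perm_inj.
move=> i; rewrite mem_enum; apply/mapP; exists (sigma^-1 i)%g; rewrite ?mem_enum //.
by rewrite permKV.
Qed.

Lemma wordspan_perm_act sigma t u :
  wordspan X t (iota 0 n) u -> wordspan X t (iota 0 n) (perm_act sigma (u : relfree V)).
Proof.
elim=> [|_ [a [ws [pI le ->]]]|u1 u2 _ D1 _ D2|c u1 _ D1].
- by rewrite raddf0; apply: span0.
- rewrite perm_act_word; apply: wordspan_word; last by rewrite nprod_relabel.
  rewrite all_letters_relabel -map_cons; apply: perm_trans (perm_iota_perm_letter sigma).
  exact: perm_map.
- by rewrite raddfD; apply: spanD.
- by rewrite linearZ; apply: spanZ.
Qed.

Lemma wordspan_alternate t u (ps : seq ('I_n * 'I_n)) :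
  wordspan X t (iota 0 n) u -> wordspan X t (iota 0 n) (alternate ps (u : relfree V)).
Proof.
by move=> Gu; elim: ps => //= p ps IH; apply: spanB => //; apply: wordspan_perm_act.
Qed.

Lemma perm_letter_tperm (x y : 'I_n) : perm_letter (tperm x y) =1 swap x y.
Proof.
move=> z; rewrite /perm_letter /swap; case: insubP => [i _ <-|].
  have [->|ix] := eqVneq i x; first by rewrite tpermL eqxx.
  rewrite (negbTE (_ : val i != val x)) //.
  have [->|iy] := eqVneq i y; first by rewrite tpermR eqxx.
  by rewrite (negbTE (_ : val i != val y)) // tpermD // eq_sym.
by rewrite -leqNgt => le; rewrite !gtn_eqF // (leq_trans (ltn_ord _)).
Qed.

Lemma alternate_cat (ps1 ps2 : seq ('I_n * 'I_n)) (u : relfree V) :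
  alternate (ps1 ++ ps2) u = alternate ps1 (alternate ps2 u).
Proof. by elim: ps1 => //= p ps1 ->. Qed.

Lemma alternateB (ps : seq ('I_n * 'I_n)) (u v : relfree V) :
  alternate ps (u - v) = alternate ps u - alternate ps v.
Proof. by elim: ps => //= p ps ->; rewrite raddfB /= !opprD !opprK addrACA. Qed.

Lemma alternateD (ps : seq ('I_n * 'I_n)) (u v : relfree V) :
  alternate ps (u + v) = alternate ps u + alternate ps v.
Proof. by elim: ps => //= p ps ->; rewrite raddfD /= opprD addrACA. Qed.

Lemma alternateZ (ps : seq ('I_n * 'I_n)) c (u : relfree V) : alternate ps (c *: u) = c *: alternate ps u.
Proof. by elim: ps => //= p ps ->; rewrite linearZ /= scalerBr. Qed.

Lemma alternate0 (ps : seq ('I_n * 'I_n)) : alternate ps (0 : relfree V) = 0.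
Proof. by elim: ps => //= p ps ->; rewrite raddf0 subrr. Qed.

Lemma perm_actM sigma tau (u : relfree V) :
  perm_act tau (perm_act sigma u) = perm_act (sigma * tau)%g u.
Proof.
suff E w : perm_act tau (perm_act sigma (mageval X w : relfree V)) =
    perm_act (sigma * tau)%g (mageval X w : relfree V).
  rewrite -[u]to_relfreeK to_relfreeE !raddf_sum /=; apply: eq_bigr => w _.
  by rewrite !linearZ /= E.
rewrite !perm_act_mageval.
suff -> : relabel (perm_letter tau) (relabel (perm_letter sigma) w) =
    relabel (perm_letter (sigma * tau)%g) w by [].
elim: w => //= [i|u1 -> u2 ->] //.
congr (Letter _); rewrite /perm_letter; case: (insubP _ i) => [j _ _|nj].
  by rewrite valK permM.
by rewrite insubN.
Qed.

(** Disjoint transpositions commute, so the factor of a pair may be applied first instead of last;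
    this allows the pairs to be reordered. *)
Lemma alternate_comm (p : 'I_n * 'I_n) ps (u : relfree V) :
  uniq (pair_letters (p :: ps)) ->
  alternate ps (u - perm_act (tperm p.1 p.2) u) =
  alternate ps u - perm_act (tperm p.1 p.2) (alternate ps u).
Proof.
elim: ps => //= q ps IH; rewrite !inE !negb_or => /and3P[].
case/and4P=> p12 p1q1 p1q2 p1ps /and3P[p2q1 p2q2 p2ps] /and3P[_ _ Ups].
rewrite IH; last by rewrite /= inE negb_or p12 p1ps p2ps.
set w := alternate ps u.
rewrite !raddfB /= !perm_actM.
have -> : (tperm q.1 q.2 * tperm p.1 p.2 = tperm p.1 p.2 * tperm q.1 q.2)%g.
  by rewrite conjgC tpermJ !tpermD.
by rewrite addrACA.
Qed.

Lemma alternate_filter (c : pred ('I_n * 'I_n)) ps (u : relfree V) :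
  uniq (pair_letters ps) ->
  alternate ps u = alternate (filter (predC c) ps) (alternate (filter c ps) u).
Proof.
elim: ps => // p ps IH Ups.
have Ups' : uniq (pair_letters ps).
  by move: Ups; rewrite /pair_letters /= => /and3P[].
rewrite /=; case: (c p) => /=; last by rewrite IH.
rewrite IH // -alternate_comm //.
apply: subseq_uniq (Ups); rewrite /pair_letters /= !eqxx.
exact: subseq_pair_letters.
Qed.

End RelfreeAction.

Lemma swap_id x y z : z != x -> z != y -> swap x y z = z.
Proof. by rewrite /swap => /negbTE-> /negbTE->. Qed.

Lemma swapK x y : involutive (swap x y).
Proof.
move=> z; rewrite {2}/swap; have [->|zx] := eqVneq z x.
  by rewrite /swap eqxx; case: eqP.
by have [->|zy] := eqVneq z y; [rewrite /swap eqxx | rewrite swap_id].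
Qed.

Lemma relabel_id (f : nat -> nat) w : {in letters w, forall y, f y = y} -> relabel f w = w.
Proof.
elim: w => [i|u IHu v IHv] /= e; first by rewrite e ?mem_head.
by rewrite IHu ?IHv // => y yl; apply: e; rewrite mem_cat yl ?orbT.
Qed.

(** * Vanishing under alternation of many disjoint pairs *)

Section AlternateSlots.
Variables (Phi : fieldType) (V : linAlgebra Phi -> Prop).
Hypothesis charPhi : [pchar Phi] =i pred0.
Local Notation A := (relfree_algebra V).
Local Notation X := (gen V).
Hypothesis leibA : leibniz A.
Variables (g : nat -> {poly Phi}) (M : nat -> nat).
Hypothesis g_neq0 : forall r, g r != 0.
Hypothesis g_size : forall r, (size (g r) <= (M r).+1)%N.
Hypothesis g_chain : forall r (b : A), chain_identity b r.+1 (g r) (M r).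

Lemma hat_neq0 r : exists2 d, (d <= M r)%N & hat (M r) (nth 0 (g r)) d != 0.
Proof.
exists (size (g r)).-1.
  by rewrite -ltnS (leq_trans _ (g_size r)) // prednK // lt0n size_poly_eq0.
rewrite /hat mulf_neq0 //; last by rewrite -lead_coefE lead_coef_eq0.
by rewrite ((pcharf0P Phi).1 charPhi) -lt0n muln_gt0 !fact_gt0.
Qed.

Section Fixed.
Variables (n a : nat) (ps : seq magma) (ys : seq nat).
Hypothesis ps_prod : all (predC is_letter) ps.
Hypothesis permI : perm_eq (a :: all_letters ps ++ ys) (iota 0 n).
Local Notation G := (wordspan X (size ps).+1 (iota 0 n)).
Local Notation W := (slot_word X a ps ys).

Let uniq_all : uniq (a :: all_letters ps ++ ys).
Proof. by rewrite (perm_uniq permI) iota_uniq. Qed.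
Let uniq_ys : uniq ys.
Proof. by move: uniq_all; rewrite /= cat_uniq => /and4P[]. Qed.

Definition bounded (kappa : nat -> nat) := {in ys, forall y, kappa y <= size ps}%N.

(** Neither the leading letter nor the letters of [ps] move, so the transposition yields the word of
    [kappa \o swap x y], except for the order of the letters within slots. *)
Lemma perm_act_slot_word (x y : 'I_n) kappa : val x \in ys -> val y \in ys -> bounded kappa ->
  G (perm_act (tperm x y) (W kappa : relfree V) - W (kappa \o swap x y)).
Proof.
move=> xys yys bk; rewrite perm_act_word; set f := perm_letter _.
have fE : f = swap x y by apply: funext => z; apply: perm_letter_tperm.
have notin z : z \in a :: all_letters ps -> z != x /\ z != y.
  move: uniq_all; rewrite -cat_cons cat_uniq => /and3P[_ /hasPn D _] zs.
  by split; apply: contraTneq zs => ->; apply: D.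
have fid z : z \in a :: all_letters ps -> f z = z.
  by move=> /notin[zx zy]; rewrite fE swap_id.
have -> : map (relabel f) (slots ys kappa ps 0) = slots (map f ys) (kappa \o f) ps 0.
  have slotE i : map (relabel f) (slot ys kappa i) = slot (map f ys) (kappa \o f) i.
    rewrite /slot filter_map -!map_comp; congr (map _ _); apply: eq_filter => z /=.
    by rewrite fE swapK.
  have : {in all_letters ps, forall z, f z = z}.
    by move=> z zs; apply: fid; rewrite inE zs orbT.
  elim: (ps) 0%N => [|p ps' IH] i e /=; first exact: slotE.
  rewrite map_cat slotE /= IH ?relabel_id // => z zs; apply: e.
    by rewrite all_letters_cons mem_cat zs.
  by rewrite all_letters_cons mem_cat zs orbT.
rewrite fid ?mem_head // -fE.
have pf : perm_eq (map f ys) ys.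
  apply: uniq_perm => //; first by rewrite map_inj_uniq // fE; apply: inv_inj; apply: swapK.
  move=> z; apply/mapP/idP => [[z' z's ->]|zs]; last first.
    exists (f z); last by rewrite fE swapK.
    by rewrite fE /swap; case: eqP => // _; case: eqP.
  by rewrite fE /swap; case: eqP => // _; case: eqP.
have bkf : {in ys, forall z, (kappa \o f) z <= size ps}%N.
  by move=> z zs; apply: bk; rewrite -(perm_mem pf) map_f.
apply: (@word_slots_perm _ _ X leibA a _ _ _ _ _ ps 0 [::]) => //.
  by move=> l; apply: perm_map; apply: perm_filter.
rewrite /=; apply: perm_trans permI; rewrite perm_cons.
apply: perm_trans (perm_slots _) _; first by move=> z; rewrite (perm_mem pf); apply: bkf.
by rewrite perm_cat2l.
Qed.

Lemma alternate_slot_word (qs : seq ('I_n * 'I_n)) kappa :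
  uniq (pair_letters qs) -> {subset map val (pair_letters qs) <= ys} -> bounded kappa ->
  G (alternate qs (W kappa : relfree V) -
     slot_alt W [seq (val q.1, val q.2) | q <- qs] kappa).
Proof.
elim: qs kappa => [|q qs IH] kappa; first by rewrite subrr => *; apply: span0.
move=> Uqs sub bk /=.
have q1 : val q.1 \in ys by apply: sub; rewrite mem_head.
have q2 : val q.2 \in ys by apply: sub; rewrite !inE eqxx orbT.
have sub' : {subset map val (pair_letters qs) <= ys}.
  by move=> z zs; apply: sub; rewrite /= !inE zs !orbT.
have Uqs' : uniq (pair_letters qs) by move: Uqs => /= /and3P[].
have bks : bounded (kappa \o swap q.1 q.2).
  by move=> z zs; apply: bk; rewrite /swap; case: eqP => // _; case: eqP.
rewrite -alternate_comm // alternateB opprD addrACA; apply: spanD; first exact: IH.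
rewrite opprK addrC; apply: span_sym; apply: span_trans (IH _ Uqs' sub' bks).
have := perm_act_slot_word q1 q2 bk.
by move/(wordspan_alternate qs); rewrite alternateB.
Qed.

(** For [i < j], alternating [M] of the pairs gives the minors of the slot word; by
    [minors_slot_pol] they are deeper after multiplication by a nonzero coefficient. For [i = j] one
    pair suffices, since exchanging two letters of one slot changes nothing at this level. The
    remaining pairs preserve the filtration. *)
Lemma alternate_class i j (qs : seq ('I_n * 'I_n)) kappa :
  (i <= j <= size ps)%N -> uniq (pair_letters qs) ->
  {subset map val (pair_letters qs) <= ys} -> bounded kappa ->
  {in qs, forall q, kappa (val q.1) = i /\ kappa (val q.2) = j} ->
  (M (j - i).-1 < size qs)%N ->
  G (alternate qs (W kappa : relfree V)).
Proof.
move=> /andP[le_ij le_j] Uqs sub bk kq lt_M.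
pose m := if i == j then 1%N else M (j - i).-1.
have le_m : (m <= size qs)%N.
  by rewrite /m; case: ifP => _; [apply: leq_ltn_trans lt_M | apply: ltnW].
rewrite -(cat_take_drop (size qs - m) qs) alternate_cat; apply: wordspan_alternate.
set rs := drop _ qs; have szr : size rs = m by rewrite size_drop subKn.
have letters_cat (s1 s2 : seq ('I_n * 'I_n)) :
    pair_letters (s1 ++ s2) = pair_letters s1 ++ pair_letters s2.
  by rewrite /pair_letters map_cat flatten_cat.
have Urs : uniq (pair_letters rs).
  by move: Uqs; rewrite -(cat_take_drop (size qs - m) qs) letters_cat cat_uniq => /and3P[].
have subr : {subset map val (pair_letters rs) <= ys}.
  move=> z zs; apply: sub.
  by rewrite -(cat_take_drop (size qs - m) qs) letters_cat map_cat mem_cat zs orbT.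
have kr : {in rs, forall q, kappa (val q.1) = i /\ kappa (val q.2) = j}.
  by move=> q /mem_drop; apply: kq.
apply: span_congr (alternate_slot_word Urs subr bk) _.
case: (eqVneq i j) => [eq_ij|ne_ij].
  case: (rs) szr kr => [|[x y] [|? ?]]; rewrite /m eq_ij eqxx // => _ kr /=.
  have [kx ky] := kr _ (mem_head _ _).
  rewrite (_ : kappa \o swap x y = kappa) ?subrr; first exact: span0.
  apply: funext => z /=; rewrite /swap; case: eqP => [->|_]; first by rewrite ky kx.
  by case: eqP => // ->; rewrite ky kx.
have lt_ij : (i < j)%N by rewrite ltn_neqAle ne_ij.
set rs' := map _ rs; have rs'E : pair_letters rs' = map val (pair_letters rs).
  by rewrite /rs'; elim: (rs) => //= q r; rewrite /pair_letters /= => ->.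
have Urs' : uniq (pair_letters rs') by rewrite rs'E map_inj_uniq //; apply: val_inj.
rewrite (@slot_alt_minors _ _ W i j rs') //; last first.
  by move=> _ /mapP[q qr ->]; apply: kr.
have [d le_d hd] := hat_neq0 (j - i).-1.
have Pup k' x l : bounded k' -> l = i \/ l = j -> bounded (update k' x l).
  move=> bk' lij z zs; rewrite /update; case: eqP => _; last exact: bk'.
  by case: lij => ->; rewrite ?le_j // (leq_trans le_ij).
have Z zs k' : uniq zs -> all (mem ys) zs -> size zs = M (j - i).-1 -> bounded k' ->
    G (slot_pol (hat (M (j - i).-1) (nth 0 (g (j - i).-1))) W i j zs k').
  move=> Uz /allP zys szz bk'.
  apply: (slot_relation (gen V) leibA charPhi ps_prod uniq_ys permI) => //; rewrite ?lt_ij //.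
  by rewrite -[(j - i)%N]prednK ?subn_gt0 //; apply: g_chain.
have := minors_slot_pol Pup Z (ps := rs') (zs := [::]) (d := d) (kappa := kappa).
rewrite cats0 addn0 => H.
have : G (minors (fun k' => hat (M (j - i).-1) (nth 0 (g (j - i).-1)) d *: W k') i j rs' kappa).
  have := H Urs'; rewrite /= addn0; apply=> //.
  - by apply/allP => z; rewrite rs'E => /subr.
  - by rewrite size_map szr /m (negbTE ne_ij).
  - by rewrite size_map szr /m (negbTE ne_ij).
rewrite minorsZ => /(spanZ (hat (M (j - i).-1) (nth 0 (g (j - i).-1)) d)^-1).
by rewrite scalerA mulVf // scale1r.
Qed.

Lemma alternate_plain (qs : seq ('I_n * 'I_n)) kappa :
  uniq (pair_letters qs) -> {subset map val (pair_letters qs) <= ys} -> bounded kappa ->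
  ((size ps).+1 * (size ps).+1 * (\sum_(r < (size ps).+1) M r) < size qs)%N ->
  G (alternate qs (W kappa : relfree V)).
Proof.
move=> Uqs sub bk lt_sz.
(* Alternation ignores the order within a pair, so each pair may be directed from the lower slot to
   the higher one. *)
pose orient (q : 'I_n * 'I_n) := if (kappa (val q.1) <= kappa (val q.2))%N then q else (q.2, q.1).
have -> : alternate qs (W kappa : relfree V) = alternate (map orient qs) (W kappa : relfree V).
  elim: (qs) => //= q rs ->; rewrite /orient; case: ifP => //= _.
  by rewrite tpermC.
have perm_orient : perm_eq (pair_letters (map orient qs)) (pair_letters qs).
  elim: (qs) => //= q rs IH; rewrite /pair_letters /= -!/(pair_letters _) /orient.
  case: ifP => _ /=; first by rewrite !perm_cons.
  by rewrite (perm_catCA [:: q.2] [:: q.1]) /= !perm_cons.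
set os := map orient qs in perm_orient *.
have Uos : uniq (pair_letters os) by rewrite (perm_uniq perm_orient).
have subo : {subset map val (pair_letters os) <= ys}.
  by move=> z; rewrite (perm_mem (perm_map val perm_orient)); apply: sub.
(* The pair of slots, written as a number in base [(size ps).+1] for the pigeonhole principle. *)
pose col (q : 'I_n * 'I_n) := (kappa (val q.1) * (size ps).+1 + kappa (val q.2))%N.
have mem_os q : q \in os -> (kappa (val q.1) <= kappa (val q.2) <= size ps)%N.
  case/mapP=> q' q'in ->; have in_ys x : x \in [:: q'.1; q'.2] -> val x \in ys.
    by move=> xq; apply/sub/map_f/flatten_mapP; exists q'.
  have [y1 y2] : val q'.1 \in ys /\ val q'.2 \in ys.
    by split; apply: in_ys; rewrite !inE eqxx ?orbT.
  rewrite /orient; case: ifP => [le|/negbT nle] /=; first by rewrite le; apply: bk.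
  by rewrite -ltnNge in nle; rewrite (ltnW nle); apply: bk.
have lt_K : all (fun q => col q < (size ps).+1 * (size ps).+1)%N os.
  apply/allP => q /mem_os /andP[le1 le2]; rewrite /col.
  have : (kappa (val q.1) <= size ps)%N by apply: leq_trans le2.
  rewrite -ltnS => lt1; apply: (@leq_trans ((kappa (val q.1)).+1 * (size ps).+1)).
    by rewrite mulSn addnC ltn_add2r ltnS.
  by rewrite leq_mul2r lt1 orbT.
have szo : size os = size qs by rewrite size_map.
have [c ltc] := pigeonhole lt_K (leq_trans lt_sz (eq_leq (esym szo))).
set cls := filter _ os => ltm.
rewrite (alternate_filter (fun q => col q == c)) //; apply: wordspan_alternate.
rewrite -/cls.
have Ucls : uniq (pair_letters cls).
  by apply: subseq_uniq Uos; apply: subseq_pair_letters.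
have clsP q : q \in cls -> kappa (val q.1) = (c %/ (size ps).+1)%N /\
     kappa (val q.2) = (c %% (size ps).+1)%N.
  rewrite mem_filter => /andP[/eqP <- /mem_os/andP[_ le]]; rewrite /col.
  by rewrite divnMDl // divn_small ?ltnS // addn0 modnMDl modn_small.
have [q qcls] : exists q, q \in cls.
  by case: (cls) ltm => // q *; exists q; rewrite mem_head.
have [k1 k2] := clsP q qcls.
have le_ij : (c %/ (size ps).+1 <= c %% (size ps).+1 <= size ps)%N.
  by rewrite -k1 -k2; apply: mem_os; move: qcls; rewrite mem_filter => /andP[].
apply: (alternate_class le_ij) => //.
  move=> z zc; apply: subo; case/mapP: zc => x xc ->; apply: map_f.
  exact: mem_subseq (subseq_pair_letters _ _) _ xc.
apply: leq_ltn_trans ltm.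
have lt_r : ((c %% (size ps).+1 - c %/ (size ps).+1).-1 < (size ps).+1)%N.
  case/andP: le_ij => _ le; rewrite ltnS (leq_trans (leq_pred _)) //.
  exact: leq_trans (leq_subr _ _) le.
by rewrite (bigD1 (Ordinal lt_r)) //= leq_addr.
Qed.

End Fixed.

(** The leading letter and [t] products of two letters make up [t.*2.+1] letters, each spoiling at
    most one of the disjoint pairs. The other summand is the number of unspoiled pairs that
    [alternate_plain] asks for. *)
Definition special_bound t := (t.*2.+1 + (t.+1 * t.+1 * (\sum_(r < t.+1) M r)).+1)%N.

Lemma wordspan_alternate_step n t (qs : seq ('I_n * 'I_n)) u :
  uniq (pair_letters qs) -> (special_bound t <= size qs)%N ->
  wordspan X t (iota 0 n) u -> wordspan X t.+1 (iota 0 n) (alternate qs (u : relfree V)).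
Proof.
move=> Uqs le_sz /(wordspan_small leibA).
elim=> [|_ [a [ws [pI le_t sm ->]]]|u1 u2 _ D1 _ D2|c u1 _ D1].
- by rewrite alternate0; apply: span0.
- have [lt_t|] := ltnP t (nprod ws).
    by apply: wordspan_alternate; apply: wordspan_word.
  move=> le_t'; have et : nprod ws = t by apply/eqP; rewrite eqn_leq le_t le_t'.
  have Uws : uniq (all_letters ws).
    by have := iota_uniq 0 n; rewrite -(perm_uniq pI) => /andP[].
  have [kappa [bk wsE]] := word_slots 0 Uws.
  set ps := products ws in wsE; set ys := plain_letters ws in bk wsE.
  have szps : size ps = t by rewrite size_products.
  have permI : perm_eq (a :: all_letters ps ++ ys) (iota 0 n).
    by apply: perm_trans pI; rewrite perm_cons perm_sym perm_plain_letters.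
  rewrite wsE (alternate_filter (fun q : 'I_n * 'I_n =>
    ~~ ((val q.1 \in a :: all_letters ps) || (val q.2 \in a :: all_letters ps)))) //.
  apply: wordspan_alternate.
  rewrite -szps; apply: (@alternate_plain n a ps ys).
  + exact: products_prod.
  + exact: permI.
  + by apply: subseq_uniq Uqs; apply: subseq_pair_letters.
  + move=> _ /mapP[x xin ->].
    have := perm_mem permI (val x); rewrite -cat_cons mem_cat mem_iota ltn_ord /=.
    case/flatten_mapP: xin => q; rewrite mem_filter negb_or; move: (a :: _) => sp.
    by case/andP=> /andP[/negbTE q1 /negbTE q2] _; rewrite !inE => /orP[/eqP->|/eqP->]; rewrite ?q1 ?q2.
  + by move=> y /bk; rewrite szps et.
  + rewrite szps.
    pose qs' := [seq (val q.1, val q.2) | q <- qs].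
    have Uqs' : uniq (pair_letters qs').
      rewrite (_ : pair_letters qs' = map val (pair_letters qs)) ?map_inj_uniq //.
        exact: val_inj.
      by rewrite /qs'; elim: (qs) => //= q r; rewrite /pair_letters /= => ->.
    have := size_filter_letters (a :: all_letters ps) Uqs'.
    rewrite filter_map size_map /= size_all_letters_small ?products_prod //; last first.
      by rewrite /ps; apply/allP => w; rewrite mem_filter => /andP[_]; apply/allP.
    move: le_sz; rewrite /special_bound szps.
    have := count_predC (fun q : 'I_n * 'I_n => (val q.1 \in a :: all_letters ps) ||
       (val q.2 \in a :: all_letters ps)) qs.
    rewrite -!size_filter /predC /preim /= => <-.
    set c1 := size _; set c2 := size _; set K := (_ * _)%N.
    by move=> le1 le2; rewrite -(ltn_add2l t.*2.+1) -addnS (leq_trans le1) // leq_add2r.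
- by rewrite alternateD; apply: spanD.
- by rewrite alternateZ; apply: spanZ.
Qed.

(** Each block of [special_bound] pairs raises the level by one, until level [s.+1], which is zero;
    [Q] adds up the blocks. *)
Theorem alternate_eq0 s : satisfies_NsA s A ->
  exists Q, forall n (qs : seq ('I_n * 'I_n)) u, uniq (pair_letters qs) ->
    (Q <= size qs)%N -> wordspan X 0 (iota 0 n) u -> alternate qs (u : relfree V) = 0.
Proof.
move=> nilA; suff QP d : (d <= s.+1)%N -> exists Q, forall n (qs : seq ('I_n * 'I_n)) u,
    uniq (pair_letters qs) -> (Q <= size qs)%N ->
    wordspan X (s.+1 - d) (iota 0 n) u -> alternate qs (u : relfree V) = 0.
  by have [Q] := QP _ (leqnn _); rewrite subnn; exists Q.
elim: d => [|d IH] le_d.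
  exists 0%N => n qs u _ _; rewrite subn0 => /(wordspan_nilpotent leibA nilA (leqnn _)) ->.
  exact: alternate0.
have [Q QP] := IH (ltnW le_d); exists (Q + special_bound (s.+1 - d.+1))%N => n qs u Uqs le_sz Gu.
set b := special_bound _ in le_sz.
rewrite -(cat_take_drop Q qs) alternate_cat.
have Ucat : uniq (pair_letters (take Q qs) ++ pair_letters (drop Q qs)).
  by rewrite -flatten_cat -map_cat cat_take_drop.
move: Ucat; rewrite cat_uniq => /and3P[U1 _ U2].
apply: QP => //; first by rewrite size_takel // (leq_trans _ le_sz) // leq_addr.
have := wordspan_alternate_step U2 (t := s.+1 - d.+1) _ Gu.
rewrite subnSK //; apply; rewrite size_drop leq_subRL //.
by rewrite (leq_trans _ le_sz) // leq_addr.
Qed.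

End AlternateSlots.

(** Once it is known which factors are letters, a list of small factors is determined by its
    sequence of letters. *)
Lemma small_relabel (f : nat -> nat) ws ws' :
  all is_small ws -> all is_small ws' -> map is_letter ws = map is_letter ws' ->
  all_letters ws' = map f (all_letters ws) -> ws' = map (relabel f) ws.
Proof.
elim: ws ws' => [|w ws IH] [|w' ws'] // /andP[sw sws] /andP[sw' sws'] [ew /(IH _ sws sws'){}IH].
rewrite !all_letters_cons /=.
case: w sw ew => [b|[b|//] [c|//]] _; case: w' sw' => [b'|[b'|//] [c'|//]] //= _ _.
  by case=> -> /IH->.
by case=> -> -> /IH->.
Qed.

Lemma same_shape (f : nat -> nat) ys ys' kappa kappa' ps ps' i :
  (forall l, map f [seq y <- ys | kappa y == l] = map f [seq y <- ys' | kappa' y == l]) ->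
  all is_small ps -> all is_small ps' ->
  all (predC is_letter) ps -> all (predC is_letter) ps' -> size ps = size ps' ->
  map f (all_letters ps) = map f (all_letters ps') ->
  map is_letter (slots ys kappa ps i) = map is_letter (slots ys' kappa' ps' i) /\
  map f (all_letters (slots ys kappa ps i)) = map f (all_letters (slots ys' kappa' ps' i)).
Proof.
move=> e; have slot_eq l : map is_letter (slot ys kappa l) = map is_letter (slot ys' kappa' l).
  have E (r : seq nat) : map is_letter (map Letter r) = nseq (size r) true by elim: r => //= x r ->.
  by rewrite /slot !E; have := congr1 size (e l); rewrite !size_map => ->.
elim: ps ps' i => [|p ps IH] [|p' ps'] i //=.
  by move=> *; rewrite !all_letters_Letter.
case/andP=> sp sps /andP[sp' sps'] /andP[np nps] /andP[np' nps'] [esz].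
case: p sp np => [//|[b|//] [c|//]] _ _; case: p' sp' np' => [//|[b'|//] [c'|//]] _ _.
rewrite !all_letters_cons /= => -[eb ec er].
have [e1 e2] := IH ps' i.+1 sps sps' nps nps' esz er.
rewrite !map_cat !all_letters_cat !all_letters_Letter /= e1 slot_eq; split=> //.
by rewrite !map_cat /= e eb ec e2.
Qed.

(** * Counting symmetrized words *)

Section Symmetrization.
Variables (Phi : fieldType) (V : linAlgebra Phi -> Prop) (n N : nat).
Local Notation A := (relfree_algebra V).
Local Notation X := (gen V).

Definition symmetrize (u : relfree V) : relfree V := \sum_(h in head_group n N) perm_act h u.

Lemma symmetrize_is_linear : linear symmetrize.
Proof.
move=> c u v; rewrite /symmetrize scaler_sumr -big_split; apply: eq_bigr => h _ /=.
by rewrite linearP.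
Qed.
HB.instance Definition _ :=
  GRing.isLinear.Build Phi (relfree V) (relfree V) _ symmetrize symmetrize_is_linear.

Lemma symmetrize_perm_act (g : 'S_n) u : g \in head_group n N ->
  symmetrize (perm_act g u) = symmetrize u.
Proof.
move=> Hg; rewrite /symmetrize [RHS](reindex_inj (mulgI g)) /=.
by apply: eq_big => h; [rewrite groupMl | rewrite perm_actM].
Qed.

(* The fibres below n are the orbits of [head_group n N]. *)
Definition collapse (y : nat) : nat := if (y < n - N)%N then 0%N else (y - (n - N)).+1.

Lemma collapse_le y : (y < n)%N -> (collapse y <= N)%N.
Proof. by move=> lty; rewrite /collapse; case: (ltnP y (n - N)) => //; move: lty; clear; lia. Qed.

(** Sending the letters of one word to those of the other, position by position, is a permutation
    that preserves [collapse]. It lies in the head group and is absorbed by the sum. *)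
Lemma symmetrize_same_word a a' ws ws' :
  perm_eq (a :: all_letters ws) (iota 0 n) -> perm_eq (a' :: all_letters ws') (iota 0 n) ->
  all is_small ws -> all is_small ws' -> map is_letter ws = map is_letter ws' ->
  map collapse (a :: all_letters ws) = map collapse (a' :: all_letters ws') ->
  symmetrize (word X a ws) = symmetrize (word X a' ws').
Proof.
set L := a :: _; set L' := a' :: _ => pL pL' sm sm' sh eL.
have szL : size L = size L' by have := congr1 size eL; rewrite !size_map.
have UL : uniq L by rewrite (perm_uniq pL) iota_uniq.
have UL' : uniq L' by rewrite (perm_uniq pL') iota_uniq.
have memL y : (y \in L) = (y < n)%N by rewrite (perm_mem pL) mem_iota.
have memL' y : (y \in L') = (y < n)%N by rewrite (perm_mem pL') mem_iota.
pose h y := nth 0%N L' (index y L).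
have h_lt y : (y < n)%N -> (h y < n)%N.
  by move=> lty; rewrite -memL' mem_nth // -szL index_mem memL.
pose s (i : 'I_n) : 'I_n := Ordinal (h_lt _ (ltn_ord i)).
have s_inj : injective s.
  move=> i j /(congr1 val) /= /eqP; rewrite /h nth_uniq // -?szL ?index_mem ?memL //.
  move/eqP/(congr1 (nth 0%N L)); rewrite !nth_index ?memL // => e; exact: val_inj.
pose g : 'S_n := perm s_inj.
have gE y : (y < n)%N -> perm_letter g y = h y.
  by move=> lty; rewrite /perm_letter insubT /= permE.
have hL : L' = map h L.
  apply: (@eq_from_nth _ 0%N) => [|k ltk]; first by rewrite size_map szL.
  by rewrite (nth_map 0%N) ?szL // /h index_uniq ?szL.
have colh y : (y < n)%N -> collapse (h y) = collapse y.
  move=> lty; have ly : (index y L < size L)%N by rewrite index_mem memL.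
  rewrite /h -(nth_map _ 0%N) -?szL // -eL (nth_map 0%N) // nth_index ?memL //.
have Hg : g \in head_group n N.
  apply/fun_stabP => i; rewrite permE /=; have := colh i (ltn_ord i).
  by rewrite /collapse; do 2 case: ltnP => ? //; lia.
have -> : word X a' ws' = perm_act g (word X a ws : relfree V).
  rewrite perm_act_word.
  have -> : map (relabel (perm_letter g)) ws = ws'.
    apply/esym/small_relabel => //; move: hL; rewrite /L /L' /= => -[_ ->].
    by apply/eq_in_map => y yws; rewrite gE // -memL inE yws orbT.
  by rewrite gE -?memL ?mem_head //; move: hL => -[->].
by rewrite symmetrize_perm_act.
Qed.

End Symmetrization.

Section Counting.
Variables (Phi : fieldType) (V : linAlgebra Phi -> Prop).
Hypothesis charPhi : [pchar Phi] =i pred0.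
Local Notation A := (relfree_algebra V).
Local Notation X := (gen V).
Hypothesis leibA : leibniz A.
Variable N : nat.

Section FixedDegree.
Variables (n t : nat).
Local Notation G := (wordspan X t.+1 (iota 0 n)).
Local Notation sym := (@symmetrize Phi V n N).
Local Notation col := (collapse n N).
Local Notation W := (slot_word X).

Definition slot_data a ps ys kappa :=
  [/\ all (predC is_letter) ps, all is_small ps, size ps = t,
      perm_eq (a :: all_letters ps ++ ys) (iota 0 n)
    & {in ys, forall y, kappa y <= t}%N].

Definition slot_count ys kappa (l c : nat) : nat :=
  count (fun y => (kappa y == l) && (col y == c)) ys.

Lemma all_small_slots ys kappa ps i : all is_small ps -> all is_small (slots ys kappa ps i).
Proof.
have sl l : all is_small (slot ys kappa l) by rewrite /slot all_map; apply/allP.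
by elim: ps i => //= p ps IH i /andP[sp sps]; rewrite all_cat sl /= sp IH.
Qed.

Lemma slot_data_perm a ps ys kappa : slot_data a ps ys kappa ->
  perm_eq (a :: all_letters (slots ys kappa ps 0)) (iota 0 n).
Proof.
case=> _ _ sz p b; apply: perm_trans p; rewrite perm_cons; apply: perm_slots.
by rewrite sz.
Qed.

Lemma symmetrize_same_slots a ps ys kappa a' ps' ys' kappa' :
  slot_data a ps ys kappa -> slot_data a' ps' ys' kappa' ->
  map col (a :: all_letters ps) = map col (a' :: all_letters ps') ->
  (forall l c, (l <= t)%N -> slot_count ys kappa l c = slot_count ys' kappa' l c) ->
  exists2 x, G x & sym (W a ps ys kappa) = sym (W a' ps' ys' kappa') + sym x.
Proof.
move=> D D' esp ecnt.
(* Sorting by class makes the slots of the two words agree letter by letter up to the head group, as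
   soon as the counts agree. The cost of sorting is deeper and goes into [x]. *)
pose le x y := (col x <= col y)%N; pose srt := sort le.
have le_total : total le by move=> x y; apply: leq_total.
have le_trans : transitive le by move=> x y z; apply: leq_trans.
have resort a0 ps0 ys0 k0 : slot_data a0 ps0 ys0 k0 ->
    G (W a0 ps0 ys0 k0 - W a0 ps0 (srt ys0) k0) /\ slot_data a0 ps0 (srt ys0) k0.
  move=> D0; have [np _ sz p b] := D0.
  have psrt : perm_eq ys0 (srt ys0) by rewrite perm_sym; apply/permEl/perm_sort.
  split.
    rewrite -sz; apply: (@word_slots_perm _ _ X leibA a0 _ _ _ _ _ ps0 0 [::]) => //.
      by move=> l; apply: perm_map; apply: perm_filter.
    exact: slot_data_perm D0.
  case: D0 => ? ? ? _ _; split=> //.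
    by apply: perm_trans p; rewrite perm_cons perm_cat2l perm_sym.
  by move=> y; rewrite -(perm_mem psrt); apply: b.
have [G1 D1] := resort _ _ _ _ D; have [G2 D2] := resort _ _ _ _ D'.
exists ((W a ps ys kappa - W a ps (srt ys) kappa) - (W a' ps' ys' kappa' - W a' ps' (srt ys') kappa')).
  exact: spanB.
suff E : sym (W a ps (srt ys) kappa) = sym (W a' ps' (srt ys') kappa').
  have aux (u v w : relfree V) : u = v + (u - w + (- v - - w)).
    by rewrite opprK addrACA addNr addr0 addrCA subrr addr0.
  by rewrite !raddfB /= E; apply: aux.
have eslot l : map col [seq y <- srt ys | kappa y == l] =
    map col [seq y <- srt ys' | kappa' y == l].
  have sorted_slot r k : sorted leq (map col [seq y <- srt r | k y == l :> nat]).
    by rewrite sorted_map; apply: sorted_filter => //; apply: sort_sorted.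
  apply: (sorted_eq leq_trans anti_leq) => //.
  rewrite /perm_eq; apply/allP => c _ /=; rewrite !count_map !count_filter.
  have cE r k : count (predI (preim col (pred1 c)) (fun y => k y == l :> nat)) (srt r) =
      slot_count r k l c.
    rewrite (seq.permP (permEl (perm_sort le r))) /slot_count.
    by apply: eq_count => y /=; rewrite andbC.
  rewrite !cE; have [le_lt|lt_tl] := leqP l t; first by rewrite ecnt.
  have c0 r k : {in r, forall y, k y <= t}%N -> slot_count r k l c = 0%N.
    move=> rb; apply/eqP; rewrite -leqn0 leqNgt -has_count; apply/hasPn => y /rb le_k.
    by rewrite ltn_eqF // (leq_ltn_trans le_k).
  by case: D D' => _ _ _ _ b [_ _ _ _ b']; rewrite !c0.
have [nps sps szs p b] := D1; have [nps' sps' szs' p' b'] := D2.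
have [sh el] := same_shape 0 eslot sps sps' nps nps' (etrans szs (esym szs')) (congr1 behead esp).
apply: symmetrize_same_word => //.
- exact: slot_data_perm D1.
- exact: slot_data_perm D2.
- exact: all_small_slots.
- exact: all_small_slots.
- by rewrite /= el; case: esp => ->.
Qed.

Variables (g : nat -> {poly Phi}) (M : nat -> nat).
Hypothesis g_neq0 : forall r, g r != 0.
Hypothesis g_size : forall r, (size (g r) <= (M r).+1)%N.
Hypothesis g_chain : forall r (b : A), chain_identity b r.+1 (g r) (M r).

Definition slot_bound := (\sum_(r < t.+1) M r).+1.

Variable S : relfree V -> Prop.
Hypothesis G_S : forall x, G x -> span S (sym x).

(* If two slots both contain many of the identified letters, the leading term
   of the polarised relation moves one of these letters to the right. *)
Lemma symmetrize_reduce a ps ys kappa i j :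
  slot_data a ps ys kappa -> (i < j <= t)%N ->
  (slot_bound <= slot_count ys kappa i 0)%N -> (slot_bound <= slot_count ys kappa j 0)%N ->
  (forall kappa', slot_data a ps ys kappa' ->
     (\sum_(y <- ys) kappa y < \sum_(y <- ys) kappa' y)%N -> span S (sym (W a ps ys kappa'))) ->
  span S (sym (W a ps ys kappa)).
Proof.
move=> D /andP[lt_ij le_jt] ci cj IH; have [nps sps szps permI bk] := D.
have uniq_ys : uniq ys.
  have := iota_uniq 0 n; rewrite -(perm_uniq permI) /= => /andP[_].
  by rewrite cat_uniq => /and3P[].
pose r := (j - i).-1; have rE : r.+1 = (j - i)%N by rewrite prednK // subn_gt0.
(* [p0] is the degree of [g r]: only the terms with at most [p0] of the chosen letters in slot [i]
   survive. *)
pose h := hat (M r) (nth 0 (g r)); pose p0 := (size (g r)).-1.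
have sg : size (g r) = p0.+1 by rewrite prednK // lt0n size_poly_eq0.
have le_p0 : (p0 <= M r)%N by rewrite -ltnS -sg.
have h_p0 : h p0 != 0.
  rewrite /h /hat mulf_neq0 //; last by rewrite -lead_coefE lead_coef_eq0.
  by rewrite ((pcharf0P Phi).1 charPhi) -lt0n muln_gt0 !fact_gt0.
have h_big k : (p0 < k)%N -> h k = 0.
  by move=> lt; rewrite /h /hat nth_default ?mulr0 // sg.
have le_M : (M r <= slot_bound)%N.
  have lt_r : (r < t.+1)%N by rewrite ltnS (leq_trans _ le_jt) // -ltnS rE leqW // leq_subr.
  by rewrite /slot_bound (bigD1 (Ordinal lt_r)) //= leqW // leq_addr.
(* The letters are chosen so that the given word is itself a term with [p0] of them in slot [i]. *)
pose zi := take p0 [seq y <- ys | (kappa y == i) && (col y == 0%N)].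
pose zj := take (M r - p0) [seq y <- ys | (kappa y == j) && (col y == 0%N)].
pose zs := zi ++ zj.
have szi : size zi = p0.
  by rewrite size_takel // size_filter (leq_trans le_p0) // (leq_trans le_M).
have szj : size zj = (M r - p0)%N.
  by rewrite size_takel // size_filter (leq_trans (leq_subr _ _)) // (leq_trans le_M).
have zsz : size zs = M r by rewrite size_cat szi szj subnKC.
have ziP y : y \in zi -> [/\ y \in ys, kappa y = i & col y = 0%N].
  by move/mem_take; rewrite mem_filter => /andP[/andP[/eqP-> /eqP->] ->].
have zjP y : y \in zj -> [/\ y \in ys, kappa y = j & col y = 0%N].
  by move/mem_take; rewrite mem_filter => /andP[/andP[/eqP-> /eqP->] ->].
have Uzs : uniq zs.
  rewrite cat_uniq !take_uniq ?filter_uniq // andbT /=; apply/hasPn => y /zjP[_ kj _].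
  by apply/negP => /ziP[_ ki _]; rewrite -ki kj ltnn in lt_ij.
have zs_col y : y \in zs -> col y = 0%N.
  by rewrite mem_cat => /orP[/ziP[]|/zjP[]].
have zs_ys : {subset zs <= ys} by move=> y; rewrite mem_cat => /orP[/ziP[]|/zjP[]].
have zs_k y : y \in zs -> kappa y = i \/ kappa y = j.
  by rewrite mem_cat => /orP[/ziP[]|/zjP[]]; [left|right].
have count_zs : count (fun y => kappa y == i) zs = p0.
  rewrite count_cat -[RHS]addn0 -[in RHS]szi; congr (_ + _)%N.
    by apply/eqP; rewrite -all_count; apply/allP => y /ziP[_ -> _] /=.
  apply/eqP; rewrite -leqn0 leqNgt -has_count; apply/hasPn => y /zjP[_ -> _].
  by rewrite gtn_eqF.
pose rest := [seq y <- ys | y \notin zs].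
have perm_ys : perm_eq ys (zs ++ rest).
  apply: uniq_perm => //.
    rewrite cat_uniq Uzs filter_uniq // andbT /=; apply/hasPn => y.
    by rewrite mem_filter => /andP[].
  move=> y; rewrite mem_cat mem_filter; case: (boolP (y \in zs)) => // yzs.
  exact: zs_ys.
(* With [q] letters already in slot [i] and [m] still to be placed, the binomial counts the ways to
   end with [p0] letters there. These terms all symmetrize to that of the given word, up to [S];
   more letters in [i] give coefficient zero, and fewer give a larger sum of slot numbers, where
   [IH] applies. *)
pose c q m : Phi := (if (q <= p0)%N then 'C(m, p0 - q) else 0%N)%:R * h p0.
have claim zs' : forall B kappa', B ++ zs' = zs ->
    {in B, forall y, kappa' y = i \/ kappa' y = j} ->
    (forall y, y \notin B -> kappa' y = kappa y) ->
    span S (sym (slot_pol (fun k => h (count (fun y => kappa' y == i) B + k)%N)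
        (W a ps ys) i j zs' kappa')
      - c (count (fun y => kappa' y == i) B) (size zs') *: sym (W a ps ys kappa)).
  elim: zs' => [|z zs' IHz] B kappa' eB kB ko; last first.
    have Bz : z \notin B.
      by move: Uzs; rewrite -eB cat_uniq => /and3P[_ /hasPn /(_ z (mem_head _ _))].
    have countB l : count (fun y => update kappa' z l y == i) B = count (fun y => kappa' y == i) B.
      apply: eq_in_count => y yB; rewrite /update; case: (y =P z) yB Bz => // -> -> //.
    have upd l : l = i \/ l = j -> {in rcons B z, forall y, update kappa' z l y = i \/ update kappa' z l y = j}.
      move=> lij y; rewrite mem_rcons inE /update; case: (y =P z) => //= _; exact: kB.
    have upo l y : y \notin rcons B z -> update kappa' z l y = kappa y.
      by rewrite mem_rcons inE negb_or /update => /andP[/negbTE-> /ko].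
    have e' : rcons B z ++ zs' = zs by rewrite cat_rcons.
    set q := count _ B in countB *.
    have count_rcons l : count (fun y => update kappa' z l y == i) (rcons B z) = (q + (l == i))%N.
      by rewrite -cats1 count_cat countB /= /update eqxx addn0.
    have := IHz _ _ e' (upd i (or_introl erefl)) (upo i).
    have := IHz _ _ e' (upd j (or_intror erefl)) (upo j).
    rewrite !count_rcons eqxx gtn_eqF // addn0 addn1 => Hj Hi.
    rewrite [size _]/= (_ : c q (size zs').+1 = c q.+1 (size zs') + c q (size zs')); last first.
      rewrite /c -mulrDl -natrD; congr (_%:R * _).
      case: (ltngtP q p0) => [lt|lt|->] //.
        by rewrite -(subnSK lt) binS addnC.
      by rewrite subnn !bin0.
    rewrite scalerDl opprD /= linearD addrACA; apply: spanD => //.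
    by move: Hi; rewrite (_ : (fun k => h (q.+1 + k)%N) = (fun k => h (q + k.+1)%N)) //;
      apply: funext => k; rewrite addSnnS.
  rewrite cats0 in eB; rewrite eB in kB ko *; set q := count _ zs.
  have kys y : y \in rest -> kappa' y = kappa y.
    by rewrite mem_filter => /andP[yz _]; apply: ko.
  have D' : slot_data a ps ys kappa'.
    split=> // y yys; have [yz|yz] := boolP (y \in zs); last by rewrite ko // bk.
    by case: (kB y yz) => ->; rewrite ?le_jt // (leq_trans (ltnW lt_ij)).
  have countj k : {in zs, forall y, k y = i \/ k y = j} ->
      count (fun y => k y == j) zs = (M r - count (fun y => k y == i) zs)%N.
    move=> kz; rewrite -zsz -(count_predC (fun y => k y == i) zs) addKn.
    apply: eq_in_count => y yz; rewrite /predC /=; case: (kz y yz) => ->.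
      by rewrite eqxx ltn_eqF.
    by rewrite eqxx gtn_eqF.
  have le_q : (q <= M r)%N by rewrite -zsz count_size.
  rewrite /= addn0 linearZ /= /c bin0n.
  case: (ltngtP q p0) => [lt_q|lt_q|eq_q].
  - rewrite subn_eq0 leqNgt lt_q mul0r scale0r subr0; apply: spanZ; apply: IH => //.
    have sum_zs k : {in zs, forall y, k y = i \/ k y = j} ->
        (\sum_(y <- zs) k y = count (fun y => k y == i) zs * i + count (fun y => k y == j) zs * j)%N.
      elim: (zs) => [|z r' IHr] kz; first by rewrite big_nil.
      rewrite big_cons IHr => [|y yr]; last by apply: kz; rewrite inE yr orbT.
      case: (kz z (mem_head _ _)) => e; rewrite /= e eqxx ?(ltn_eqF lt_ij) ?(gtn_eqF lt_ij).
        by rewrite add0n add1n mulSn addnA.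
      by rewrite add0n add1n mulSn addnCA.
    have sum_ys (k : nat -> nat) : (\sum_(y <- ys) k y = \sum_(y <- zs) k y + \sum_(y <- rest) k y)%N.
      by rewrite (perm_big _ perm_ys) big_cat.
    rewrite !sum_ys (eq_big_seq _ kys) ltn_add2r.
    rewrite (sum_zs _ zs_k) (sum_zs _ kB) !countj // count_zs -/q.
    have := leq_trans lt_q (leqnn p0); rewrite -subn_gt0 => pq.
    have lt_ij' : ((p0 - q) * i < (p0 - q) * j)%N by rewrite ltn_mul2l pq.
    have -> : (M r - q = (M r - p0) + (p0 - q))%N by rewrite addnBA ?(ltnW lt_q) // subnK.
    rewrite -[X in (X * i + _ < _)%N](subnK (ltnW lt_q)) !mulnDl.
    move: lt_ij'; move: ((p0 - q) * i)%N ((p0 - q) * j)%N (q * i)%N ((M r - p0) * j)%N.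
    by clear; lia.
  - by rewrite h_big // mul0r !scale0r subr0; apply: span0.
  rewrite eq_q subnn mul1r -scalerBr; apply: spanZ.
  have [||x Gx ->] := symmetrize_same_slots D' D.
  - by [].
  - move=> l c' _; rewrite /slot_count !(seq.permP perm_ys) !(count_cat _ zs rest); congr (_ + _)%N; last first.
      by apply: eq_in_count => y yr; rewrite kys.
    have [->|c'0] := eqVneq c' 0%N; last first.
      rewrite !(eq_in_count (a2 := pred0)) ?count_pred0 // => y yz;
        by rewrite zs_col // [0%N == _]eq_sym (negbTE c'0) andbF.
    have E k : count (fun y => (k y == l) && (col y == 0%N)) zs = count (fun y => k y == l) zs.
      by apply: eq_in_count => y yz; rewrite zs_col // eqxx andbT.
    rewrite !E; have [->|li] := eqVneq l i; first by rewrite -/q eq_q.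
    have [->|lj] := eqVneq l j; first by rewrite !countj // -/q eq_q count_zs.
    rewrite !(eq_in_count (a2 := pred0)) ?count_pred0 // => y yz.
      by case: (zs_k y yz) => ->; rewrite eq_sym ?(negbTE li) ?(negbTE lj).
    by case: (kB y yz) => ->; rewrite eq_sym ?(negbTE li) ?(negbTE lj).
  by rewrite addrC addKr; apply: G_S.
have slotpol : G (slot_pol h (W a ps ys) i j zs kappa).
  rewrite -szps; apply: (slot_relation (gen V) leibA charPhi nps uniq_ys permI) => //.
  - by rewrite lt_ij szps.
  - by rewrite -rE; apply: g_chain.
  - by rewrite szps.
have /(_ _ _)/span_sym := claim zs [::] kappa erefl; rewrite /= => H.
have {}H := span_congr (H _ _) (G_S slotpol).
have : span S (c 0%N (size zs) *: sym (W a ps ys kappa)) by apply: H.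
rewrite /c leq0n subn0 => /(spanZ ('C(size zs, p0)%:R * h p0)^-1).
rewrite scalerA mulVf ?scale1r // mulf_neq0 //.
by rewrite ((pcharf0P Phi).1 charPhi) -lt0n bin_gt0 zsz.
Qed.

End FixedDegree.
End Counting.

(** * Finitely many codes for symmetrized words *)

Section Codes.
Variables (n N t : nat).
Local Notation col := (collapse n N).
Local Notation slot_count := (slot_count N n).
Local Notation slot_data := (slot_data n t).

Lemma slot_data_lt a ps ys kappa y : slot_data a ps ys kappa ->
  y \in a :: all_letters ps ++ ys -> (y < n)%N.
Proof. by case=> _ _ _ /perm_mem p _; rewrite p mem_iota. Qed.

Lemma slot_data_uniq a ps ys kappa : slot_data a ps ys kappa -> uniq ys.
Proof.
case=> _ _ _ p _; have := iota_uniq 0 n; rewrite -(perm_uniq p) /= => /andP[_].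
by rewrite cat_uniq => /and3P[].
Qed.

Lemma size_special a ps ys kappa : slot_data a ps ys kappa ->
  size (a :: all_letters ps) = t.*2.+1.
Proof. by case=> np sm sz _ _; rewrite /= size_all_letters_small // sz. Qed.

Lemma sum_slot_count a ps ys kappa c : slot_data a ps ys kappa ->
  (\sum_(l < t.+1) slot_count ys kappa l c = count (fun y => col y == c) ys)%N.
Proof.
case=> _ _ _ _ b; rewrite /slot_count.
elim: ys b => [|y ys IH] b /=; first by rewrite big1.
rewrite big_split IH /= => [|z zs]; last by apply: b; rewrite inE zs orbT.
congr (_ + _)%N; have lt_k : (kappa y < t.+1)%N by rewrite ltnS b ?mem_head.
rewrite (bigD1 (Ordinal lt_k)) //= eqxx big1 ?addn0 // => l /eqP ne.
by case: eqP => // e; case: ne; apply: val_inj; rewrite /= e.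
Qed.

(** A class [c > 0] contains the single letter [c.-1 + (n - N)]. *)
Lemma slot_count_le1 a ps ys kappa l c : slot_data a ps ys kappa ->
  (0 < c)%N -> (slot_count ys kappa l c <= 1)%N.
Proof.
move=> D c0; apply: (@leq_trans (count_mem (c.-1 + (n - N))%N ys)).
  apply: sub_count => y /= /andP[_]; rewrite /collapse.
  by case: ltnP => le /eqP e; move: c0; rewrite -e //= subnK.
by rewrite count_uniq_mem ?leq_b1 // (slot_data_uniq D).
Qed.

Variable B : nat.
Hypothesis B_gt0 : (0 < B)%N.

(** The normal form reached by iterating [symmetrize_reduce], with [B] the bound [slot_bound]. *)
Definition reduced ys kappa := forall i j, (i < j <= t)%N ->
  ~~ ((B <= slot_count ys kappa i 0) && (B <= slot_count ys kappa j 0))%N.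

(* All but one of the counts of a reduced word are known from their truncations,
   and the remaining one follows from the total number of letters. *)
Lemma slot_count_inj a ps ys kappa a' ps' ys' kappa' :
  slot_data a ps ys kappa -> slot_data a' ps' ys' kappa' ->
  reduced ys kappa -> reduced ys' kappa' ->
  map col (a :: all_letters ps) = map col (a' :: all_letters ps') ->
  (forall l c, (l <= t)%N -> (c <= N)%N ->
     minn (slot_count ys kappa l c) B = minn (slot_count ys' kappa' l c) B) ->
  forall l c, (l <= t)%N -> slot_count ys kappa l c = slot_count ys' kappa' l c.
Proof.
move=> D D' red red' esp emin.
have big c a0 ps0 ys0 k0 l : slot_data a0 ps0 ys0 k0 -> (N < c)%N -> slot_count ys0 k0 l c = 0%N.
  move=> D0 lt; apply/eqP; rewrite -leqn0 leqNgt -has_count; apply/hasPn => y ysy.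
  rewrite negb_and orbC neq_ltn (leq_ltn_trans _ lt) //; apply: collapse_le.
  by apply: (slot_data_lt D0); rewrite inE mem_cat ysy !orbT.
have small l c : (l <= t)%N -> (slot_count ys kappa l c < B)%N ->
    slot_count ys kappa l c = slot_count ys' kappa' l c.
  move=> le_l lt; have [le_c|lt_c] := leqP c N; last by rewrite (big _ _ _ _ _ _ D) // (big _ _ _ _ _ _ D').
  have := emin l c le_l le_c; move: lt.
  move: (slot_count _ _ _ _) (slot_count _ _ _ _) => p q; clear; lia.
move=> l c le_l; have [lt|ge] := ltnP (slot_count ys kappa l c) B; first exact: small.
have [c0|c_gt0] := posnP c; last first.
  have := slot_count_le1 l D c_gt0; have := slot_count_le1 l D' c_gt0.
  have [le_c|lt_c] := leqP c N; last by rewrite (big _ _ _ _ _ _ D) // (big _ _ _ _ _ _ D').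
  have := emin l c le_l le_c; move: B_gt0.
  move: (slot_count _ _ _ _) (slot_count _ _ _ _) => p q; clear; lia.
move: ge; rewrite {}c0 => ge.
(* Both words use every letter once, and the letters outside their slots have the same classes;
   hence the slots hold equally many letters of class 0. *)
have total : count (fun y => col y == 0%N) ys = count (fun y => col y == 0%N) ys'.
  have cE r : count (fun y => col y == 0%N) r = count_mem 0%N (map col r) by rewrite count_map.
  have [_ _ _ p _] := D; have [_ _ _ p' _] := D'.
  have := perm_trans p (etrans (perm_sym _ _) p') => /(perm_map col) /seq.permP /(_ (pred1 0%N)).
  rewrite -!cat_cons !map_cat !count_cat esp -!cE => /addnI; exact.
move: total; rewrite -(sum_slot_count _ D) -(sum_slot_count _ D').
have lt_l : (l < t.+1)%N by [].
rewrite (bigD1 (Ordinal lt_l)) //= [RHS](bigD1 (Ordinal lt_l)) //=.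
set s1 := (\sum_(i < _ | _) _)%N; set s2 := (\sum_(i < _ | _) _)%N.
suff -> : s1 = s2 by move/addIn.
apply: eq_bigr => i ne_i; apply: small; first by rewrite -ltnS.
have ne : (val i != l) by apply: contraNneq ne_i => e; apply/eqP/val_inj.
rewrite ltnNge; apply/negP => gei; case: (ltngtP i l) ne => // lt _.
  by have := red i l; rewrite lt le_l ge gei => /(_ isT).
by have := red l i; rewrite lt -ltnS ltn_ord ge gei => /(_ isT).
Qed.

(** Its cardinality does not involve [n], which makes the final bound uniform. *)
Definition code : finType :=
  ({ffun 'I_t.*2.+1 -> 'I_N.+1} * {ffun 'I_t.+1 * 'I_N.+1 -> 'I_B.+1})%type.

Definition slot_code a ps ys kappa : code :=
  ([ffun i : 'I_t.*2.+1 => inord (nth 0%N (map col (a :: all_letters ps)) i)],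
   [ffun q : 'I_t.+1 * 'I_N.+1 => inord (minn (slot_count ys kappa q.1 q.2) B)]).

Lemma slot_code_inj a ps ys kappa a' ps' ys' kappa' :
  slot_data a ps ys kappa -> slot_data a' ps' ys' kappa' ->
  reduced ys kappa -> reduced ys' kappa' ->
  slot_code a ps ys kappa = slot_code a' ps' ys' kappa' ->
  map col (a :: all_letters ps) = map col (a' :: all_letters ps') /\
  forall l c, (l <= t)%N -> slot_count ys kappa l c = slot_count ys' kappa' l c.
Proof.
move=> D D' red red' [/ffunP e1 /ffunP e2].
have sz a0 ps0 ys0 k0 : slot_data a0 ps0 ys0 k0 -> size (map col (a0 :: all_letters ps0)) = t.*2.+1.
  by move=> D0; rewrite size_map (size_special D0).
have bnd a0 ps0 ys0 k0 i : slot_data a0 ps0 ys0 k0 -> (nth 0%N (map col (a0 :: all_letters ps0)) i < N.+1)%N.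
  move=> D0; have [lt|ge] := ltnP i (size (map col (a0 :: all_letters ps0))); last by rewrite nth_default.
  have /mapP[y ysy ->] := mem_nth 0%N lt; rewrite ltnS; apply: collapse_le.
  by apply: (slot_data_lt D0); rewrite -cat_cons mem_cat ysy.
have esp : map col (a :: all_letters ps) = map col (a' :: all_letters ps').
  apply: (@eq_from_nth _ 0%N) => [|i]; first by rewrite (sz _ _ _ _ D) (sz _ _ _ _ D').
  rewrite (sz _ _ _ _ D) => lt_i; have := congr1 val (e1 (Ordinal lt_i)).
  by rewrite !ffunE /= !inordK //; [apply: (bnd _ _ _ _ i D')|apply: (bnd _ _ _ _ i D)].
split=> //; apply: (slot_count_inj D D') => // l c le_l le_c.
have /(congr1 val) := e2 (inord l, inord c).
by rewrite !ffunE /= !inordK // ltnS geq_minr.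
Qed.

End Codes.

Section CountingTheorem.
Variables (Phi : fieldType) (V : linAlgebra Phi -> Prop).
Hypothesis charPhi : [pchar Phi] =i pred0.
Local Notation A := (relfree_algebra V).
Local Notation X := (gen V).
Hypothesis leibA : leibniz A.
Variable N : nat.
Variables (g : nat -> {poly Phi}) (M : nat -> nat).
Hypothesis g_neq0 : forall r, g r != 0.
Hypothesis g_size : forall r, (size (g r) <= (M r).+1)%N.
Hypothesis g_chain : forall r (b : A), chain_identity b r.+1 (g r) (M r).

Definition symmetrize_spanned n t (vs : seq (relfree V)) :=
  (forall v, v \in vs -> wordspan X 0 (iota 0 n) v) /\
  forall u, wordspan X t (iota 0 n) u -> span (fun v : relfree V => v \in vs) (symmetrize n N (u : relfree V)).

Lemma symmetrize_wordspan n t u : wordspan X t (iota 0 n) u ->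
  wordspan X t (iota 0 n) (symmetrize n N (u : relfree V)).
Proof.
move=> Wu; rewrite /symmetrize; elim/big_ind: _ => [|u1 u2|h _]; [exact: span0|exact: spanD|].
exact: wordspan_perm_act.
Qed.

Lemma symmetrize_spanned_step n t vs : symmetrize_spanned n t.+1 vs ->
  exists2 vs', (size vs' <= size vs + #|{: code N t (slot_bound t M)}|)%N &
    symmetrize_spanned n t vs'.
Proof.
move=> [vsW vsS]; pose B := slot_bound t M.
(* One representative is chosen for each code that occurs; the symmetrized representatives are the
   new spanning elements. *)
pose rep_of (c : code N t B) (u : relfree V) := exists a ps ys kappa,
  [/\ slot_data n t a ps ys kappa, reduced n N t B ys kappa, slot_code n N t B a ps ys kappa = c
    & u = slot_word X a ps ys kappa].
have rep_ex (c : code N t B) : exists u : relfree V, (exists u', rep_of c u') -> rep_of c u.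
  by case: (pselect (exists u, rep_of c u)) => [[u ru]|no]; [exists u | exists 0].
have [rep repP] := choice rep_ex.
have repW c : wordspan X t (iota 0 n) (rep c : relfree V) \/ ~ (exists u, rep_of c u).
  case: (pselect (exists u, rep_of c u)) => [/repP[a [ps [ys [kappa [D _ _ ->]]]]]|]; last by right.
  left; apply: wordspan_word (slot_data_perm D) _; have [np _ sz _ _] := D.
  by rewrite nprod_slots // sz.
pose vr := [seq symmetrize n N (rep c) | c <- enum {: code N t B} & `[< exists u, rep_of c u >]].
exists (vs ++ vr).
  rewrite size_cat leq_add2l size_map size_filter (leq_trans (count_size _ _)) //.
  by rewrite -cardE.
split=> [v|u Wu].
  rewrite mem_cat => /orP[/vsW //|/mapP[c]]; rewrite mem_filter => /andP[/asboolP ex _ ->].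
  by case: (repW c) => // /(wordspanS (leq0n _)) /symmetrize_wordspan.
have spanS u' : span (fun v : relfree V => v \in vs) u' -> span (fun v : relfree V => v \in vs ++ vr) u'.
  by apply: span_sub => v vvs; apply: span_gen; rewrite mem_cat vvs.
elim: (wordspan_small leibA Wu) => [|_ [a [ws [pI le_t sm ->]]]|u1 u2 _ D1 _ D2|c u1 _ D1].
- by rewrite linear0; apply: span0.
- have [lt_t|] := ltnP t (nprod ws).
    by apply/spanS/vsS/wordspan_word.
  move=> le_t'; have et : nprod ws = t by apply/eqP; rewrite eqn_leq le_t le_t'.
  have Uws : uniq (all_letters ws).
    by have := iota_uniq 0 n; rewrite -(perm_uniq pI) => /andP[].
  have [kappa [bk wsE]] := word_slots 0 Uws.
  set ps := products ws in wsE; set ys := plain_letters ws in bk wsE.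
  have szps : size ps = t by rewrite size_products.
  have D : slot_data n t a ps ys kappa.
    split=> //.
    + exact: products_prod.
    + by rewrite /ps; apply/allP => w; rewrite mem_filter => /andP[_]; apply/allP.
    + by apply: perm_trans pI; rewrite perm_cons perm_sym perm_plain_letters.
    + by move=> y /bk; rewrite et.
  rewrite wsE -/(slot_word X a ps ys kappa); move: ps ys kappa D {wsE bk szps} => ps ys kappa.
  (* Every reduction increases the sum of the slot numbers, which is at most [t * size ys]. *)
  have [m] := ubnP (t * size ys - \sum_(y <- ys) kappa y)%N.
  elim: m kappa => // m IH kappa; rewrite ltnS => le_m D.
  have [red|] := pselect (reduced n N t B ys kappa).
    pose c := slot_code n N t B a ps ys kappa.
    have ex : exists u, rep_of c u by exists (slot_word X a ps ys kappa), a, ps, ys, kappa.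
    have [a' [ps' [ys' [kappa' [D' red' ec erep]]]]] := repP c ex.
    have [esp ecnt] := slot_code_inj (isT : (0 < B)%N) D D' red red' (esym ec).
    have [x Gx ->] := symmetrize_same_slots leibA D D' esp ecnt.
    apply: spanD; last exact/spanS/vsS.
    apply: span_gen; rewrite /= mem_cat -erep; apply/orP; right; apply: map_f.
    by rewrite mem_filter mem_enum andbT; apply/asboolP.
  move/existsNP => [i /existsNP [j /not_implyP [ij /negP]]]; rewrite negbK => /andP[ci cj].
  apply: (symmetrize_reduce charPhi leibA g_neq0 g_size g_chain _ D ij ci cj).
    by move=> x Gx; apply/spanS/vsS.
  move=> kappa' D' lt; apply: IH => //; apply: leq_trans le_m.
  apply: ltn_sub2l => //; apply: (leq_trans lt).
  have [_ _ _ _ b'] := D'; rewrite mulnC -[size ys]sum1_size big_distrl /= big_seq [in leqRHS]big_seq.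
  by apply: leq_sum => y /b'; rewrite mul1n.
- by rewrite linearD; apply: spanD.
- by rewrite linearZ; apply: spanZ.
Qed.

Lemma symmetrize_finite s : satisfies_NsA s A ->
  exists C, forall n, exists2 vs, (size vs <= C)%N & symmetrize_spanned n 0 vs.
Proof.
move=> nilA; suff QP d : (d <= s.+1)%N -> exists C, forall n,
    exists2 vs, (size vs <= C)%N & symmetrize_spanned n (s.+1 - d) vs.
  by have [C] := QP _ (leqnn _); rewrite subnn; exists C.
elim: d => [|d IH] le_d.
  exists 0%N => n; exists [::] => //; split=> // u.
  rewrite subn0 => /(wordspan_nilpotent leibA nilA (leqnn _)) ->.
  by rewrite linear0; apply: span0.
have [C CP] := IH (ltnW le_d).
exists (C + #|{: code N (s.+1 - d.+1) (slot_bound (s.+1 - d.+1) M)}|)%N => n.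
have [vs le_vs] := CP n; rewrite -subnSK // => /symmetrize_spanned_step [vs' le_vs' ?].
by exists vs' => //; apply: leq_trans le_vs' _; rewrite leq_add2r.
Qed.

End CountingTheorem.

(** * Multilinear elements as words, and the conclusion *)

Lemma span_seq (Phi : fieldType) (U : lmodType Phi) (vs : seq U) u :
  span (fun v => v \in vs) u -> exists c : nat -> Phi, u = \sum_(i < size vs) c i *: vs`_i.
Proof.
elim=> [|v v_vs|u1 u2 _ [c1 ->] _ [c2 ->]|c u1 _ [c1 ->]].
- by exists (fun=> 0); rewrite big1 // => i _; rewrite scale0r.
- have lt_v : (index v vs < size vs)%N by rewrite index_mem.
  exists (fun i => (i == index v vs)%:R); rewrite (bigD1 (Ordinal lt_v)) //= eqxx scale1r.
  rewrite nth_index // big1 ?addr0 // => i ne; rewrite (_ : (i == _ :> nat) = false) ?scale0r //.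
  by apply: contraNF ne => /eqP e; apply/eqP/val_inj.
- by exists (fun i => c1 i + c2 i); rewrite -big_split; apply: eq_bigr => i _; rewrite scalerDl.
- by exists (fun i => c * c1 i); rewrite scaler_sumr; apply: eq_bigr => i _; rewrite scalerA.
Qed.

Lemma wordspan_eq_perm (Phi : fieldType) (A : linAlgebra Phi) (X : nat -> A) t I I' u :
  perm_eq I I' -> wordspan X t I u -> wordspan X t I' u.
Proof.
move=> p; apply: span_sub => _ [a [ws [pI le ->]]].
by apply: wordspan_word le; apply: perm_trans pI p.
Qed.

Lemma multilinear_wordspan (Phi : fieldType) (V : linAlgebra Phi -> Prop) n (u : relfree V) :
  multilinear n u <-> wordspan (gen V) 0 (iota 0 n) u.
Proof.
split=> [[f fM ->]|].
  rewrite to_relfreeE; apply: span_sum_in => w /fM pw; apply: spanZ.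
  exact: wordspan_eq_perm pw (ev_wordspan _ _).
elim=> [|_ [a [ws [pI _ ->]]]|u1 u2 _ [f fM ->] _ [h hM ->]|c u1 _ [f fM ->]].
- by exists 0; [move=> t; rewrite msupp0 in_fset0 | rewrite linear0].
- pose w := foldl Prod (Letter a) ws.
  have lw b : letters (foldl Prod b ws) = letters b ++ all_letters ws.
    elim: (ws) b => [|v r IH] b /=; first by rewrite cats0.
    by rewrite IH all_letters_cons /= catA.
  have ew b : wact (gen V) (mageval (gen V) b) ws = mageval (gen V) (foldl Prod b ws).
    by elim: (ws) b => [|v r IH] b //; rewrite wact_cons -IH.
  exists << w >>; last by rewrite /word (ew (Letter a)) mageval_gen.
  move=> t /(fsubsetP msuppU_le); rewrite in_fset1 => /eqP->.
  by rewrite lw.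
- exists (f + h); last by rewrite linearD.
  by move=> t /(fsubsetP (msuppD_le _ _)); rewrite in_fsetU => /orP[/fM|/hM].
- exists (c *: f); last by rewrite linearZ.
  by move=> t /(fsubsetP (msuppZ_le _ _))/fM.
Qed.

Theorem theorem1 (Phi : fieldType) (charPhi : [pchar Phi] =i pred0) (s : nat)
    (V : linAlgebra Phi -> Prop) (varV : variety V)
    (subV : forall A : linAlgebra Phi, V A -> leibniz_NsA s A)
    (k m : nat) (le_km : (k <= m)%N) (alpha : nat -> Phi)
    (idV : forall A : linAlgebra Phi, V A -> forall x y z : A,
       rmulX (rmulX x y k ** z) y (m - k) =
       \sum_(1 <= i < k.+1)
         alpha i *: rmulX (rmulX x y (k - i) ** z) y (m - k + i)) :
  exists C : nat, forall n l : nat, is_colength V n l -> (l <= C)%N.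
Proof.
(* All identities of [V] are applied in this one algebra, where the multilinear parts live. *)
have VA := relfree_in_variety varV; have [leibA nilA] := subV _ VA.
have /choice[g /choice[M gP]] := chain_identities leibA le_km (idV _ VA).
have g_neq0 r : g r != 0 by case: (gP r).
have g_size r : (size (g r) <= (M r).+1)%N by case: (gP r).
have g_chain r (b : relfree_algebra V) : chain_identity b r.+1 (g r) (M r) by case: (gP r).
have [Q altQ] := alternate_eq0 charPhi leibA g_neq0 g_size g_chain nilA.
have [C symC] := symmetrize_finite charPhi leibA Q.*2 g_neq0 g_size g_chain nilA.
exists C => n l; apply: (colength_le charPhi (Q := Q)) => [ps u Ups le_Q|].
  by move/multilinear_wordspan; apply: altQ.
have [vs le_vs [vsW vsS]] := symC n; exists vs; split=> // [v /vsW|u].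
  by move/multilinear_wordspan.
by move/multilinear_wordspan/vsS/span_seq.
Qed.
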